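(* Let $n \geq 5$. Let $\mathcal{K}$ be a compact set of algebraic curvature tensors on $\mathbb{R}^n$ which is contained in the interior of the cone $\mathrm{PIC}$, and let $T>0$ be given. Then there exist a small positive real number $\theta$, a large positive real number $N$ and a continuous family of closed, convex, $O(n)$-invariant sets $\{\mathcal{G}_t^{(0)}: t \in [0,T]\}$ of algebraic curvature tensors such that: the family $\{\mathcal{G}_t^{(0)}: t \in [0,T]\}$ is invariant under the Hamilton ODE $\frac{d}{dt} R = Q(R)$; $\mathcal{K} \subset \mathcal{G}_0^{(0)}$; and for all $t\in[0,T]$ every $R \in \mathcal{G}_t^{(0)}$ satisfies $R - \theta \, \mathrm{scal}(R) \, \mathrm{id} \odot \mathrm{id} \in \mathrm{PIC}$ and $\mathrm{Ric}(R)_{11}+\mathrm{Ric}(R)_{22} - \theta \, \mathrm{scal}(R) + N \geq 0$ for every pair of orthonormal vectors $\{e_1,e_2\}$.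
   Context: An algebraic curvature tensor on $\mathbb{R}^n$ is a four-linear form $R_{ijkl}$ with $R_{ijkl}=-R_{jikl}=-R_{ijlk}=R_{klij}$ and the first Bianchi identity, with the sign convention that $R_{1212}$ is the sectional curvature of the plane spanned by $e_1,e_2$; $\mathrm{Ric}(R)_{ik}=\sum_p R_{ipkp}$, $\mathrm{scal}(R)=\sum_i \mathrm{Ric}(R)_{ii}$. $\mathrm{PIC}$ is the cone of algebraic curvature tensors with $R_{1313}+R_{1414}+R_{2323}+R_{2424}-2R_{1234}\ge 0$ for all orthonormal four-frames $\{e_1,e_2,e_3,e_4\}$. Kulkarni-Nomizu product: $(A \odot B)_{ijkl} = A_{ik} B_{jl} - A_{il} B_{jk} - A_{jk} B_{il} + A_{jl} B_{ik}$. $Q(R)=R^2+R^\#$, where $(R^2)_{ijkl} = \sum_{p,q} R_{ijpq} R_{klpq}$ and $(R^\#)_{ijkl} = 2 \sum_{p,q} (R_{ipkq} R_{jplq} - R_{iplq} R_{jpkq})$. A family $\{\mathcal{G}_t\}_{t\in[0,T]}$ is invariant under the ODE if for every solution $R(t)$ of $\frac{d}{dt}R=Q(R)$ and every $t_0\in[0,T]$ with $R(t_0)\in\mathcal{G}_{t_0}$ one has $R(t)\in\mathcal{G}_t$ for all $t\in[t_0,T]$ for which the solution exists. *)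

(* Defs.v *)
From HB Require Import structures.
From mathcomp Require Import all_boot all_order all_algebra.
From mathcomp Require Import all_classical all_reals all_analysis.

Set Implicit Arguments.
Unset Strict Implicit.
Unset Printing Implicit Defensive.

Import Order.TTheory GRing.Theory Num.Theory.
Import numFieldNormedType.Exports.

Local Open Scope classical_set_scope.
Local Open Scope ring_scope.

(* A four-tensor on R^n is stored as a row vector, so that it inherits the
   normed module structure (and topology) of row vectors; [tcomp] and [tensor]
   translate between this encoding and the components A_{ijkl}. *)
Notation tensor4 R n := 'rV[R]_((n * n) * (n * n)).

Definition tcomp (R : realType) (n : nat) (A : tensor4 R n)
    (i j k l : 'I_n) : R :=
  A 0 (mxvec_index (mxvec_index i j) (mxvec_index k l)).

Definition tensor (R : realType) (n : nat)
    (F : 'I_n -> 'I_n -> 'I_n -> 'I_n -> R) : tensor4 R n :=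
  mxvec (\matrix_(a < n * n, b < n * n)
    mxvec (\matrix_(i < n, j < n)
      mxvec (\matrix_(k < n, l < n) F i j k l) 0 b) 0 a).

Lemma tensorE (R : realType) (n : nat)
    (F : 'I_n -> 'I_n -> 'I_n -> 'I_n -> R) (i j k l : 'I_n) :
  tcomp (tensor F) i j k l = F i j k l.
Proof. by rewrite /tcomp /tensor mxvecE mxE mxvecE mxE mxvecE mxE. Qed.

Lemma tcompK (R : realType) (n : nat) (A : tensor4 R n) :
  tensor (tcomp A) = A.
Proof.
apply/rowP => c; case/mxvec_indexP: c => a b.
case/mxvec_indexP: a => i j; case/mxvec_indexP: b => k l.
exact: tensorE.
Qed.

Definition curvature_tensor (R : realType) (n : nat) : set (tensor4 R n) :=
  [set A | forall i j k l : 'I_n,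
    [/\ tcomp A i j k l = - tcomp A j i k l,
        tcomp A i j k l = - tcomp A i j l k,
        tcomp A i j k l = tcomp A k l i j &
        tcomp A i j k l + tcomp A j k i l + tcomp A k i j l = 0]].

Definition tform (R : realType) (n : nat) (A : tensor4 R n)
    (u v w z : 'rV[R]_n) : R :=
  \sum_(i < n) \sum_(j < n) \sum_(k < n) \sum_(l < n)
    tcomp A i j k l * u 0 i * v 0 j * w 0 k * z 0 l.

Definition Ric (R : realType) (n : nat) (A : tensor4 R n) : 'M[R]_n :=
  \matrix_(i < n, k < n) \sum_(p < n) tcomp A i p k p.

Definition scal (R : realType) (n : nat) (A : tensor4 R n) : R :=
  \sum_(i < n) Ric A i i.

Definition Ric_form (R : realType) (n : nat) (A : tensor4 R n)
    (u v : 'rV[R]_n) : R :=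
  \sum_(i < n) \sum_(k < n) Ric A i k * u 0 i * v 0 k.

Definition dot (R : realType) (n : nat) (u v : 'rV[R]_n) : R :=
  \sum_(i < n) u 0 i * v 0 i.

Definition orthonormal_frame (R : realType) (n : nat) (s : seq 'rV[R]_n) : Prop :=
  forall i j : nat, (i < size s)%N -> (j < size s)%N ->
    dot s`_i s`_j = (i == j)%:R.

Definition PIC (R : realType) (n : nat) : set (tensor4 R n) :=
  [set A | curvature_tensor A /\
    forall e1 e2 e3 e4 : 'rV[R]_n, orthonormal_frame [:: e1; e2; e3; e4] ->
      0 <= tform A e1 e3 e1 e3 + tform A e1 e4 e1 e4
         + tform A e2 e3 e2 e3 + tform A e2 e4 e2 e4
         - 2 * tform A e1 e2 e3 e4].

(* Kulkarni-Nomizu product *)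
Definition KN (R : realType) (n : nat) (A B : 'M[R]_n) : tensor4 R n :=
  tensor (fun i j k l =>
    A i k * B j l - A i l * B j k - A j k * B i l + A j l * B i k).

Definition Rsquare (R : realType) (n : nat) (A : tensor4 R n) : tensor4 R n :=
  tensor (fun i j k l =>
    \sum_(p < n) \sum_(q < n) tcomp A i j p q * tcomp A k l p q).

Definition Rsharp (R : realType) (n : nat) (A : tensor4 R n) : tensor4 R n :=
  tensor (fun i j k l =>
    2 * \sum_(p < n) \sum_(q < n)
      (tcomp A i p k q * tcomp A j p l q - tcomp A i p l q * tcomp A j p k q)).

Definition Q (R : realType) (n : nat) (A : tensor4 R n) : tensor4 R n :=
  Rsquare A + Rsharp A.

(* Pull-back of A by the linear map sending the i-th basis vector to the i-th
   row of g *)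
Definition pullback (R : realType) (n : nat) (g : 'M[R]_n) (A : tensor4 R n) :
    tensor4 R n :=
  tensor (fun i j k l => tform A (row i g) (row j g) (row k g) (row l g)).

Definition O_invariant (R : realType) (n : nat) (G : set (tensor4 R n)) :
    Prop :=
  forall g : 'M[R]_n, g *m g^T = 1%:M ->
  forall A : tensor4 R n, G A -> G (pullback g A).

(* Interior of A relative to the subspace D: the space of curvature tensors
   has empty interior in the space of all four-tensors. *)
Definition interior_in (V : topologicalType) (D A : set V) : set V :=
  [set x | D x /\ within D (nbhs x) A].

(* X is a solution of X' = Q(X) in the space of algebraic curvature tensors
   on the interval I; derivatives are taken within I, hence are one-sided at
   the endpoints belonging to I. *)
Definition Hamilton_solution (R : realType) (n : nat) (I : set R)
    (X : R -> tensor4 R n) : Prop :=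
  forall t : R, I t ->
    curvature_tensor (X t) /\
    (s - t)^-1 *: (X s - X t) @[s --> within I t^'] --> Q (X t).

Definition Hamilton_invariant (R : realType) (n : nat) (T : R)
    (G : R -> set (tensor4 R n)) : Prop :=
  forall (I : set R) (X : R -> tensor4 R n),
    is_interval I -> Hamilton_solution I X ->
  forall t0 : R, I t0 -> 0 <= t0 <= T -> G t0 (X t0) ->
  forall t : R, I t -> t0 <= t <= T -> G t (X t).

(* Continuity of a family of (possibly unbounded) closed sets, with respect to
   the Hausdorff distance localised to bounded regions; for closed subsets of a
   finite-dimensional space this is Painleve-Kuratowski continuity. *)
Definition near_in_ball (R : realType) (V : normedModType R) (r eps : R)
    (A B : set V) : Prop :=
  forall x, A x -> `|x| <= r -> exists2 y, B y & `|x - y| < eps.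

Definition continuous_family (R : realType) (V : normedModType R) (T : R)
    (G : R -> set V) : Prop :=
  forall t0 : R, 0 <= t0 <= T -> forall r eps : R, 0 < eps ->
    \forall t \near within `[0, T] (nbhs t0),
      near_in_ball r eps (G t) (G t0) /\ near_in_ball r eps (G t0) (G t).

(* Main.v *)
Require Import Defs.
From HB Require Import structures.
From mathcomp Require Import all_boot all_order all_algebra.
From mathcomp Require Import all_classical all_reals all_analysis.
From mathcomp Require Import ring lra.

(* One set [pinching_set] serves for all times. Let r and s be the Ricci and
   scalar curvature of R; the set is cut out by the conditions, for all
   orthonormal frames,
     (1) R - b r (.) id + (gam s - del) id (.) id lies in PIC,
     (2) (1 + kap) r_11 + (1 - kap) r_22 - 2 R_1212 + kap s / (16 n) >= 0,
     (3) r_11 + r_22 - 2 th s + N >= 0,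
   with gam = (1/2 + 1/(4n)) b^2 and th = (1 - 1/(16n)) b, where first del (the
   distance of the compact set to the boundary of PIC) and N are chosen, then a
   small kap, and finally a tiny b. Each condition is linear in R and the three
   families are permuted by O(n), so by compactness of O(n) the set is invariant
   as soon as each functional has a positive derivative along Q wherever it
   vanishes on the set. For (1), this derivative is the one of the PIC cone,
   which is nonnegative (the first and second variations over all isotropic
   planes, and the trace of a product of two nonnegative forms), plus terms in r
   and s that are controlled by the lower bound (3) on isotropic planes. For (2)
   and (3) the first variation kills the off-diagonal Ricci terms, and the
   operators p, q |-> R_1p1q + R_2p2q can be diagonalised on the orthogonal
   complement of the plane; (2) bounds r_11 - r_22 and r_12 in the evolution of
   (3), where only r_11 + r_22 is known. *)

Set Implicit Arguments.
Unset Strict Implicit.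
Unset Printing Implicit Defensive.

Import Order.TTheory GRing.Theory Num.Theory.
Import numFieldNormedType.Exports.

Local Open Scope classical_set_scope.
Local Open Scope ring_scope.

(** * Equivariance under the orthogonal group *)

(** Strict positivity at the boundary makes invariance elementary: at an active frame the difference
    quotients of the functional are positive, and no tangent cone or Lipschitz estimate enters. The
    price is that each derivative needs positive slack, and the constants create it. Since
    scal(Q(R)) = 2 |r|^2, a gam above b^2 / 2 leaves 4 b^2 |r|^2 / n in the derivative of (1), and a
    th below b leaves b |r|^2 / (4 n) in that of (3). Yet th must agree with b up to a relative
    error of order 1/n, because (1) uses (3) to cancel its leading losses. In (2) the slack comes
    from r_22 - r_11, which the term kap s / (16 n) forces to be at least s / (16 n) on the
    boundary, while the errors carry a factor kap. The order of the choices follows: bounding r_11 -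
    r_22 through (2) costs a factor 1 / kap, so b is compared with kap^2, and b N has to be small
    against del. *)

Lemma tform_lin1 (R : realType) n (A : tensor4 R n) (v w z : 'rV[R]_n) c u1 u2 :
  tform A (c *: u1 + u2) v w z = c * tform A u1 v w z + tform A u2 v w z.
Proof.
rewrite /tform; do 4![rewrite mulr_sumr -big_split; apply: eq_bigr => ? _ /=].
by rewrite !mxE; ring.
Qed.

Lemma tform_lin2 (R : realType) n (A : tensor4 R n) (u w z : 'rV[R]_n) c v1 v2 :
  tform A u (c *: v1 + v2) w z = c * tform A u v1 w z + tform A u v2 w z.
Proof.
rewrite /tform; do 4![rewrite mulr_sumr -big_split; apply: eq_bigr => ? _ /=].
by rewrite !mxE; ring.
Qed.

Lemma tform_lin3 (R : realType) n (A : tensor4 R n) (u v z : 'rV[R]_n) c w1 w2 :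
  tform A u v (c *: w1 + w2) z = c * tform A u v w1 z + tform A u v w2 z.
Proof.
rewrite /tform; do 4![rewrite mulr_sumr -big_split; apply: eq_bigr => ? _ /=].
by rewrite !mxE; ring.
Qed.

Lemma tform_lin4 (R : realType) n (A : tensor4 R n) (u v w : 'rV[R]_n) c z1 z2 :
  tform A u v w (c *: z1 + z2) = c * tform A u v w z1 + tform A u v w z2.
Proof.
rewrite /tform; do 4![rewrite mulr_sumr -big_split; apply: eq_bigr => ? _ /=].
by rewrite !mxE; ring.
Qed.

Definition ev (R : realType) n (i : 'I_n) : 'rV[R]_n := delta_mx 0 i.
Arguments ev {R n} i.

Lemma lin_expand (R : realType) n (f : 'rV[R]_n -> R) :
  (forall c u v, f (c *: u + v) = c * f u + f v) ->
  forall u, f u = \sum_a u 0 a * f (ev a).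
Proof.
move=> fl u; have f0 : f 0 = 0.
  by have := fl (-1) 0 0; rewrite scaler0 addr0 => h; lra.
rewrite {1}[u]row_sum_delta.
elim/big_rec2: _ => [//|i y1 y2 _ <-]; exact: fl.
Qed.

Lemma sum_delta (R : realType) n (F : 'I_n -> R) (i : 'I_n) :
  \sum_a F a * (a == i)%:R = F i.
Proof.
rewrite (bigD1 i) //= eqxx mulr1 big1 ?addr0 // => a /negPf ->.
by rewrite mulr0.
Qed.

Lemma sum_deltal (R : realType) n (F : 'I_n -> R) (i : 'I_n) :
  \sum_a (a == i)%:R * F a = F i.
Proof. by rewrite -[RHS](sum_delta F); apply: eq_bigr => a _; rewrite mulrC. Qed.

Lemma evE (R : realType) n (i j : 'I_n) : ev i 0 j = (j == i)%:R :> R.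
Proof. by rewrite mxE eqxx. Qed.

Lemma tform_ev (R : realType) n (A : tensor4 R n) (i j k l : 'I_n) :
  tform A (ev i) (ev j) (ev k) (ev l) = tcomp A i j k l.
Proof.
rewrite /tform.
under eq_bigr do under eq_bigr do under eq_bigr do under eq_bigr do rewrite !evE.
under eq_bigr do under eq_bigr do under eq_bigr do rewrite sum_delta.
under eq_bigr do under eq_bigr do rewrite sum_delta.
under eq_bigr do rewrite sum_delta.
by rewrite sum_delta.
Qed.

(** Lifts identities known for components, such as the curvature symmetries and the formula for [Q],
    to arbitrary vectors. *)
Lemma multilinear4_eq (R : realType) n (f h : 'rV[R]_n -> 'rV[R]_n -> 'rV[R]_n -> 'rV[R]_n -> R) :
  (forall v w z c u1 u2, f (c *: u1 + u2) v w z = c * f u1 v w z + f u2 v w z) ->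
  (forall u w z c u1 u2, f u (c *: u1 + u2) w z = c * f u u1 w z + f u u2 w z) ->
  (forall u v z c u1 u2, f u v (c *: u1 + u2) z = c * f u v u1 z + f u v u2 z) ->
  (forall u v w c u1 u2, f u v w (c *: u1 + u2) = c * f u v w u1 + f u v w u2) ->
  (forall v w z c u1 u2, h (c *: u1 + u2) v w z = c * h u1 v w z + h u2 v w z) ->
  (forall u w z c u1 u2, h u (c *: u1 + u2) w z = c * h u u1 w z + h u u2 w z) ->
  (forall u v z c u1 u2, h u v (c *: u1 + u2) z = c * h u v u1 z + h u v u2 z) ->
  (forall u v w c u1 u2, h u v w (c *: u1 + u2) = c * h u v w u1 + h u v w u2) ->
  (forall i j k l, f (ev i) (ev j) (ev k) (ev l) = h (ev i) (ev j) (ev k) (ev l)) ->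
  forall u v w z, f u v w z = h u v w z.
Proof.
move=> f1 f2 f3 f4 h1 h2 h3 h4 fh u v w z.
rewrite (lin_expand (f1 v w z)) (lin_expand (h1 v w z)); apply: eq_bigr => i _.
congr (_ * _).
rewrite (lin_expand (f2 _ w z)) (lin_expand (h2 _ w z)); apply: eq_bigr => j _.
congr (_ * _).
rewrite (lin_expand (f3 _ _ z)) (lin_expand (h3 _ _ z)); apply: eq_bigr => k _.
congr (_ * _).
rewrite (lin_expand (f4 _ _ _)) (lin_expand (h4 _ _ _)); apply: eq_bigr => l _.
by rewrite fh.
Qed.

Definition orthogonal_mx (R : realType) n (g : 'M[R]_n) := g *m g^T = 1%:M.

Lemma orthogonal_mx_row (R : realType) n (g : 'M[R]_n) : orthogonal_mx g ->
  forall i j, \sum_a g i a * g j a = (i == j)%:R.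
Proof.
move=> gO i j; have /matrixP/(_ i j) := gO; rewrite !mxE => <-.
by apply: eq_bigr => a _; rewrite mxE.
Qed.

Lemma orthogonal_mx_col (R : realType) n (g : 'M[R]_n) : orthogonal_mx g ->
  forall i j, \sum_a g a i * g a j = (i == j)%:R.
Proof.
move=> /mulmx1C gO i j; have /matrixP/(_ i j) := gO; rewrite !mxE => <-.
by apply: eq_bigr => a _; rewrite mxE.
Qed.

Lemma orthogonal_mxM (R : realType) n (g h : 'M[R]_n) :
  orthogonal_mx g -> orthogonal_mx h -> orthogonal_mx (g *m h).
Proof.
rewrite /orthogonal_mx => gO hO.
by rewrite trmx_mul mulmxA -(mulmxA g) hO mulmx1.
Qed.

Lemma orthogonal_mx1 (R : realType) n : orthogonal_mx (1%:M : 'M[R]_n).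
Proof. by rewrite /orthogonal_mx trmx1 mulmx1. Qed.

(** A contraction may be taken in any orthonormal basis: expanding both factors leaves products of
    columns of [g], and these are orthonormal because [g^T] is orthogonal too. *)
Lemma sum_orthogonal (R : realType) n (g : 'M[R]_n) (f h : 'rV[R]_n -> R) :
  orthogonal_mx g ->
  (forall c u v, f (c *: u + v) = c * f u + f v) ->
  (forall c u v, h (c *: u + v) = c * h u + h v) ->
  \sum_p f (row p g) * h (row p g) = \sum_p f (ev p) * h (ev p).
Proof.
move=> gO fl hl.
under eq_bigr => p _ do rewrite (lin_expand fl (row p g)) (lin_expand hl (row p g)) mulr_suml.
under eq_bigr => p _ do under eq_bigr => a _ do rewrite mulr_sumr.
rewrite exchange_big /=; apply: eq_bigr => a _.
rewrite exchange_big /=.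
rewrite -[RHS](sum_delta (fun b => f (ev a) * h (ev b))); apply: eq_bigr => b _.
rewrite [(b == a)]eq_sym -(orthogonal_mx_col gO a b) mulr_sumr; apply: eq_bigr => p _.
by rewrite !mxE; ring.
Qed.

Lemma sum_orthogonal2 (R : realType) n (g : 'M[R]_n) (f : 'rV[R]_n -> 'rV[R]_n -> R) :
  orthogonal_mx g ->
  (forall w c u v, f (c *: u + v) w = c * f u w + f v w) ->
  (forall w c u v, f w (c *: u + v) = c * f w u + f w v) ->
  \sum_p f (row p g) (row p g) = \sum_p f (ev p) (ev p).
Proof.
move=> gO f1 f2.
under eq_bigr => p _ do rewrite (lin_expand (f1 _) (row p g)).
under eq_bigr => p _ do under eq_bigr => a _ do rewrite (lin_expand (f2 _) (row p g)) mulr_sumr.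
rewrite exchange_big /=; apply: eq_bigr => a _.
rewrite exchange_big /=.
rewrite -[RHS](sum_delta (fun b => f (ev a) (ev b))); apply: eq_bigr => b _.
rewrite [(b == a)]eq_sym -(orthogonal_mx_col gO a b) mulr_sumr; apply: eq_bigr => p _.
by rewrite !mxE; ring.
Qed.

(** Arguments are arbitrary vectors while the contractions run over the standard basis; [pullbackQ]
    needs the two separated, since it rotates the contraction basis only. *)
Definition Qform (R : realType) n (A : tensor4 R n) (u v w z : 'rV[R]_n) : R :=
  \sum_p \sum_q tform A u v (ev p) (ev q) * tform A w z (ev p) (ev q) +
  2 * \sum_p \sum_q (tform A u (ev p) w (ev q) * tform A v (ev p) z (ev q)
    - tform A u (ev p) z (ev q) * tform A v (ev p) w (ev q)).

Lemma tcompD (R : realType) n (A B : tensor4 R n) i j k l :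
  tcomp (A + B) i j k l = tcomp A i j k l + tcomp B i j k l.
Proof. by rewrite /tcomp mxE. Qed.

Lemma tcompZ (R : realType) n c (A : tensor4 R n) i j k l :
  tcomp (c *: A) i j k l = c * tcomp A i j k l.
Proof. by rewrite /tcomp mxE. Qed.

Lemma tcomp_inj (R : realType) n (A B : tensor4 R n) :
  (forall i j k l, tcomp A i j k l = tcomp B i j k l) -> A = B.
Proof.
move=> AB; rewrite -(tcompK A) -(tcompK B) /tensor; congr mxvec.
apply/matrixP => a b; rewrite !mxE.
case/mxvec_indexP: a => i j; case/mxvec_indexP: b => k l.
by rewrite !mxvecE !mxE !mxvecE !mxE.
Qed.

Lemma tcompQ (R : realType) n (A : tensor4 R n) i j k l :
  tcomp (Q A) i j k l =
  \sum_p \sum_q tcomp A i j p q * tcomp A k l p q +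
  2 * \sum_p \sum_q (tcomp A i p k q * tcomp A j p l q - tcomp A i p l q * tcomp A j p k q).
Proof. by rewrite tcompD !tensorE. Qed.

Lemma Qform_lin (R : realType) n (A : tensor4 R n) :
  [/\ forall v w z c u1 u2, Qform A (c *: u1 + u2) v w z = c * Qform A u1 v w z + Qform A u2 v w z,
      forall u w z c u1 u2, Qform A u (c *: u1 + u2) w z = c * Qform A u u1 w z + Qform A u u2 w z,
      forall u v z c u1 u2, Qform A u v (c *: u1 + u2) z = c * Qform A u v u1 z + Qform A u v u2 z &
      forall u v w c u1 u2, Qform A u v w (c *: u1 + u2) = c * Qform A u v w u1 + Qform A u v w u2].
Proof.
split=> *; rewrite /Qform !mulrDr addrACA !mulr_sumr; congr (_ + _);
  rewrite -big_split /=; apply: eq_bigr => p _; rewrite ?mulr_sumr -big_split /=;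
  apply: eq_bigr => q _; rewrite ?(tform_lin1, tform_lin2, tform_lin3, tform_lin4); ring.
Qed.

Lemma tformQ (R : realType) n (A : tensor4 R n) u v w z :
  tform (Q A) u v w z = Qform A u v w z.
Proof.
have [Q1 Q2 Q3 Q4] := Qform_lin A; move: u v w z.
apply: multilinear4_eq => //; try by move=> *; rewrite ?(tform_lin1, tform_lin2, tform_lin3, tform_lin4).
move=> i j k l; rewrite tform_ev tcompQ /Qform.
by congr (_ + 2 * _); apply: eq_bigr => p _; apply: eq_bigr => q _; rewrite !tform_ev.
Qed.

Lemma tcomp_pullback (R : realType) n (g : 'M[R]_n) (A : tensor4 R n) i j k l :
  tcomp (pullback g A) i j k l = tform A (row i g) (row j g) (row k g) (row l g).
Proof. exact: tensorE. Qed.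

Lemma sum_orthogonal_bilin (R : realType) n (g : 'M[R]_n) (f h : 'rV[R]_n -> 'rV[R]_n -> R) :
  orthogonal_mx g ->
  (forall w c u v, f (c *: u + v) w = c * f u w + f v w) ->
  (forall w c u v, f w (c *: u + v) = c * f w u + f w v) ->
  (forall w c u v, h (c *: u + v) w = c * h u w + h v w) ->
  (forall w c u v, h w (c *: u + v) = c * h w u + h w v) ->
  \sum_p \sum_q f (row p g) (row q g) * h (row p g) (row q g) =
  \sum_p \sum_q f (ev p) (ev q) * h (ev p) (ev q).
Proof.
move=> gO f1 f2 h1 h2.
under eq_bigr => p _ do rewrite (sum_orthogonal gO (f2 _) (h2 _)).
rewrite exchange_big [RHS]exchange_big /=; apply: eq_bigr => q _.
exact: (sum_orthogonal gO (f1 _) (h1 _)).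
Qed.

Lemma pullbackQ (R : realType) n (g : 'M[R]_n) (A : tensor4 R n) :
  orthogonal_mx g -> Q (pullback g A) = pullback g (Q A).
Proof.
move=> gO; apply: tcomp_inj => i j k l.
rewrite tcomp_pullback tformQ tcompQ /Qform.
under eq_bigr do under eq_bigr do rewrite !tcomp_pullback.
under [X in 2 * X]eq_bigr do under eq_bigr do rewrite !tcomp_pullback.
congr (_ + 2 * _).
  apply: (@sum_orthogonal_bilin _ _ _ (tform A (row i g) (row j g)) (tform A (row k g) (row l g))) => //;
  by move=> *; rewrite ?(tform_lin3, tform_lin4).
under eq_bigr do rewrite sumrB; under [RHS]eq_bigr do rewrite sumrB.
rewrite !sumrB; congr (_ - _).
  apply: (@sum_orthogonal_bilin _ _ _ (fun x => tform A (row i g) x (row k g))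
    (fun x => tform A (row j g) x (row l g))) => //;
  by move=> *; rewrite ?(tform_lin2, tform_lin4).
apply: (@sum_orthogonal_bilin _ _ _ (fun x => tform A (row i g) x (row l g))
    (fun x => tform A (row j g) x (row k g))) => //;
  by move=> *; rewrite ?(tform_lin2, tform_lin4).
Qed.

Lemma tform_pullback (R : realType) n (g : 'M[R]_n) (A : tensor4 R n) u v w z :
  tform (pullback g A) u v w z = tform A (u *m g) (v *m g) (w *m g) (z *m g).
Proof.
move: u v w z; apply: multilinear4_eq => //; try by move=> *;
  rewrite ?mulmxDl -?scalemxAl ?(tform_lin1, tform_lin2, tform_lin3, tform_lin4).
by move=> i j k l; rewrite tform_ev tcomp_pullback /ev -!rowE.
Qed.

Lemma pullbackM (R : realType) n (g h : 'M[R]_n) (A : tensor4 R n) :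
  pullback g (pullback h A) = pullback (g *m h) A.
Proof.
apply: tcomp_inj => i j k l.
by rewrite !tcomp_pullback tform_pullback !row_mul.
Qed.

Lemma RicE (R : realType) n (A : tensor4 R n) i k : Ric A i k = \sum_p tcomp A i p k p.
Proof. by rewrite mxE. Qed.

Lemma Ric_pullback (R : realType) n (g : 'M[R]_n) (A : tensor4 R n) :
  orthogonal_mx g -> Ric (pullback g A) = g *m Ric A *m g^T.
Proof.
move=> gO; apply/matrixP => i k; rewrite RicE.
under eq_bigr do rewrite tcomp_pullback.
rewrite (@sum_orthogonal2 _ _ g (fun x y => tform A (row i g) x (row k g) y)) //; last 2 first.
- by move=> *; rewrite tform_lin2.
- by move=> *; rewrite tform_lin4.
rewrite mxE.
under eq_bigr => p _ do rewrite (lin_expand (fun c u v => tform_lin1 A (ev p) (row k g) (ev p) c u v) (row i g)).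
under [RHS]eq_bigr => p _ do rewrite mxE mulr_suml.
rewrite exchange_big [RHS]exchange_big /=; apply: eq_bigr => a _.
under eq_bigr => p _ do rewrite (lin_expand (fun c u v => tform_lin3 A (ev a) (ev p) (ev p) c u v) (row k g)) mulr_sumr.
rewrite exchange_big /=; apply: eq_bigr => b _.
rewrite RicE mulr_sumr mulr_suml; apply: eq_bigr => p _.
by rewrite tform_ev !mxE; ring.
Qed.

Lemma scalE (R : realType) n (A : tensor4 R n) : scal A = \tr (Ric A).
Proof. by []. Qed.

Lemma scal_pullback (R : realType) n (g : 'M[R]_n) (A : tensor4 R n) :
  orthogonal_mx g -> scal (pullback g A) = scal A.
Proof.
move=> gO; rewrite !scalE Ric_pullback // mxtrace_mulC mulmxA.
by rewrite (mulmx1C gO) mul1mx.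
Qed.

Lemma pullbackD (R : realType) n (g : 'M[R]_n) (A B : tensor4 R n) :
  pullback g (A + B) = pullback g A + pullback g B.
Proof.
apply: tcomp_inj => i j k l; rewrite tcompD !tcomp_pullback /tform.
do 4![rewrite -big_split; apply: eq_bigr => ? _ /=].
by rewrite tcompD; ring.
Qed.

Lemma pullbackZ (R : realType) n (g : 'M[R]_n) c (A : tensor4 R n) :
  pullback g (c *: A) = c *: pullback g A.
Proof.
apply: tcomp_inj => i j k l; rewrite tcompZ !tcomp_pullback /tform.
do 4![rewrite mulr_sumr; apply: eq_bigr => ? _ /=].
by rewrite tcompZ; ring.
Qed.

Lemma KNE (R : realType) n (A B : 'M[R]_n) i j k l : tcomp (KN A B) i j k l =
  A i k * B j l - A i l * B j k - A j k * B i l + A j l * B i k.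
Proof. exact: tensorE. Qed.

Lemma pullback_KN (R : realType) n (g A B : 'M[R]_n) :
  pullback g (KN A B) = KN (g *m A *m g^T) (g *m B *m g^T).
Proof.
pose bf (M : 'M[R]_n) (u v : 'rV[R]_n) := (u *m M *m v^T) 0 0.
have bf1 M w c u v : bf M (c *: u + v) w = c * bf M u w + bf M v w.
  by rewrite /bf !mulmxDl -!scalemxAl mxE mxE.
have bf2 M w c u v : bf M w (c *: u + v) = c * bf M w u + bf M w v.
  by rewrite /bf linearP mulmxDr -scalemxAr mxE mxE.
have bfe M i j : bf M (ev i) (ev j) = M i j.
  by rewrite /bf -rowE mxE; under eq_bigr do rewrite !mxE eqxx; rewrite sum_delta.
have bfg M i j : bf M (row i g) (row j g) = (g *m M *m g^T) i j.
  by rewrite /bf -row_mul mxE [RHS]mxE; apply: eq_bigr => a _; rewrite !mxE.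
have H : forall u v w z, tform (KN A B) u v w z =
   bf A u w * bf B v z - bf A u z * bf B v w - bf A v w * bf B u z + bf A v z * bf B u w.
  apply: multilinear4_eq; try by move=> *;
    rewrite ?(tform_lin1, tform_lin2, tform_lin3, tform_lin4, bf1, bf2) //; ring.
  by move=> i j k l; rewrite tform_ev KNE !bfe.
by apply: tcomp_inj => i j k l; rewrite tcomp_pullback H KNE !bfg.
Qed.

(** * The quadratic term of the Hamilton ODE on Kulkarni-Nomizu products *)

Section Curvature.
Variables (R : realType) (n : nat).
Implicit Types (A B S T : tensor4 R n) (M N : 'M[R]_n).

Lemma curv_antil S i j k l : curvature_tensor S -> tcomp S i j k l = - tcomp S j i k l.
Proof. by move=> /(_ i j k l)[]. Qed.

Lemma curv_antir S i j k l : curvature_tensor S -> tcomp S i j k l = - tcomp S i j l k.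
Proof. by move=> /(_ i j k l)[]. Qed.

Lemma curv_sym S i j k l : curvature_tensor S -> tcomp S i j k l = tcomp S k l i j.
Proof. by move=> /(_ i j k l)[]. Qed.

Lemma curv_bianchi S i j k l : curvature_tensor S ->
  tcomp S i j k l + tcomp S j k i l + tcomp S k i j l = 0.
Proof. by move=> /(_ i j k l)[]. Qed.

Lemma curv_iikl S i k l : curvature_tensor S -> tcomp S i i k l = 0.
Proof. by move=> cS; have := curv_antil i i k l cS; lra. Qed.

Lemma curv_ijkk S i j k : curvature_tensor S -> tcomp S i j k k = 0.
Proof. by move=> cS; have := curv_antir i j k k cS; lra. Qed.

Lemma curvD A B : curvature_tensor A -> curvature_tensor B -> curvature_tensor (A + B).
Proof.
move=> cA cB i j k l; have [a1 a2 a3 a4] := cA i j k l; have [b1 b2 b3 b4] := cB i j k l.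
by rewrite !tcompD; split; lra.
Qed.

Lemma curvZ c A : curvature_tensor A -> curvature_tensor (c *: A).
Proof.
move=> cA i j k l; have [a1 a2 a3 a4] := cA i j k l.
rewrite !tcompZ; split; [by rewrite a1 mulrN|by rewrite a2 mulrN|by rewrite a3|].
by rewrite -!mulrDr a4 mulr0.
Qed.

Lemma curvB A B : curvature_tensor A -> curvature_tensor B -> curvature_tensor (A - B).
Proof. by move=> cA cB; rewrite -scaleN1r; apply: curvD => //; apply: curvZ. Qed.

Lemma curv_KN M N : M^T = M -> N^T = N -> curvature_tensor (KN M N).
Proof.
move=> Ms Ns i j k l; rewrite !KNE.
have Me a b : M a b = M b a by rewrite -{1}Ms mxE.
have Ne a b : N a b = N b a by rewrite -{1}Ns mxE.
rewrite (Me k i) (Me l j) (Me l i) (Me k j) (Me j i).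
rewrite (Ne k i) (Ne l j) (Ne l i) (Ne k j) (Ne j i).
by split; ring.
Qed.

Lemma tform_anti S u v w z : curvature_tensor S -> tform S u v w z = - tform S v u w z.
Proof.
move=> cS; move: u v w z; apply: multilinear4_eq; try by move=> *;
  rewrite ?(tform_lin1, tform_lin2, tform_lin3, tform_lin4) //; ring.
by move=> i j k l; rewrite !tform_ev curv_antil.
Qed.

Lemma tform_sym S u v w z : curvature_tensor S -> tform S u v w z = tform S w z u v.
Proof.
move=> cS; move: u v w z; apply: multilinear4_eq; try by move=> *;
  rewrite ?(tform_lin1, tform_lin2, tform_lin3, tform_lin4) //; ring.
by move=> i j k l; rewrite !tform_ev curv_sym.
Qed.

Lemma tform_antir S u v w z : curvature_tensor S -> tform S u v w z = - tform S u v z w.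
Proof. by move=> cS; rewrite tform_sym // tform_anti // tform_sym. Qed.

Lemma tform_bianchi S u v w z : curvature_tensor S ->
  tform S u v w z + tform S v w u z + tform S w u v z = 0.
Proof.
move=> cS; move: u v w z.
apply: (@multilinear4_eq _ _ (fun u v w z => tform S u v w z + tform S v w u z + tform S w u v z)
  (fun _ _ _ _ => 0)); try by move=> *;
  rewrite ?(tform_lin1, tform_lin2, tform_lin3, tform_lin4) ?mulr0 ?addr0 //; ring.
by move=> i j k l; rewrite !tform_ev curv_bianchi.
Qed.

Lemma curv_pullback (g : 'M[R]_n) S : curvature_tensor S -> curvature_tensor (pullback g S).
Proof.
move=> cS i j k l; rewrite !tcomp_pullback; split.
- exact: tform_anti.
- exact: tform_antir.
- exact: tform_sym.
- exact: tform_bianchi.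
Qed.

Lemma Ric_sym S : curvature_tensor S -> (Ric S)^T = Ric S.
Proof.
move=> cS; apply/matrixP => i k; rewrite !mxE.
by apply: eq_bigr => p _; rewrite curv_sym.
Qed.

Lemma Ric_symE S i k : curvature_tensor S -> Ric S i k = Ric S k i.
Proof. by move=> cS; rewrite -{1}(Ric_sym cS) mxE. Qed.

Lemma RicD A B : Ric (A + B) = Ric A + Ric B.
Proof.
apply/matrixP => i k; rewrite !mxE -big_split; apply: eq_bigr => p _.
by rewrite tcompD.
Qed.

Lemma RicZ c A : Ric (c *: A) = c *: Ric A.
Proof.
apply/matrixP => i k; rewrite !mxE mulr_sumr; apply: eq_bigr => p _.
by rewrite tcompZ.
Qed.

Lemma scalD A B : scal (A + B) = scal A + scal B.
Proof. by rewrite !scalE RicD mxtraceD. Qed.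

Lemma scalZ c A : scal (c *: A) = c * scal A.
Proof. by rewrite !scalE RicZ mxtraceZ. Qed.

(** The action of a curvature tensor on bilinear forms. It is the reaction term of the Ricci tensor
    ([Ric_Q]), so the evolution of Ricci curvature is read off its diagonal entries. *)
Definition star S M : 'M[R]_n := \matrix_(i, k) \sum_p \sum_q tcomp S i p k q * M p q.

Definition frobenius M N : R := \sum_p \sum_q M p q * N p q.

Lemma idE i j : (1%:M : 'M[R]_n) i j = (i == j)%:R.
Proof. by rewrite mxE. Qed.

(** The identity factor contributes Kronecker deltas, each of which collapses one sum. [F] is not
    assumed symmetric: it will be a slice of a curvature tensor. *)
Lemma contract_KN12 (F : 'I_n -> 'I_n -> R) M k l :
  \sum_p \sum_q F p q * tcomp (KN M 1%:M) k l p q =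
  \sum_p M k p * (F p l - F l p) + \sum_p M l p * (F k p - F p k).
Proof.
have -> : \sum_p \sum_q F p q * tcomp (KN M 1%:M) k l p q =
    \sum_p \sum_q (F p q * M k p) * (q == l)%:R - \sum_p \sum_q (F p q * M k q) * (p == l)%:R
    - \sum_p \sum_q (F p q * M l p) * (q == k)%:R + \sum_p \sum_q (F p q * M l q) * (p == k)%:R.
  rewrite -!(sumrB, big_split) /=; apply: eq_bigr => p _.
  rewrite -!(sumrB, big_split) /=; apply: eq_bigr => q _.
  by rewrite KNE !idE !(eq_sym l) !(eq_sym k); ring.
under eq_bigr do rewrite sum_delta.
rewrite [X in _ - X - _]exchange_big /=.
under [X in _ - X - _]eq_bigr do rewrite sum_delta.
under [X in _ - _ - X + _]eq_bigr do rewrite sum_delta.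
rewrite [X in _ - _ + X]exchange_big /=.
under [X in _ - _ + X]eq_bigr do rewrite sum_delta.
rewrite -!(sumrB, big_split) /=; apply: eq_bigr => p _; ring.
Qed.

Lemma contract_KN13 (F : 'I_n -> 'I_n -> R) M i k :
  \sum_p \sum_q F p q * tcomp (KN M 1%:M) i p k q =
  M i k * \sum_p F p p - \sum_q M i q * F k q - \sum_p M p k * F p i
  + (i == k)%:R * \sum_p \sum_q F p q * M p q.
Proof.
have -> : \sum_p \sum_q F p q * tcomp (KN M 1%:M) i p k q =
    \sum_p \sum_q (M i k * F p q) * (q == p)%:R - \sum_p \sum_q (F p q * M i q) * (p == k)%:R
    - \sum_p \sum_q (F p q * M p k) * (q == i)%:R + (i == k)%:R * \sum_p \sum_q F p q * M p q.
  rewrite mulr_sumr -!(sumrB, big_split) /=; apply: eq_bigr => p _.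
  rewrite mulr_sumr -!(sumrB, big_split) /=; apply: eq_bigr => q _.
  by rewrite KNE !idE (eq_sym i q) (eq_sym p q); ring.
under eq_bigr do rewrite sum_delta.
rewrite [X in _ - X - _]exchange_big /=.
under [X in _ - X - _]eq_bigr do rewrite sum_delta.
under [X in _ - _ - X + _]eq_bigr do rewrite sum_delta.
rewrite -mulr_sumr; congr (_ - _ - _ + _); apply: eq_bigr => p _; exact: mulrC.
Qed.

(** Polarisation of [Q]: the part of [Q (S + T)] that is linear in each of [S] and [T]. *)
Definition Qcross S T i j k l : R :=
  \sum_p \sum_q (tcomp S i j p q * tcomp T k l p q + tcomp S k l p q * tcomp T i j p q) +
  2 * (\sum_p \sum_q (tcomp S i p k q * tcomp T j p l q + tcomp S j p l q * tcomp T i p k q)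
    - \sum_p \sum_q (tcomp S i p l q * tcomp T j p k q + tcomp S j p k q * tcomp T i p l q)).

Lemma tcompQD S T i j k l :
  tcomp (Q (S + T)) i j k l = tcomp (Q S) i j k l + Qcross S T i j k l + tcomp (Q T) i j k l.
Proof.
have split3 (F G H K : 'I_n -> 'I_n -> R) : (forall p q, F p q = G p q + H p q + K p q) ->
    \sum_p \sum_q F p q = \sum_p \sum_q G p q + \sum_p \sum_q H p q + \sum_p \sum_q K p q.
  move=> FE; rewrite -!big_split; apply: eq_bigr => p _.
  by rewrite -!big_split; apply: eq_bigr => q _; rewrite FE.
rewrite !tcompQ /Qcross -[in RHS]sumrB.
under [X in _ = _ + (_ + 2 * X) + _]eq_bigr do rewrite -sumrB.
rewrite (split3 _ (fun p q => tcomp S i j p q * tcomp S k l p q)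
  (fun p q => tcomp S i j p q * tcomp T k l p q + tcomp S k l p q * tcomp T i j p q)
  (fun p q => tcomp T i j p q * tcomp T k l p q)); last by move=> p q; rewrite !tcompD; ring.
rewrite [X in _ + 2 * X = _](split3 _
  (fun p q => tcomp S i p k q * tcomp S j p l q - tcomp S i p l q * tcomp S j p k q)
  (fun p q => tcomp S i p k q * tcomp T j p l q + tcomp S j p l q * tcomp T i p k q
    - (tcomp S i p l q * tcomp T j p k q + tcomp S j p k q * tcomp T i p l q))
  (fun p q => tcomp T i p k q * tcomp T j p l q - tcomp T i p l q * tcomp T j p k q));
  last by move=> p q; rewrite !tcompD; ring.
ring.
Qed.

Lemma Qcrossxx T i j k l : Qcross T T i j k l = 2 * tcomp (Q T) i j k l.
Proof.
have := tcompQD T T i j k l.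
have -> : tcomp (Q (T + T)) i j k l = 4 * tcomp (Q T) i j k l.
  have -> : T + T = 2 *: T by rewrite scaler_nat mulr2n.
  have sc (F G : 'I_n -> 'I_n -> R) : (forall p q, F p q = 4 * G p q) ->
      \sum_p \sum_q F p q = 4 * \sum_p \sum_q G p q.
    move=> FE; rewrite mulr_sumr; apply: eq_bigr => p _.
    by rewrite mulr_sumr; apply: eq_bigr => q _; rewrite FE.
  rewrite !tcompQ (sc _ (fun p q => tcomp T i j p q * tcomp T k l p q)); last first.
    by move=> p q; rewrite !tcompZ; ring.
  rewrite [X in _ + 2 * X = _](sc _ (fun p q => tcomp T i p k q * tcomp T j p l q - tcomp T i p l q * tcomp T j p k q));
    first by ring.
  by move=> p q; rewrite !tcompZ; ring.
lra.
Qed.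

(** Contractions of [M] with [S] that are neither of Ricci nor of [star] type arise from both halves
    of [Q]. The Bianchi identity ([E] below) turns those of the square part into those of the sharp
    part, and they cancel. *)
Lemma Qcross_KN S M i j k l : curvature_tensor S -> M^T = M ->
  Qcross S (KN M 1%:M) i j k l =
  2 * tcomp (KN (star S M) 1%:M) i j k l + 2 * tcomp (KN (Ric S) M) i j k l.
Proof.
move=> cS Ms.
have Me a b : M a b = M b a by rewrite -{1}Ms mxE.
rewrite /Qcross.
under eq_bigr do rewrite big_split /=.
rewrite [X in X + _ = _]big_split /=.
rewrite !contract_KN12.
under [X in _ + 2 * (X - _)]eq_bigr do rewrite big_split /=.
under [X in _ + 2 * (_ - X)]eq_bigr do rewrite big_split /=.
rewrite [X in _ + 2 * (X - _)]big_split [X in _ + 2 * (_ - X)]big_split /=.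
rewrite !contract_KN13 !KNE !idE !mxE.
have E x y z w : \sum_p M x p * (tcomp S y z p w - tcomp S y z w p) =
    2 * (\sum_p M p x * tcomp S z p w y) - 2 * (\sum_p M p x * tcomp S y p w z).
  rewrite !mulr_sumr -sumrB; apply: eq_bigr => p _; rewrite (Me p x).
  have := curv_bianchi y z p w cS.
  rewrite (curv_antir z p y w cS) (curv_antil p y z w cS) (curv_antir y p z w cS).
  rewrite (curv_antir y z w p cS) => h.
  by apply/subr0_eq; rewrite -[RHS](mulr0 (2 * M x p)) -h; ring.
have E' x y z w : \sum_p M x p * (tcomp S y z w p - tcomp S y z p w) =
    - (\sum_p M x p * (tcomp S y z p w - tcomp S y z w p)).
  by rewrite -sumrN; apply: eq_bigr => p _; ring.
have F x y z w : \sum_p M x p * tcomp S y z w p = \sum_p M p x * tcomp S w p y z.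
  by apply: eq_bigr => p _; rewrite (Me p x) curv_sym.
rewrite !E' !E !F.
ring.
Qed.

Lemma Ric_KN1 M : Ric (KN M 1%:M) = (n%:R - 2) *: M + (\tr M) *: 1%:M.
Proof.
apply/matrixP => i k; rewrite RicE !mxE.
have -> : \sum_p tcomp (KN M 1%:M) i p k p = \sum_(p < n) M i k - \sum_p M i p * (p == k)%:R
    - \sum_p M p k * (p == i)%:R + (\sum_p M p p) * (i == k)%:R.
  rewrite mulr_suml -!(sumrB, big_split) /=; apply: eq_bigr => p _.
  by rewrite KNE !idE eqxx (eq_sym i p) mulr1.
rewrite !sum_delta sumr_const card_ord /mxtrace -mulr_natl; ring.
Qed.

Lemma star_KN1 M : M^T = M ->
  star (KN M 1%:M) M = (\tr M) *: M - 2 *: (M *m M) + (frobenius M M) *: 1%:M.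
Proof.
move=> Ms; have Me a b : M a b = M b a by rewrite -{1}Ms mxE.
apply/matrixP => i k; rewrite mxE.
under eq_bigr do under eq_bigr do rewrite mulrC.
rewrite contract_KN13 !mxE /mxtrace /frobenius.
have -> : \sum_q M i q * M k q = \sum_q M i q * M q k by apply: eq_bigr => q _; rewrite (Me k).
have -> : \sum_p M p k * M p i = \sum_q M i q * M q k.
  by apply: eq_bigr => q _; rewrite mulrC (Me i).
ring.
Qed.

(** [C1] and [C2] are the two quadratic contractions of [S] that could survive besides [star]. The
    Bianchi identity gives C1 = 2 C1 - 2 C2, so the trace of the square part, C1, cancels against
    the -2 C2 of the sharp part. *)
Lemma Ric_Q S : curvature_tensor S -> Ric (Q S) = 2 *: star S (Ric S).
Proof.
move=> cS; apply/matrixP => i k; rewrite RicE !mxE.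
pose C1 := \sum_p \sum_a \sum_b tcomp S i a p b * tcomp S k a p b.
pose C2 := \sum_p \sum_a \sum_b tcomp S i a p b * tcomp S k b p a.
have E1 : \sum_p \sum_a \sum_b tcomp S i p a b * tcomp S k p a b = C1.
  by rewrite exchange_big.
have E2 : \sum_p \sum_a \sum_b tcomp S i p a b * tcomp S k p a b = 2 * C1 - 2 * C2.
  have -> : 2 * C1 - 2 * C2 = C1 + \sum_p \sum_a \sum_b tcomp S i b p a * tcomp S k b p a
      - C2 - \sum_p \sum_a \sum_b tcomp S i b p a * tcomp S k a p b.
    have -> : \sum_p \sum_a \sum_b tcomp S i b p a * tcomp S k b p a = C1.
      by apply: eq_bigr => p _; exact: exchange_big.
    have -> : \sum_p \sum_a \sum_b tcomp S i b p a * tcomp S k a p b = C2.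
      by apply: eq_bigr => p _; exact: exchange_big.
    ring.
  rewrite /C1 /C2 -!(sumrB, big_split); apply: eq_bigr => p _ /=.
  rewrite -!(sumrB, big_split); apply: eq_bigr => a _ /=.
  rewrite -!(sumrB, big_split); apply: eq_bigr => b _ /=.
  have bi x : tcomp S x p a b = tcomp S x a p b - tcomp S x b p a.
    have := curv_bianchi x p a b cS.
    rewrite (curv_sym p a x b cS) (curv_antir x b p a cS) (curv_antil a x p b cS); lra.
  by rewrite !bi; ring.
transitivity (C1 + 2 * (\sum_p \sum_q tcomp S i p k q * Ric S p q - C2)).
  under eq_bigr do rewrite tcompQ.
  rewrite big_split /= E1 -mulr_sumr; congr (_ + 2 * _).
  under [LHS]eq_bigr do under eq_bigr do rewrite sumrB.
  under [LHS]eq_bigr do rewrite sumrB.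
  rewrite sumrB; congr (_ - _).
    rewrite exchange_big; apply: eq_bigr => a _ /=; rewrite exchange_big; apply: eq_bigr => b _ /=.
    by rewrite RicE mulr_sumr; apply: eq_bigr => p _; rewrite (curv_antil p a p b cS) (curv_antir a p p b cS) opprK.
  apply: eq_bigr => p _; apply: eq_bigr => a _; apply: eq_bigr => b _.
  by rewrite (curv_sym p a k b cS).
by move: E2; rewrite E1 => E2; lra.
Qed.

Lemma scal_Q S : curvature_tensor S -> scal (Q S) = 2 * frobenius (Ric S) (Ric S).
Proof.
move=> cS; rewrite scalE Ric_Q // mxtraceZ; congr (2 * _).
have trS p q : \sum_(i < n) tcomp S i p i q = Ric S p q.
  rewrite RicE; apply: eq_bigr => i _.
  by rewrite (curv_antil i p i q cS) (curv_antir p i i q cS) opprK.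
transitivity (\sum_i \sum_p \sum_q tcomp S i p i q * Ric S p q).
  by apply: eq_bigr => i _; rewrite mxE.
transitivity (\sum_p \sum_q (\sum_i tcomp S i p i q) * Ric S p q).
  rewrite exchange_big; apply: eq_bigr => p _; rewrite exchange_big; apply: eq_bigr => q _.
  by rewrite -mulr_suml.
by apply: eq_bigr => p _; apply: eq_bigr => q _; rewrite trS.
Qed.

Lemma KNC M N : KN M N = KN N M.
Proof. by apply: tcomp_inj => i j k l; rewrite !KNE; ring. Qed.

(** No separate computation of [Q (KN M 1%:M)] is necessary: it is half the cross term of
    [KN M 1%:M] with itself, to which [Qcross_KN] applies again. *)
Lemma tcompQ_KN S M i j k l : curvature_tensor S -> M^T = M ->
  tcomp (Q (S + KN M 1%:M)) i j k l = tcomp (Q S) i j k l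
  + 2 * tcomp (KN (star S M) 1%:M) i j k l + 2 * tcomp (KN (Ric S) M) i j k l
  + (n%:R - 2) * tcomp (KN M M) i j k l + 2 * \tr M * tcomp (KN M 1%:M) i j k l
  - 2 * tcomp (KN (M *m M) 1%:M) i j k l + frobenius M M * tcomp (KN 1%:M 1%:M) i j k l.
Proof.
move=> cS Ms; rewrite tcompQD Qcross_KN //.
have /esym := Qcrossxx (KN M 1%:M) i j k l.
rewrite Qcross_KN //; last by apply: curv_KN => //; rewrite trmx1.
have -> : tcomp (KN (star (KN M 1%:M) M) 1%:M) i j k l = \tr M * tcomp (KN M 1%:M) i j k l
    - 2 * tcomp (KN (M *m M) 1%:M) i j k l + frobenius M M * tcomp (KN 1%:M 1%:M) i j k l.
  rewrite star_KN1 //; move: (M *m M) (\tr M) (frobenius M M) => M2 t f.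
  by rewrite !KNE !mxE; ring.
have -> : tcomp (KN (Ric (KN M 1%:M)) M) i j k l = (n%:R - 2) * tcomp (KN M M) i j k l
    + \tr M * tcomp (KN M 1%:M) i j k l.
  rewrite Ric_KN1; move: (\tr M) => t; rewrite !KNE !mxE; ring.
lra.
Qed.

End Curvature.

(** * Compactness of the orthogonal group and partial diagonalisation *)

Section OrthogonalGroup.
Variables (R : realType) (n : nat).

Lemma dotC (u v : 'rV[R]_n) : dot u v = dot v u.
Proof. by apply: eq_bigr => i _; rewrite mulrC. Qed.

Lemma dot_linl c (u v w : 'rV[R]_n) : dot (c *: u + v) w = c * dot u w + dot v w.
Proof.
rewrite /dot mulr_sumr -big_split; apply: eq_bigr => i _ /=; rewrite !mxE; ring.
Qed.

Lemma dot_linr c (u v w : 'rV[R]_n) : dot w (c *: u + v) = c * dot w u + dot w v.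
Proof. by rewrite dotC dot_linl !(dotC w). Qed.

Lemma dotDl (u v w : 'rV[R]_n) : dot (u + v) w = dot u w + dot v w.
Proof. by rewrite -[u]scale1r dot_linl scale1r mul1r. Qed.

Lemma dotDr (u v w : 'rV[R]_n) : dot w (u + v) = dot w u + dot w v.
Proof. by rewrite dotC dotDl !(dotC w). Qed.

Lemma dot0l (u : 'rV[R]_n) : dot 0 u = 0.
Proof. by apply: big1 => i _; rewrite mxE mul0r. Qed.

Lemma dotZl c (u v : 'rV[R]_n) : dot (c *: u) v = c * dot u v.
Proof. by rewrite -[c *: u]addr0 dot_linl dot0l addr0. Qed.

Lemma dotZr c (u v : 'rV[R]_n) : dot v (c *: u) = c * dot v u.
Proof. by rewrite dotC dotZl dotC. Qed.

Lemma dot_ev i j : dot (ev i : 'rV[R]_n) (ev j) = (i == j)%:R.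
Proof. by rewrite /dot; under eq_bigr do rewrite !evE; rewrite sum_deltal eq_sym. Qed.

Lemma dot_ge0 (u : 'rV[R]_n) : 0 <= dot u u.
Proof. by apply: sumr_ge0 => i _; rewrite -expr2 sqr_ge0. Qed.

Lemma dot_eq0 (u : 'rV[R]_n) : dot u u = 0 -> u = 0.
Proof.
move=> /eqP; rewrite psumr_eq0; last by move=> i _; rewrite -expr2 sqr_ge0.
move=> /allP u0; apply/rowP => i; rewrite mxE; apply/eqP.
by have := u0 i; rewrite mem_index_enum => /(_ isT); rewrite mulf_eq0 orbb.
Qed.

Lemma orthogonal_mxP (g : 'M[R]_n) :
  orthogonal_mx g <-> forall i j, dot (row i g) (row j g) = (i == j)%:R.
Proof.
split=> [gO i j|gO].
  rewrite -(orthogonal_mx_row gO); apply: eq_bigr => a _; by rewrite !mxE.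
apply/matrixP => i j; rewrite [RHS]mxE -gO mxE; apply: eq_bigr => a _; by rewrite !mxE.
Qed.

Definition row_rotation (g : 'M[R]_n) (i j : 'I_n) (c s : R) : 'M[R]_n :=
  \matrix_k (if k == i then c *: row i g + s *: row j g else
             if k == j then (- s) *: row i g + c *: row j g else row k g).

Lemma orthogonal_row_rotation (g : 'M[R]_n) (i j : 'I_n) (c s : R) :
  i != j -> c ^+ 2 + s ^+ 2 = 1 -> orthogonal_mx g -> orthogonal_mx (row_rotation g i j c s).
Proof.
move=> ij cs /orthogonal_mxP gO; apply/orthogonal_mxP => k l; rewrite !rowK.
have ji : (j == i) = false by rewrite eq_sym (negPf ij).
have cs' : c * c + s * s = 1 by rewrite -!expr2.
have sgl (x y : 'I_n) : x != y -> ((x == y) = false) * ((y == x) = false).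
  by move=> xy; rewrite (eq_sym y) !(negPf xy).
have [sij sji] := sgl _ _ ij.
by case: (eqVneq k i) => [?|ki]; [|case: (eqVneq k j) => [?|kj]];
  (case: (eqVneq l i) => [?|li]; [|case: (eqVneq l j) => [?|lj]]); subst;
  rewrite /= ?eqxx ?sij ?sji ?(sgl _ _ ki) ?(sgl _ _ kj) ?(sgl _ _ li) ?(sgl _ _ lj) /=;
  rewrite ?(dot_linl, dot_linr, dotZl, dotZr) ?gO ?eqxx ?sij ?sji ?(sgl _ _ ki) ?(sgl _ _ kj)
    ?(sgl _ _ li) ?(sgl _ _ lj) /= ?mulr1n ?mulr0n; first [ring | rewrite -[RHS]cs'; ring].
Qed.

Lemma lin_zero (b M : R) :
  (forall t, -1 <= t <= 1 -> 0 <= b * t + M * t ^+ 2) -> b = 0.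
Proof.
(* The summand [|b|] keeps the test point -b/K inside [-1, 1], and [|M| + 1] makes K - M
   positive. *)
move=> H; pose K := `|M| + `|b| + 1.
have K0 : 0 < K by rewrite /K; have := normr_ge0 M; have := normr_ge0 b; lra.
have Kn0 : K != 0 by rewrite gt_eqF.
have t1 : -1 <= - b / K <= 1.
  rewrite -ler_norml normrM normrN normfV (gtr0_norm K0) ler_pdivrMr // mul1r /K.
  by have := normr_ge0 M; lra.
have := H _ t1; have -> : b * (- b / K) + M * (- b / K) ^+ 2 = - (b ^+ 2 * (K - M)) / K ^+ 2 by field.
rewrite pmulr_lge0 ?invr_gt0 ?exprn_gt0 // oppr_ge0 => h.
have KM : 0 < K - M by rewrite /K; have := ler_norm M; have := normr_ge0 b; lra.
by move: h; rewrite pmulr_lle0 // => h; apply/eqP; rewrite -sqrf_eq0 eq_le h sqr_ge0.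
Qed.

(** First-order condition for a minimum over the rotations of a plane. The rational parametrisation
    of the circle makes the hypothesis polynomial in t, with linear coefficient 4 B, so that
    [lin_zero] applies. *)
Lemma rotation_minimum (D B : R) :
  (forall c s : R, c ^+ 2 + s ^+ 2 = 1 -> 0 <= 2 * c * s * B + s ^+ 2 * D) -> B = 0.
Proof.
move=> step; suff : 4 * B = 0 by lra.
apply: (@lin_zero _ (4 * (`|B| + `|D|))) => t /andP[t1 t2].
have t3 : 0 <= 1 - t ^+ 2 by nra.
have t0 : 0 < 1 + t ^+ 2 by have := sqr_ge0 t; lra.
have tn : 1 + t ^+ 2 != 0 by rewrite gt_eqF.
have := step ((1 - t ^+ 2) / (1 + t ^+ 2)) (2 * t / (1 + t ^+ 2)).
have -> : ((1 - t ^+ 2) / (1 + t ^+ 2)) ^+ 2 + (2 * t / (1 + t ^+ 2)) ^+ 2 = 1 by field.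
move=> /(_ erefl).
have -> : 2 * ((1 - t ^+ 2) / (1 + t ^+ 2)) * (2 * t / (1 + t ^+ 2)) * B +
     (2 * t / (1 + t ^+ 2)) ^+ 2 * D =
  (4 * t * (1 - t ^+ 2) * B + 4 * t ^+ 2 * D) / (1 + t ^+ 2) ^+ 2 by field.
rewrite pmulr_lge0 ?invr_gt0 ?exprn_gt0 // => h.
have h1 := ler_norm D; have h2 := ler_norm (- (t * B)).
rewrite normrN normrM in h2.
have h3 : `|t| <= 1 by rewrite ler_norml t1 t2.
have h4 := normr_ge0 B; have h5 := sqr_ge0 t.
have h6 : - (t * B) <= `|B| by nra.
nra.
Qed.

Lemma cvg_sum_ord (T : Type) (F : set_system T) {FF : Filter F} m (f : 'I_m -> T -> R) (l : 'I_m -> R) :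
  (forall i, f i x @[x --> F] --> l i) ->
  \sum_i f i x @[x --> F] --> \sum_i l i.
Proof.
move=> fl; pose h (P : seq 'I_m) := \sum_(i <- P) f i x @[x --> F] --> \sum_(i <- P) l i.
suff : h (index_enum 'I_m) by [].
elim: (index_enum _) => [|i s IH]; rewrite /h.
  by under eq_fun do rewrite big_nil; rewrite big_nil; exact: cvg_cst.
by under eq_fun do rewrite big_cons; rewrite big_cons; exact: cvgD.
Qed.

Lemma continuous_sum_ord (T : topologicalType) m (f : 'I_m -> T -> R) :
  (forall i, continuous (f i)) -> continuous (fun x => \sum_i f i x).
Proof. by move=> fc x; apply: (@cvg_sum_ord _ (nbhs x)) => i; exact: fc. Qed.

Lemma continuous_mul (T : topologicalType) (f h : T -> R) :
  continuous f -> continuous h -> continuous (fun x => f x * h x).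
Proof. by move=> fc hc x; exact: (cvgM (fc x) (hc x)). Qed.

Lemma continuous_cst (T : topologicalType) (c : R) : continuous (fun _ : T => c).
Proof. by move=> x; exact: cvg_cst. Qed.

Definition orthogonal_rV : set 'rV[R]_(n * n) := [set x | orthogonal_mx (vec_mx x)].

Lemma cvg_vec_mx (x0 : 'rV[R]_(n * n)) i j : vec_mx x i j @[x --> x0] --> vec_mx x0 i j.
Proof.
have -> : (fun x : 'rV[R]_(n * n) => vec_mx x i j) = (fun x => x 0 (mxvec_index i j)).
  by apply/funext => x; rewrite mxE.
rewrite mxE; exact: coord_continuous.
Qed.

Lemma closed_cont_eq (T : topologicalType) (f : T -> R) c :
  continuous f -> closed [set x | f x = c].
Proof.
move=> cf; rewrite (_ : mkset _ = f @^-1` [set y | y = c]) //.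
by apply: preimage_closed; [move=> x _; exact: cf | exact: closed_eq].
Qed.

(** The stabiliser of the first [k] basis vectors: k = 0 yields the spectral theorem, k = 2
    diagonalisation on the complement of a plane. Matrices are flattened to row vectors, where boxes
    are compact. *)
Definition orthogonal_rV_fixing k : set 'rV[R]_(n * n) :=
  [set x | orthogonal_rV x /\ forall i j : 'I_n, (i < k)%N -> vec_mx x i j = (j == i)%:R].

Lemma compact_orthogonal_rV_fixing k : compact (orthogonal_rV_fixing k).
Proof.
apply: (@subclosed_compact _ _ [set v : 'rV[R]_(n * n) | forall i, `[-1, 1]%classic (v ord0 i)]).
- have -> : orthogonal_rV_fixing k =
      \bigcap_(ij in [set: 'I_n * 'I_n])
        ([set x | \sum_a vec_mx x ij.1 a * vec_mx x ij.2 a = (ij.1 == ij.2)%:R] `&`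
         [set x | (ij.1 < k)%N -> vec_mx x ij.1 ij.2 = (ij.2 == ij.1)%:R]).
    apply/seteqP; split=> x.
      move=> [xO xk] [i j] _ /=; split; last exact: xk.
      exact: (orthogonal_mx_row xO).
    move=> H; split.
      apply/orthogonal_mxP => i j; have [/= <- _] := H (i, j) I.
      by apply: eq_bigr => a _; rewrite !mxE.
    by move=> i j; have [_] := H (i, j) I.
  apply: closed_bigI => -[i j] _ /=; apply: closedI.
    apply: closed_cont_eq; apply: continuous_sum_ord => a x.
    exact: (cvgM (@cvg_vec_mx x i a) (@cvg_vec_mx x j a)).
  case: (ltnP i k) => ik.
    rewrite (_ : mkset _ = [set x | vec_mx x i j = (j == i)%:R]).
      by apply: closed_cont_eq => x; exact: cvg_vec_mx.
    by apply/seteqP; split=> x /=; [exact|move=> ->].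
  by rewrite (_ : mkset _ = setT) ?set_true; [exact: closedT|apply/seteqP; split].
- apply: (@rV_compact _ _ (fun=> `[(-1 : R), 1]%classic)) => _; exact: segment_compact.
- move=> x [xO _] ab; case/mxvec_indexP: ab => i j.
  have := orthogonal_mx_row xO i i; rewrite eqxx (bigD1 j) //= => h.
  have h2 : 0 <= \sum_(a | a != j) vec_mx x i a * vec_mx x i a.
    by apply: sumr_ge0 => a _; rewrite -expr2 sqr_ge0.
  have {}h : vec_mx x i j ^+ 2 <= 1 by rewrite expr2; lra.
  have -> : x ord0 (mxvec_index i j) = vec_mx x i j by rewrite mxE.
  by rewrite in_itv /= -ler_norml -(@ler_pXn2r _ 2) ?nnegrE ?normr_ge0 // expr1n real_normK ?num_real.
Qed.

Lemma compact_orthogonal_rV : compact orthogonal_rV.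
Proof.
have -> : orthogonal_rV = orthogonal_rV_fixing 0; last exact: compact_orthogonal_rV_fixing.
by apply/seteqP; split=> x; [move=> xO; split | case].
Qed.

Definition qform (M : 'M[R]_n) (u v : 'rV[R]_n) : R := \sum_a \sum_b M a b * u 0 a * v 0 b.

Lemma qform_linl M c u v w : qform M (c *: u + v) w = c * qform M u w + qform M v w.
Proof.
rewrite /qform; do 2![rewrite mulr_sumr -big_split; apply: eq_bigr => ? _ /=].
by rewrite !mxE; ring.
Qed.

Lemma qform_linr M c u v w : qform M w (c *: u + v) = c * qform M w u + qform M w v.
Proof.
rewrite /qform; do 2![rewrite mulr_sumr -big_split; apply: eq_bigr => ? _ /=].
by rewrite !mxE; ring.
Qed.

Lemma qformZl M c u w : qform M (c *: u) w = c * qform M u w.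
Proof.
by have := qform_linl M c u 0 w; have := qform_linl M 1 0 0 w; rewrite scaler0 !addr0 => h ->; lra.
Qed.

Lemma qformZr M c u w : qform M w (c *: u) = c * qform M w u.
Proof.
by have := qform_linr M c u 0 w; have := qform_linr M 1 0 0 w; rewrite scaler0 !addr0 => h ->; lra.
Qed.

Lemma qform_sym M u v : M^T = M -> qform M u v = qform M v u.
Proof.
move=> Ms; rewrite /qform exchange_big; apply: eq_bigr => a _; apply: eq_bigr => b _.
by rewrite -{1}Ms mxE; ring.
Qed.

Lemma qform_row M (g : 'M[R]_n) i j : qform M (row i g) (row j g) = (g *m M *m g^T) i j.
Proof.
rewrite mxE /qform; under [RHS]eq_bigr do rewrite !mxE mulr_suml.
rewrite exchange_big; apply: eq_bigr => b _; apply: eq_bigr => a _.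
by rewrite !mxE; ring.
Qed.

(* Minimizing [\sum_i i (g M g^T)_ii] over the orthogonal group: a rotation in
   the plane of two rows changes this sum at first order by the corresponding
   off-diagonal entry, which thus vanishes at the minimum. *)
Lemma spectral_fixing (M : 'M[R]_n) k : M^T = M ->
  exists g : 'M[R]_n, [/\ orthogonal_mx g,
    forall i : 'I_n, (i < k)%N -> row i g = ev i &
    forall i j : 'I_n, (k <= i)%N -> (k <= j)%N -> i != j -> (g *m M *m g^T) i j = 0].
Proof.
move=> Ms; pose f (x : 'rV[R]_(n * n)) : R :=
  \sum_(i < n) (i : nat)%:R * qform M (row i (vec_mx x)) (row i (vec_mx x)).
have fc : continuous f.
  apply: continuous_sum_ord => i; apply: continuous_mul; first exact: continuous_cst.
  apply: continuous_sum_ord => a; apply: continuous_sum_ord => b.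
  have rc c : continuous (fun x : 'rV[R]_(n * n) => row i (vec_mx x) 0 c).
    have -> : (fun x : 'rV[R]_(n * n) => row i (vec_mx x) 0 c) = (fun x => vec_mx x i c).
      by apply/funext => x; rewrite mxE.
    by move=> x; exact: cvg_vec_mx.
  apply: continuous_mul; [apply: continuous_mul; [exact: continuous_cst|exact: rc]|exact: rc].
have C0 : orthogonal_rV_fixing k !=set0.
  exists (mxvec 1%:M); split; first by rewrite /orthogonal_rV /= mxvecK; exact: orthogonal_mx1.
  by move=> i j _; rewrite mxvecK mxE eq_sym.
have [x /set_mem[xO xk] xmin] := compact_EVT_min C0 (@compact_orthogonal_rV_fixing k)
  (continuous_subspaceT fc).
exists (vec_mx x); split=> //.
  by move=> i ik; apply/rowP => j; rewrite mxE xk // evE.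
move=> i j ki kj; wlog ij : i j ki kj / (i < j)%N => [H|_].
  move=> nij; case: (ltngtP i j) => ij.
  - exact: (H i j).
  - have <- : (vec_mx x *m M *m (vec_mx x)^T)^T = vec_mx x *m M *m (vec_mx x)^T.
      by rewrite !trmx_mul trmxK Ms mulmxA.
    by rewrite mxE H // eq_sym.
  - by move: nij; rewrite -val_eqE /= ij eqxx.
have nij : i != j by rewrite -val_eqE neq_ltn ij.
pose q a b := qform M (row a (vec_mx x)) (row b (vec_mx x)).
have step c s : c ^+ 2 + s ^+ 2 = 1 -> 0 <= - (2 * c * s * q i j + s ^+ 2 * (q j j - q i i)).
  move=> cs; pose y := mxvec (row_rotation (vec_mx x) i j c s).
  have yk : orthogonal_rV_fixing k y.
    split; first by rewrite /orthogonal_rV /= mxvecK; exact: orthogonal_row_rotation.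
    move=> a b ak; rewrite mxvecK mxE.
    have -> : (a == i) = false by apply/negbTE; rewrite -val_eqE neq_ltn (leq_trans ak ki).
    have -> : (a == j) = false by apply/negbTE; rewrite -val_eqE neq_ltn (leq_trans ak kj).
    by rewrite mxE xk.
  have := xmin y (mem_set yk); rewrite /f mxvecK.
  rewrite (bigD1 i) //= (bigD1 j) /=; last by rewrite eq_sym.
  rewrite [in X in _ <= X](bigD1 i) //= [in X in _ <= X](bigD1 j) /=; last by rewrite eq_sym.
  rewrite !rowK eqxx (eq_sym j) (negPf nij) eqxx.
  under [in X in _ <= X]eq_bigr => a /andP[/negPf ai /negPf aj] do rewrite rowK ai aj.
  rewrite !(qform_linl, qform_linr, qformZl, qformZr) !addrA lerD2r.
  rewrite -/(q i i) -/(q i j) -/(q j i) -/(q j j).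
  have -> : q j i = q i j by exact: qform_sym.
  (* The weights of the two rows differ, so j - i factors out of the change; with equal weights the
     rotation would leave the sum unchanged. *)
  rewrite -subr_ge0; set X := (X in 0 <= X -> _).
  have -> : X = ((j : nat)%:R - (i : nat)%:R) * (- (2 * c * s * q i j + s ^+ 2 * (q j j - q i i)))
      + (c ^+ 2 + s ^+ 2 - 1) * ((i : nat)%:R * q i i + (j : nat)%:R * q j j).
    by rewrite /X; ring.
  by rewrite cs subrr mul0r addr0 pmulr_rge0 // subr_gt0 ltr_nat.
suff : - q i j = 0 by rewrite -qform_row -/(q i j) => /eqP; rewrite oppr_eq0 => /eqP.
apply: (@rotation_minimum (q i i - q j j)) => c s /step; set X := - _; set Y := _ + _.
by have -> : X = Y by rewrite /X /Y; ring.
Qed.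

End OrthogonalGroup.

(** After diagonalising [M], the trace is the sum of its eigenvalues times values of the form [N] at
    the eigenvectors. The index type is arbitrary because it will be a sum of four copies of
    ['I_n]. *)
Lemma psd_trace_ge0 (R : realType) (I : finType) (M N : I -> I -> R) :
  (forall i j, M i j = M j i) ->
  (forall x : I -> R, 0 <= \sum_i \sum_j M i j * x i * x j) ->
  (forall x : I -> R, 0 <= \sum_i \sum_j N i j * x i * x j) ->
  0 <= \sum_i \sum_j M i j * N i j.
Proof.
move=> Ms Mp Np; pose e (a : 'I_#|I|) : I := enum_val a.
have eE (F : I -> R) : \sum_i F i = \sum_(a < #|I|) F (e a).
  by rewrite (reindex _ (onW_bij _ (enum_val_bij I))).
have eE2 (F : I -> I -> R) : \sum_i \sum_j F i j = \sum_(a < #|I|) \sum_(b < #|I|) F (e a) (e b).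
  by rewrite eE; apply: eq_bigr => a _; exact: eE.
pose M' : 'M[R]_#|I| := \matrix_(a, b) M (e a) (e b).
have M's : M'^T = M' by apply/matrixP => a b; rewrite !mxE Ms.
have [g [gO _ gd]] := spectral_fixing 0 M's.
pose X := g *m M' *m g^T.
have M'E : M' = g^T *m X *m g.
  by rewrite /X !mulmxA (mulmx1C gO) mul1mx -mulmxA (mulmx1C gO) mulmx1.
have ge (h : 'I_#|I| -> R) : exists x : I -> R, forall a, x (e a) = h a.
  by exists (fun i => h (enum_rank i)) => a; rewrite /e enum_valK.
have Xp k : 0 <= X k k.
  have [x xe] := ge (fun a => g k a).
  have := Mp x; rewrite eE2 => h; apply: le_trans h _; rewrite le_eqVlt; apply/orP; left; apply/eqP.
  rewrite /X -qform_row; apply: eq_bigr => a _; apply: eq_bigr => b _.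
  by rewrite !xe !mxE.
rewrite eE2.
have -> : \sum_(a < #|I|) \sum_(b < #|I|) M (e a) (e b) * N (e a) (e b) =
    \sum_k X k k * \sum_a \sum_b N (e a) (e b) * g k a * g k b.
  under [RHS]eq_bigr do rewrite mulr_sumr.
  rewrite [RHS]exchange_big; apply: eq_bigr => a _.
  under [RHS]eq_bigr do rewrite mulr_sumr.
  rewrite [RHS]exchange_big; apply: eq_bigr => b _.
  have -> : M (e a) (e b) = M' a b by rewrite mxE.
  rewrite M'E mxE mulr_suml; apply: eq_bigr => k _.
  rewrite mxE (bigD1 k) //= big1 ?addr0; first by rewrite mxE; ring.
  by move=> l lk; rewrite gd // mulr0.
apply: sumr_ge0 => k _; apply: mulr_ge0 => //.
have [x xe] := ge (fun a => g k a).
have := Np x; rewrite eE2 => h; apply: le_trans h _; rewrite le_eqVlt; apply/orP; left; apply/eqP.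
by apply: eq_bigr => a _; apply: eq_bigr => b _; rewrite !xe.
Qed.

Lemma orthonormal_frame_extend (R : realType) n (s : seq 'rV[R]_n) :
  (size s <= n)%N -> orthonormal_frame s ->
  exists2 g : 'M[R]_n, orthogonal_mx g & forall i : 'I_n, (i < size s)%N -> row i g = s`_i.
Proof.
move=> sn; have [m] := ubnP (n - size s)%N; elim: m s sn => [//|m IH] s sn.
rewrite ltnS => nsm sO; have [ns|ns] := leqP n (size s).
  exists (\matrix_(i < n) s`_i); last by move=> i _; rewrite rowK.
  apply/orthogonal_mxP => i j; rewrite !rowK sO //;
    [exact: leq_trans (ltn_ord i) ns|exact: leq_trans (ltn_ord j) ns].
pose E : 'M[R]_(size s, n) := \matrix_i s`_i.
(* Fewer than n vectors leave a nonzero vector orthogonal to all of them; normalised, it lengthens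
   the frame by one. *)
have K0 : kermx E^T != 0.
  rewrite -mxrank_eq0 mxrank_ker -lt0n subn_gt0.
  by apply: leq_ltn_trans ns; exact: rank_leq_col.
pose v := nz_row (kermx E^T).
have v0 : v != 0 by rewrite nz_row_eq0.
have vs i : (i < size s)%N -> dot v s`_i = 0.
  move=> si; have /sub_kermxP/matrixP/(_ 0 (Ordinal si)) : (v <= kermx E^T)%MS by exact: nz_row_sub.
  by rewrite !mxE => h; rewrite -[RHS]h; apply: eq_bigr => a _; rewrite !mxE.
have vv : 0 < dot v v.
  by rewrite lt_neqAle dot_ge0 andbT eq_sym; apply: contraNneq v0 => /dot_eq0 ->.
pose w := (Num.sqrt (dot v v))^-1 *: v.
have ww : dot w w = 1.
  by rewrite dotZl dotZr mulrA -expr2 exprVn sqr_sqrtr ?ltW // mulVf // gt_eqF.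
have ws i : (i < size s)%N -> dot w s`_i = 0 by move=> si; rewrite dotZl vs // mulr0.
have swO : orthonormal_frame (rcons s w).
  move=> i j; rewrite size_rcons !ltnS (leq_eqVlt i) (leq_eqVlt j) => /orP[/eqP ei|si] /orP[/eqP ej|sj].
  - by rewrite ei ej !nth_rcons ltnn !eqxx ww.
  - by rewrite ei !nth_rcons ltnn eqxx sj ws // gtn_eqF.
  - by rewrite ej !nth_rcons ltnn eqxx si dotC ws // ltn_eqF.
  - by rewrite !nth_rcons si sj; exact: sO.
have := IH _ _ _ swO; rewrite size_rcons => /(_ ns).
case.
  by rewrite subnS; move: nsm; case: (n - size s)%N (subn_gt0 (size s) n) => [|k]; rewrite ?ns.
move=> g gO gs; exists g => // i si; rewrite gs ?(leqW si) //.
by rewrite nth_rcons si.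
Qed.

(** * Isotropic planes and their variations *)

Section BivectorForm.
Variables (R : realType) (n : nat).
Implicit Types (S : tensor4 R n) (x y : 'M[R]_n) (a b c d u v w z : 'rV[R]_n).

Definition outer u v : 'M[R]_n := \matrix_(i, j) (u 0 i * v 0 j).

Definition bform S x y : R :=
  \sum_i \sum_j \sum_k \sum_l tcomp S i j k l * x i j * y k l.

Lemma bform_linl S t x1 x2 y : bform S (t *: x1 + x2) y = t * bform S x1 y + bform S x2 y.
Proof.
rewrite /bform; do 4![rewrite mulr_sumr -big_split; apply: eq_bigr => ? _ /=].
by rewrite !mxE; ring.
Qed.

Lemma bform_linr S t x1 x2 y : bform S y (t *: x1 + x2) = t * bform S y x1 + bform S y x2.
Proof.
rewrite /bform; do 4![rewrite mulr_sumr -big_split; apply: eq_bigr => ? _ /=].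
by rewrite !mxE; ring.
Qed.

Lemma bformDl S x1 x2 y : bform S (x1 + x2) y = bform S x1 y + bform S x2 y.
Proof. by rewrite -[x1]scale1r bform_linl scale1r mul1r. Qed.

Lemma bformDr S x1 x2 y : bform S y (x1 + x2) = bform S y x1 + bform S y x2.
Proof. by rewrite -[x1]scale1r bform_linr scale1r mul1r. Qed.

Lemma bform0l S y : bform S 0 y = 0.
Proof. by do 4![apply: big1 => ? _]; rewrite mxE mulr0 mul0r. Qed.

Lemma bform0r S y : bform S y 0 = 0.
Proof. by do 4![apply: big1 => ? _]; rewrite mxE mulr0. Qed.

Lemma bformZl S t x y : bform S (t *: x) y = t * bform S x y.
Proof. by rewrite -[t *: x]addr0 bform_linl bform0l addr0. Qed.

Lemma bformZr S t x y : bform S y (t *: x) = t * bform S y x.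
Proof. by rewrite -[t *: x]addr0 bform_linr bform0r addr0. Qed.

Lemma bformNl S x y : bform S (- x) y = - bform S x y.
Proof. by rewrite -scaleN1r bformZl mulN1r. Qed.

Lemma bformNr S x y : bform S y (- x) = - bform S y x.
Proof. by rewrite -scaleN1r bformZr mulN1r. Qed.

Lemma bform_sym S x y : curvature_tensor S -> bform S x y = bform S y x.
Proof.
move=> cS; rewrite /bform pair_big [RHS]pair_big /=.
under eq_bigr do rewrite pair_big; under [RHS]eq_bigr do rewrite pair_big.
rewrite exchange_big; apply: eq_bigr => -[i j] _; apply: eq_bigr => -[k l] _ /=.
by rewrite curv_sym //; ring.
Qed.

Lemma bform_outer S u v w z : bform S (outer u v) (outer w z) = tform S u v w z.
Proof. by do 4![apply: eq_bigr => ? _]; rewrite !mxE; ring. Qed.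

Lemma bform_symmetric S x y : curvature_tensor S -> x^T = x -> bform S x y = 0.
Proof.
move=> cS xs; suff : bform S x y = - bform S x y by lra.
rewrite {1}/bform exchange_big /= -sumrN; apply: eq_bigr => i _.
rewrite -sumrN; apply: eq_bigr => j _; rewrite -sumrN; apply: eq_bigr => k _.
rewrite -sumrN; apply: eq_bigr => l _.
by rewrite curv_antil // -{1}xs mxE; ring.
Qed.

(* Real and imaginary parts of the bivector (a + ib) /\ (c + id). *)
Definition bivRe a b c d := outer a c - outer b d.
Definition bivIm a b c d := outer a d + outer b c.

(** Hermitian extension of the curvature operator, evaluated at the complex bivector above. *)
Definition isotropic_form S a b c d : R :=
  bform S (bivRe a b c d) (bivRe a b c d) + bform S (bivIm a b c d) (bivIm a b c d).

Lemma isotropic_formE S a b c d : curvature_tensor S ->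
  isotropic_form S a b c d =
  tform S a c a c + tform S a d a d + tform S b c b c + tform S b d b d - 2 * tform S a b c d.
Proof.
move=> cS; rewrite /isotropic_form /bivRe /bivIm !(bformDl, bformDr, bformNl, bformNr) !bform_outer.
have h1 := tform_sym a c b d cS; have h2 := tform_sym a d b c cS.
have := tform_bianchi a b c d cS; have := tform_antir b c a d cS.
have := tform_sym b c a d cS; have := tform_sym b c d a cS; have := tform_antir c a b d cS.
have := tform_anti c a b d cS; have := tform_antir a d b c cS.
have := tform_anti d a b c cS; have := tform_sym b c d a cS; lra.
Qed.

(** The vectors zeta = a + ib and eta = c + id satisfy zeta.zeta = eta.eta = zeta.eta = 0 for the
    complex bilinear product, that is, they span an isotropic plane. *)
Definition isotropic_pair a b c d :=
  [/\ dot a a = dot b b, dot a b = 0, dot c c = dot d d & dot c d = 0] /\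
  (dot a c = dot b d /\ dot a d = - dot b c).

Lemma isotropic_formZ S r s a b c d :
  isotropic_form S (r *: a) (r *: b) (s *: c) (s *: d) = (r * s) ^+ 2 * isotropic_form S a b c d.
Proof.
rewrite /isotropic_form.
have -> : bivRe (r *: a) (r *: b) (s *: c) (s *: d) = (r * s) *: bivRe a b c d.
  by apply/matrixP => i j; rewrite !mxE; ring.
have -> : bivIm (r *: a) (r *: b) (s *: c) (s *: d) = (r * s) *: bivIm a b c d.
  by apply/matrixP => i j; rewrite !mxE; ring.
by rewrite !(bformZl, bformZr); ring.
Qed.

(** [PIC] speaks of orthonormal frames, but the variations below leave that class. The form depends
    on zeta and eta only through their bivector: eta can be made Hermitian-orthogonal to zeta and
    both rescaled, which produces a frame; if either vector vanishes, so does the form. *)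
Lemma isotropic_form_PIC S a b c d : PIC S -> isotropic_pair a b c d ->
  0 <= isotropic_form S a b c d.
Proof.
move=> [cS pS] [[aabb ab ccdd cd] [acbd adbc]].
have unit_of u : 0 < dot u u -> dot ((Num.sqrt (dot u u))^-1 *: u) ((Num.sqrt (dot u u))^-1 *: u) = 1.
  by move=> u0; rewrite dotZl dotZr mulrA -expr2 exprVn sqr_sqrtr ?ltW // mulVf // gt_eqF.
have zero a' b' c' d' : a' = 0 -> b' = 0 -> isotropic_form S a' b' c' d' = 0.
  move=> -> ->; rewrite /isotropic_form.
  have -> : bivRe 0 0 c' d' = 0 by apply/matrixP => i j; rewrite !mxE; ring.
  have -> : bivIm 0 0 c' d' = 0 by apply/matrixP => i j; rewrite !mxE; ring.
  by rewrite bform0l addr0.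
have zero' a' b' c' d' : c' = 0 -> d' = 0 -> isotropic_form S a' b' c' d' = 0.
  move=> -> ->; rewrite /isotropic_form.
  have -> : bivRe a' b' 0 0 = 0 by apply/matrixP => i j; rewrite !mxE; ring.
  have -> : bivIm a' b' 0 0 = 0 by apply/matrixP => i j; rewrite !mxE; ring.
  by rewrite bform0l addr0.
have [aa0|aa0] := eqVneq (dot a a) 0.
  by rewrite zero //; [exact: dot_eq0|apply: dot_eq0; rewrite -aabb].
have {}aa0 : 0 < dot a a by rewrite lt_neqAle eq_sym aa0 dot_ge0.
(* Gram-Schmidt over the complex numbers: c' + id' = (c + id) - (k1 + i k2)(a + ib). *)
pose k1 := dot a c / dot a a; pose k2 := dot a d / dot a a.
pose c' := (- k1) *: a + (k2 *: b + c); pose d' := (- k1) *: b + ((- k2) *: a + d).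
(* The two bivectors differ by a multiple of zeta tensor zeta, whose real and imaginary parts are
   symmetric. *)
have -> : isotropic_form S a b c d = isotropic_form S a b c' d'.
  have [s1 [s2 [s1s s2s E1 E2]]] : exists s1 s2 : 'M[R]_n, [/\ s1^T = s1, s2^T = s2,
      bivRe a b c' d' = s1 + bivRe a b c d & bivIm a b c' d' = s2 + bivIm a b c d].
    exists ((- k1) *: (outer a a - outer b b) + k2 *: (outer a b + outer b a)).
    exists ((- k1) *: (outer a b + outer b a) - k2 *: (outer a a - outer b b)).
    by split; apply/matrixP => i j; rewrite !mxE; ring.
  have sym0 y s : s^T = s -> bform S y s = 0.
    by move=> ss; rewrite bform_sym // bform_symmetric.
  rewrite /isotropic_form E1 E2 !(bformDl, bformDr) !(bform_symmetric _ cS s1s).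
  by rewrite !(bform_symmetric _ cS s2s) !(sym0 _ _ s1s) !(sym0 _ _ s2s) !add0r.
have kaa : k1 * dot a a = dot a c by rewrite /k1 divfK // gt_eqF.
have kad : k2 * dot a a = dot a d by rewrite /k2 divfK // gt_eqF.
have ba : dot b a = 0 by rewrite dotC.
have ac' : dot a c' = 0 by rewrite !dot_linr ab; lra.
have bc' : dot b c' = 0 by rewrite !dot_linr ba -aabb; lra.
have ad' : dot a d' = 0 by rewrite !dot_linr ab; lra.
have bd' : dot b d' = 0 by rewrite !dot_linr ba -aabb; lra.
have c'c' : dot c' c' = dot d' d'.
  rewrite {1}/c' {2}/d' !dot_linl ac' bc' ad' bd' /c' /d' !dot_linr.
  by rewrite (dotC c a) (dotC c b) (dotC d a) (dotC d b) acbd adbc ccdd; ring.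
have c'd' : dot c' d' = 0.
  have bc : dot b c = - dot a d by lra.
  rewrite {1}/c' !dot_linl ad' bd' /d' !dot_linr (dotC c b) (dotC c a) cd bc /k1 /k2.
  ring.
have [cc0|cc0] := eqVneq (dot c' c') 0.
  by rewrite zero' //; [exact: dot_eq0|apply: dot_eq0; rewrite -c'c'].
have {}cc0 : 0 < dot c' c' by rewrite lt_neqAle eq_sym cc0 dot_ge0.
pose r := (Num.sqrt (dot a a))^-1; pose s := (Num.sqrt (dot c' c'))^-1.
have rs0 : 0 < (r * s) ^+ 2 by rewrite exprn_gt0 // mulr_gt0 // invr_gt0 sqrtr_gt0.
rewrite -(pmulr_rge0 _ rs0) -isotropic_formZ isotropic_formE //.
apply: pS; have a1 := unit_of _ aa0; have c1 := unit_of _ cc0.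
have b1 : dot (r *: b) (r *: b) = 1 by move: a1; rewrite -/r !dotZl !dotZr -aabb.
have d1 : dot (s *: d') (s *: d') = 1 by move: c1; rewrite -/s !dotZl !dotZr -c'c'.
have Z u v p q : dot u v = 0 -> dot (p *: u) (q *: v) = 0 /\ dot (q *: v) (p *: u) = 0.
  by move=> uv; rewrite (dotC (q *: v)) dotZl dotZr uv !mulr0.
have [[ab1 ab2] [ac1 ac2] [ad1 ad2]] := And3 (Z _ _ r r ab) (Z _ _ r s ac') (Z _ _ r s ad').
have [[bc1 bc2] [bd1 bd2] [cd1 cd2]] := And3 (Z _ _ r s bc') (Z _ _ r s bd') (Z _ _ s s c'd').
by move=> [|[|[|[|i]]]] [|[|[|[|j]]]].
Qed.

(** Extracts first and second order conditions from a polynomial inequality near 0 without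
    differentiating. *)
Lemma nonneg_expansion (a1 a2 M : R) (r : R -> R) :
  (forall t, -1 <= t <= 1 -> `|r t| <= M) ->
  (forall t, -1 <= t <= 1 -> 0 <= a1 * t + t ^+ 2 * (a2 + t * r t)) ->
  a1 = 0 /\ 0 <= a2.
Proof.
move=> rM H.
have a10 : a1 = 0.
  apply: (@lin_zero R a1 (`|a2| + M)) => t t1; apply: le_trans (H _ t1) _.
  rewrite lerD2l mulrC ler_wpM2r ?sqr_ge0 // lerD ?ler_norm //.
  apply: le_trans (ler_norm _) _; rewrite normrM -[leRHS]mul1r.
  by apply: ler_pM => //; [rewrite ler_norml|exact: rM].
split=> //; rewrite leNgt; apply/negP => a20.
have M0 : 0 <= M by apply: le_trans (rM 0 _); [exact: normr_ge0|lra].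
(* With this t one has a2 + t M = t (a2 - 1) < 0, against the sign required of the quadratic
   part. *)
pose t := - a2 / (M + - a2 + 1).
have K0 : 0 < M + - a2 + 1 by lra.
have t0 : 0 < t by rewrite divr_gt0 //; lra.
have t1 : t < 1 by rewrite ltr_pdivrMr // mul1r; lra.
have tt : -1 <= t <= 1 by lra.
have := H _ tt; rewrite a10 mul0r add0r pmulr_rge0 ?exprn_gt0 // => h.
have h2 : t * r t <= t * M by rewrite ler_pM2l // (le_trans (ler_norm _)) // rM.
have : t * (M + - a2 + 1) = - a2 by rewrite /t divfK // gt_eqF.
nra.
Qed.

(** Degree four suffices: the curves of vectors have degree at most two, so their products have
    degree at most four. *)
Lemma isotropic_second_variation S (x0 x1 x2 x3 x4 y0 y1 y2 y3 y4 : 'M[R]_n) :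
  curvature_tensor S ->
  (forall t x y, x = x0 + t *: x1 + t ^+ 2 *: x2 + t ^+ 3 *: x3 + t ^+ 4 *: x4 ->
     y = y0 + t *: y1 + t ^+ 2 *: y2 + t ^+ 3 *: y3 + t ^+ 4 *: y4 ->
     0 <= bform S x x + bform S y y) ->
  bform S x0 x0 + bform S y0 y0 = 0 ->
  bform S x0 x1 + bform S y0 y1 = 0 /\
  0 <= bform S x1 x1 + bform S y1 y1 + 2 * (bform S x0 x2 + bform S y0 y2).
Proof.
move=> cS H H0; pose c i j (xs ys : seq 'M[R]_n) := bform S xs`_i xs`_j + bform S ys`_i ys`_j.
set xs := [:: x0; x1; x2; x3; x4]; set ys := [:: y0; y1; y2; y3; y4].
pose C i j := c i j xs ys.
pose r t := 2 * (C 0 3 + C 1 2) + t * (2 * (C 0 4 + C 1 3) + C 2 2) + t ^+ 2 * (2 * (C 1 4 + C 2 3))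
   + t ^+ 3 * (2 * C 2 4 + C 3 3) + t ^+ 4 * (2 * C 3 4) + t ^+ 5 * C 4 4.
have [] := @nonneg_expansion (2 * (C 0 1)) (C 1 1 + 2 * C 0 2)
  (`|2 * (C 0 3 + C 1 2)| + `|2 * (C 0 4 + C 1 3) + C 2 2| + `|2 * (C 1 4 + C 2 3)|
   + `|2 * C 2 4 + C 3 3| + `|2 * C 3 4| + `|C 4 4|) r.
- move=> t t1; have tn : `|t| <= 1 by rewrite ler_norml.
  have tk k (z : R) : `|t ^+ k * z| <= `|z|.
    by rewrite normrM normrX ler_piMl // exprn_ile1.
  rewrite /r; do 4![apply: le_trans (ler_normD _ _) _; apply: lerD => //].
  by apply: le_trans (ler_normD _ _) _; apply: lerD => //; rewrite -[t]expr1.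
- move=> t _; apply: le_trans (H t _ _ erefl erefl) _; rewrite le_eqVlt; apply/orP; left; apply/eqP.
  rewrite !(bformDl, bformDr, bformZl, bformZr).
  rewrite (bform_sym x1 x0) // (bform_sym x2 x0) // (bform_sym x3 x0) // (bform_sym x4 x0) //.
  rewrite (bform_sym x2 x1) // (bform_sym x3 x1) // (bform_sym x4 x1) //.
  rewrite (bform_sym x3 x2) // (bform_sym x4 x2) // (bform_sym x4 x3) //.
  rewrite (bform_sym y1 y0) // (bform_sym y2 y0) // (bform_sym y3 y0) // (bform_sym y4 y0) //.
  rewrite (bform_sym y2 y1) // (bform_sym y3 y1) // (bform_sym y4 y1) //.
  rewrite (bform_sym y3 y2) // (bform_sym y4 y2) // (bform_sym y4 y3) //.
  rewrite /r /C /c /=; move/eqP: H0; rewrite addr_eq0 => /eqP ->; ring.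
- rewrite /C /c /= => h1 h2; split; lra.
Qed.

End BivectorForm.

Section CurvatureQ.
Variables (R : realType) (n : nat).
Implicit Types (S : tensor4 R n).

(** By the Bianchi identity the square part is also expressed through the contraction [B]. This
    gives the four-term formula [QE], from which the symmetries [B1] and [B2] of [B] yield every
    identity. *)
Lemma curv_Q S : curvature_tensor S -> curvature_tensor (Q S).
Proof.
move=> cS.
pose B i j k l := \sum_p \sum_q tcomp S i p j q * tcomp S k p l q.
have B1 i j k l : B i j k l = B k l i j.
  by apply: eq_bigr => p _; apply: eq_bigr => q _; exact: mulrC.
have B2 i j k l : B i j k l = B j i l k.
  rewrite /B exchange_big; apply: eq_bigr => p _; apply: eq_bigr => q _.
  by rewrite (curv_sym i q j p cS) (curv_sym k q l p cS).
have QE i j k l : tcomp (Q S) i j k l = 2 * (B i j k l - B i j l k + B i k j l - B i l j k).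
  have -> : 2 * (B i j k l - B i j l k + B i k j l - B i l j k) =
    (B i j k l + B j i l k - B i j l k - B j i k l) + 2 * (B i k j l - B i l j k).
    by rewrite (B2 j i l k) (B2 j i k l); ring.
  rewrite tcompQ; congr (_ + 2 * _); last first.
    by rewrite /B -sumrB; apply: eq_bigr => p _; rewrite sumrB.
  rewrite /B -!(sumrB, big_split); apply: eq_bigr => p _ /=.
  rewrite -!(sumrB, big_split); apply: eq_bigr => q _ /=.
  have bi x y : tcomp S x y p q = tcomp S x p y q - tcomp S y p x q.
    have := curv_bianchi x y p q cS.
    rewrite (curv_antil y p x q cS) (curv_antil p x y q cS) (curv_antil p y x q cS).
    lra.
  by rewrite !bi; ring.
move=> i j k l; split.
- by rewrite !QE (B2 j i k l) (B2 j i l k) (B1 j k i l) (B1 j l i k); ring.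
- by rewrite !QE; ring.
- by rewrite !QE (B1 k l i j) (B1 k l j i) (B2 j i k l) (B2 k i l j) (B1 k j l i) (B2 l i k j) (B1 i k j l)
    (B2 j l i k) (B1 i l j k); ring.
- rewrite !QE (B1 j k i l) (B1 k l i j) (B1 k i j l) (B2 j i k l) (B2 k j i l) (B2 i k j l).
  ring.
Qed.

End CurvatureQ.

Section IsotropicVariation.
Variables (R : realType) (n : nat) (S : tensor4 R n) (e1 e2 e3 e4 : 'rV[R]_n).
Hypotheses (pS : PIC S) (eO : orthonormal_frame [:: e1; e2; e3; e4]).
Hypothesis S0 : isotropic_form S e1 e2 e3 e4 = 0.
Implicit Types (u v : 'rV[R]_n).

Let cS : curvature_tensor S. Proof. by case: pS. Qed.

Let frame_dot : [/\ dot e1 e1 = 1, dot e2 e2 = 1, dot e3 e3 = 1 & dot e4 e4 = 1] /\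
  [/\ [/\ dot e1 e2 = 0, dot e1 e3 = 0 & dot e1 e4 = 0],
      [/\ dot e2 e1 = 0, dot e2 e3 = 0 & dot e2 e4 = 0],
      [/\ dot e3 e1 = 0, dot e3 e2 = 0 & dot e3 e4 = 0] &
      [/\ dot e4 e1 = 0, dot e4 e2 = 0 & dot e4 e3 = 0]].
Proof.
by split; [split|split; split]; [exact: (eO (i:=0) (j:=0))|exact: (eO (i:=1) (j:=1))|
  exact: (eO (i:=2) (j:=2))|exact: (eO (i:=3) (j:=3))|
  exact: (eO (i:=0) (j:=1))|exact: (eO (i:=0) (j:=2))|exact: (eO (i:=0) (j:=3))|
  exact: (eO (i:=1) (j:=0))|exact: (eO (i:=1) (j:=2))|exact: (eO (i:=1) (j:=3))|
  exact: (eO (i:=2) (j:=0))|exact: (eO (i:=2) (j:=1))|exact: (eO (i:=2) (j:=3))|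
  exact: (eO (i:=3) (j:=0))|exact: (eO (i:=3) (j:=1))|exact: (eO (i:=3) (j:=2))].
Qed.

Definition normal_to u := [/\ dot u e1 = 0, dot u e2 = 0, dot u e3 = 0 & dot u e4 = 0].

(** Real and imaginary parts of the derivative of zeta /\ eta in the direction (u + iu', v +
    iv'). *)
Definition varRe u u' v v' := outer u e3 + outer e1 v - outer u' e4 - outer e2 v'.
Definition varIm u u' v v' := outer u e4 + outer e1 v' + outer u' e3 + outer e2 v.

(* The curves [zeta + t u - t^2 (u.u) zeta^* / 4] and
   [eta + t v - t^2 ((v.v) eta^* / 4 + (u.v) zeta^* / 2)], where zeta = e1 + i e2
   and eta = e3 + i e4, span isotropic planes for all complex u, v normal to the frame. *)
Let kr u u' : R := - (dot u u - dot u' u') / 4.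
Let ki u u' : R := - dot u u' / 2.
Let mr u u' v v' : R := - (dot u v - dot u' v') / 2.
Let mi u u' v v' : R := - (dot u v' + dot u' v) / 2.
Let a2 u u' := kr u u' *: e1 + ki u u' *: e2.
Let b2 u u' := ki u u' *: e1 - kr u u' *: e2.
Let c2 u u' v v' := kr v v' *: e3 + ki v v' *: e4 + mr u u' v v' *: e1 + mi u u' v v' *: e2.
Let d2 u u' v v' := ki v v' *: e3 - kr v v' *: e4 + mi u u' v v' *: e1 - mr u u' v v' *: e2.
Let Re2 u u' v v' := bivRe u u' v v' + outer (a2 u u') e3 + outer e1 (c2 u u' v v')
  - outer (b2 u u') e4 - outer e2 (d2 u u' v v').
Let Im2 u u' v v' := bivIm u u' v v' + outer (a2 u u') e4 + outer e1 (d2 u u' v v')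
  + outer (b2 u u') e3 + outer e2 (c2 u u' v v').

Let dotNl u v : dot (- u) v = - dot u v.
Proof. by rewrite -scaleN1r dotZl mulN1r. Qed.

Let dotNr u v : dot v (- u) = - dot v u.
Proof. by rewrite dotC dotNl dotC. Qed.

Let variation_pos u u' v v' : normal_to u -> normal_to u' -> normal_to v -> normal_to v' ->
  bform S (bivRe e1 e2 e3 e4) (varRe u u' v v') + bform S (bivIm e1 e2 e3 e4) (varIm u u' v v') = 0
  /\ 0 <= bform S (varRe u u' v v') (varRe u u' v v') + bform S (varIm u u' v v') (varIm u u' v v')
     + 2 * (bform S (bivRe e1 e2 e3 e4) (Re2 u u' v v') + bform S (bivIm e1 e2 e3 e4) (Im2 u u' v v')).
Proof.
move=> [u1 u2 u3 u4] [u'1 u'2 u'3 u'4] [v1 v2 v3 v4] [v'1 v'2 v'3 v'4].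
have [[e11 e22 e33 e44] [[e12 e13 e14] [e21 e23 e24] [e31 e32 e34] [e41 e42 e43]]] := frame_dot.
pose x3 := outer (a2 u u') v + outer u (c2 u u' v v') - outer (b2 u u') v' - outer u' (d2 u u' v v').
pose y3 := outer (a2 u u') v' + outer u (d2 u u' v v') + outer (b2 u u') v + outer u' (c2 u u' v v').
pose x4 := bivRe (a2 u u') (b2 u u') (c2 u u' v v') (d2 u u' v v').
pose y4 := bivIm (a2 u u') (b2 u u') (c2 u u' v v') (d2 u u' v v').
refine (@isotropic_second_variation _ _ S _ _ _ x3 x4 _ _ _ y3 y4 cS _ S0).
move=> t x y xE yE.
have -> : x = bivRe (e1 + t *: u + t ^+ 2 *: a2 u u') (e2 + t *: u' + t ^+ 2 *: b2 u u')
    (e3 + t *: v + t ^+ 2 *: c2 u u' v v') (e4 + t *: v' + t ^+ 2 *: d2 u u' v v').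
  by apply/matrixP => i j; rewrite xE /x3 /x4 !mxE; ring.
have -> : y = bivIm (e1 + t *: u + t ^+ 2 *: a2 u u') (e2 + t *: u' + t ^+ 2 *: b2 u u')
    (e3 + t *: v + t ^+ 2 *: c2 u u' v v') (e4 + t *: v' + t ^+ 2 *: d2 u u' v v').
  by apply/matrixP => i j; rewrite yE /y3 /y4 !mxE; ring.
apply: (isotropic_form_PIC pS).
have dots := (e11, e22, e33, e44, (e12, e13, e14), (e21, e23, e24), (e31, e32, e34), (e41, e42, e43),
  (u1, u2, u3, u4), (u'1, u'2, u'3, u'4), (v1, v2, v3, v4), (v'1, v'2, v'3, v'4)).
have flip (w i : 'rV[R]_n) : dot i w = dot w i by exact: dotC.
have flips := (flip u e1, flip u e2, flip u e3, flip u e4, flip u' e1, flip u' e2, flip u' e3, flip u' e4,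
  (flip v e1, flip v e2, flip v e3, flip v e4, flip v' e1, flip v' e2, flip v' e3, flip v' e4)).
by split; split; rewrite /a2 /b2 /c2 /d2 !(dotDl, dotDr, dotZl, dotZr, dotNl, dotNr) !flips !dots
  ?(dotC v u) ?(dotC v' u) ?(dotC v u') ?(dotC v' u') ?(dotC u' u) ?(dotC v' v) /kr /ki /mr /mi; field.
Qed.

Lemma isotropic_first_variation u u' v v' :
  normal_to u -> normal_to u' -> normal_to v -> normal_to v' ->
  bform S (bivRe e1 e2 e3 e4) (varRe u u' v v') + bform S (bivIm e1 e2 e3 e4) (varIm u u' v v') = 0.
Proof. by move=> *; apply: (proj1 (variation_pos _ _ _ _)). Qed.

(* The second order terms of the curves cancel when (u, v) and i(u, v) are averaged. *)
Lemma isotropic_hessian_ge0 u u' v v' :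
  normal_to u -> normal_to u' -> normal_to v -> normal_to v' ->
  0 <= bform S (varRe u u' v v') (varRe u u' v v') + bform S (varIm u u' v v') (varIm u u' v v').
Proof.
move=> nu nu' nv nv'.
have normN w : normal_to w -> normal_to (- w).
  by move=> [w1 w2 w3 w4]; split; rewrite dotNl ?w1 ?w2 ?w3 ?w4 oppr0.
have [_ h1] := variation_pos nu nu' nv nv'.
have [_] := variation_pos (normN _ nu') nu (normN _ nv') nv.
have E1 : varRe (- u') u (- v') v = - varIm u u' v v' by apply/matrixP => i j; rewrite !mxE; ring.
have E2 : varIm (- u') u (- v') v = varRe u u' v v' by apply/matrixP => i j; rewrite !mxE; ring.
have Ek w w' : kr (- w') w = - kr w w' by rewrite /kr !(dotNl, dotNr); ring.
have Ek' w w' : ki (- w') w = - ki w w' by rewrite /ki !(dotNl, dotNr) (dotC w'); ring.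
have Em : mr (- u') u (- v') v = - mr u u' v v' by rewrite /mr !(dotNl, dotNr); ring.
have Em' : mi (- u') u (- v') v = - mi u u' v v' by rewrite /mi !(dotNl, dotNr); ring.
have E3 : Re2 (- u') u (- v') v = - Re2 u u' v v'.
  by apply/matrixP => i j; rewrite /Re2 /a2 /b2 /c2 /d2 Em Em' !Ek !Ek' !mxE; ring.
have E4 : Im2 (- u') u (- v') v = - Im2 u u' v v'.
  by apply/matrixP => i j; rewrite /Im2 /a2 /b2 /c2 /d2 Em Em' !Ek !Ek' !mxE; ring.
rewrite E1 E2 E3 E4 !(bformNl, bformNr) => h2; lra.
Qed.

(** Variations inside the span of the frame, which normal vectors miss: zeta + i t conj(eta), eta -
    i t conj(zeta), and the same pair without i. Both remain isotropic for all t, and one of the two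
    parts of each derivative is symmetric, hence contributes nothing. *)
Lemma isotropic_first_variation_frame :
  bform S (bivRe e1 e2 e3 e4) (outer e4 e3 - outer e3 e4 - outer e1 e2 + outer e2 e1) = 0 /\
  bform S (bivIm e1 e2 e3 e4) (outer e3 e4 - outer e4 e3 + outer e1 e2 - outer e2 e1) = 0.
Proof.
have [[e11 e22 e33 e44] [[e12 e13 e14] [e21 e23 e24] [e31 e32 e34] [e41 e42 e43]]] := frame_dot.
have dots := (e11, e22, e33, e44, (e12, e13, e14), (e21, e23, e24), (e31, e32, e34), (e41, e42, e43)).
have sym0 x s : s^T = s -> bform S x s = 0 by move=> ss; rewrite bform_sym // bform_symmetric.
split.
- suff : bform S (bivRe e1 e2 e3 e4) (outer e4 e3 - outer e3 e4 - outer e1 e2 + outer e2 e1) +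
      bform S (bivIm e1 e2 e3 e4) (outer e4 e4 - outer e1 e1 + outer e3 e3 - outer e2 e2) = 0.
    rewrite [X in _ + X]sym0 ?addr0 //; by apply/matrixP => i j; rewrite !mxE; ring.
  refine (proj1 (@isotropic_second_variation _ _ S _ _ (bivRe e4 e3 (- e2) (- e1)) 0 0
    _ _ (bivIm e4 e3 (- e2) (- e1)) 0 0 cS _ S0)) => t x y xE yE.
  have -> : x = bivRe (e1 + t *: e4) (e2 + t *: e3) (e3 - t *: e2) (e4 - t *: e1).
    by apply/matrixP => i j; rewrite xE !mxE; ring.
  have -> : y = bivIm (e1 + t *: e4) (e2 + t *: e3) (e3 - t *: e2) (e4 - t *: e1).
    by apply/matrixP => i j; rewrite yE !mxE; ring.
  apply: (isotropic_form_PIC pS).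
  by split; split; rewrite !(dotDl, dotDr, dotZl, dotZr, dotNl, dotNr) !dots; ring.
- suff : bform S (bivRe e1 e2 e3 e4) (outer e3 e3 - outer e1 e1 + outer e4 e4 - outer e2 e2) +
      bform S (bivIm e1 e2 e3 e4) (outer e3 e4 - outer e4 e3 + outer e1 e2 - outer e2 e1) = 0.
    rewrite [X in X + _]sym0 ?add0r //; by apply/matrixP => i j; rewrite !mxE; ring.
  refine (proj1 (@isotropic_second_variation _ _ S _ _ (bivRe e3 (- e4) (- e1) e2) 0 0
    _ _ (bivIm e3 (- e4) (- e1) e2) 0 0 cS _ S0)) => t x y xE yE.
  have -> : x = bivRe (e1 + t *: e3) (e2 - t *: e4) (e3 - t *: e1) (e4 + t *: e2).
    by apply/matrixP => i j; rewrite xE !mxE; ring.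
  have -> : y = bivIm (e1 + t *: e3) (e2 - t *: e4) (e3 - t *: e1) (e4 + t *: e2).
    by apply/matrixP => i j; rewrite yE !mxE; ring.
  apply: (isotropic_form_PIC pS).
  by split; split; rewrite !(dotDl, dotDr, dotZl, dotZr, dotNl, dotNr) !dots; ring.
Qed.

End IsotropicVariation.

Lemma varReE (R : realType) n (e1 e2 e3 e4 u u' v v' : 'rV[R]_n) i j :
  varRe e1 e2 e3 e4 u u' v v' i j =
  u 0 i * e3 0 j + e1 0 i * v 0 j - u' 0 i * e4 0 j - e2 0 i * v' 0 j.
Proof. by rewrite !mxE. Qed.

Lemma varImE (R : realType) n (e1 e2 e3 e4 u u' v v' : 'rV[R]_n) i j :
  varIm e1 e2 e3 e4 u u' v v' i j =
  u 0 i * e4 0 j + e1 0 i * v' 0 j + u' 0 i * e3 0 j + e2 0 i * v 0 j.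
Proof. by rewrite !mxE. Qed.

Definition picc (R : realType) n (S : tensor4 R n) (i j k l : 'I_n) : R :=
  tcomp S i k i k + tcomp S i l i l + tcomp S j k j k + tcomp S j l j l - 2 * tcomp S i j k l.

Lemma orthonormal_frame_ev (R : realType) n (s : seq 'I_n) :
  uniq s -> orthonormal_frame [seq ev i : 'rV[R]_n | i <- s].
Proof.
move=> us i j; rewrite size_map => si sj; case: s us si sj => // x s us si sj.
by rewrite !(nth_map x) // dot_ev nth_uniq.
Qed.

(** * Nonnegativity of Q where an isotropic curvature of a PIC tensor vanishes *)

Section Wilking.
Variables (R : realType) (n : nat) (S : tensor4 R n) (i1 i2 i3 i4 : 'I_n).
Hypotheses (pS : PIC S) (ui : uniq [:: i1; i2; i3; i4]) (S0 : picc S i1 i2 i3 i4 = 0).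

Let cS : curvature_tensor S. Proof. by case: pS. Qed.

Let eO : orthonormal_frame [:: ev i1 : 'rV[R]_n; ev i2; ev i3; ev i4].
Proof. exact: (@orthonormal_frame_ev R n [:: i1; i2; i3; i4]). Qed.

Let S0' : isotropic_form S (ev i1) (ev i2) (ev i3) (ev i4) = 0.
Proof. by rewrite isotropic_formE // !tform_ev. Qed.

Let outer0l (u : 'rV[R]_n) : outer 0 u = 0.
Proof. by apply/matrixP => i j; rewrite !mxE mul0r. Qed.

Let outer0r (u : 'rV[R]_n) : outer u 0 = 0.
Proof. by apply/matrixP => i j; rewrite !mxE mulr0. Qed.

Let normal0 : normal_to (ev i1) (ev i2) (ev i3) (ev i4) (0 : 'rV[R]_n).
Proof. by split; rewrite dot0l. Qed.

Let normal_ev p : p \notin [:: i1; i2; i3; i4] ->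
  normal_to (ev i1) (ev i2) (ev i3) (ev i4) (ev p : 'rV[R]_n).
Proof.
rewrite !inE !negb_or => /and4P[p1 p2 p3 p4].
by split; rewrite dot_ev ?(negPf p1) ?(negPf p2) ?(negPf p3) ?(negPf p4).
Qed.

Let first_variation p : p \notin [:: i1; i2; i3; i4] ->
  [/\ tcomp S i1 i3 p i3 - tcomp S i2 i4 p i3 + tcomp S i1 i4 p i4 + tcomp S i2 i3 p i4 = 0,
      tcomp S i1 i4 p i3 + tcomp S i2 i3 p i3 - tcomp S i1 i3 p i4 + tcomp S i2 i4 p i4 = 0,
      tcomp S i1 i3 i1 p - tcomp S i2 i4 i1 p + tcomp S i1 i4 i2 p + tcomp S i2 i3 i2 p = 0 &
      tcomp S i1 i4 i1 p + tcomp S i2 i3 i1 p - tcomp S i1 i3 i2 p + tcomp S i2 i4 i2 p = 0].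
Proof.
move=> pF; have np := normal_ev pF.
have V := isotropic_first_variation pS eO S0'.
have simp := (outer0l, outer0r, subr0, addr0, sub0r, add0r).
split.
- have := V _ _ _ _ np normal0 normal0 normal0.
  rewrite /varRe /varIm !simp /bivRe /bivIm !(bformDl, bformNl) !bform_outer !tform_ev; lra.
- have := V _ _ _ _ normal0 np normal0 normal0.
  rewrite /varRe /varIm !simp /bivRe /bivIm !(bformDl, bformNl, bformNr) !bform_outer !tform_ev; lra.
- have := V _ _ _ _ normal0 normal0 np normal0.
  rewrite /varRe /varIm !simp /bivRe /bivIm !(bformDl, bformNl) !bform_outer !tform_ev; lra.
- have := V _ _ _ _ normal0 normal0 normal0 np.
  rewrite /varRe /varIm !simp /bivRe /bivIm !(bformDl, bformNl, bformNr) !bform_outer !tform_ev; lra.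
Qed.

Let sharp p q (i j k l : 'I_n) : R :=
  tcomp S i p k q * tcomp S j p l q - tcomp S i p l q * tcomp S j p k q.

(** Contribution of the index pair (p, q) in the sharp part of [Q] to the isotropic curvature,
    written without the Bianchi identity. *)
Let T p q : R := 2 * (sharp p q i1 i3 i1 i3 + sharp p q i1 i4 i1 i4 + sharp p q i2 i3 i2 i3
  + sharp p q i2 i4 i2 i4 - 2 * sharp p q i1 i3 i2 i4 + 2 * sharp p q i1 i4 i2 i3).

Let al x y := fun k l => @curv_antil R n S x y k l cS.
Let ar x y := fun i j => @curv_antir R n S i j x y cS.
Let zl x := fun k l => @curv_iikl R n S x k l cS.
Let zr x := fun i j => @curv_ijkk R n S i j x cS.

(** Pairs of one frame index and one normal index cancel: the first variation expresses half of the
    components involved through the others. *)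
Let T_mixed p : p \notin [:: i1; i2; i3; i4] ->
  (T i1 p + T i2 p + T i3 p + T i4 p) + (T p i1 + T p i2 + T p i3 + T p i4) = 0.
Proof.
move=> pF; have [] := first_variation pF.
have B1 := curv_bianchi i1 i2 i3 p cS. have B2 := curv_bianchi i1 i2 i4 p cS.
have B3 := curv_bianchi i1 i3 i4 p cS. have B4 := curv_bianchi i2 i3 i4 p cS.
move: B1 B2 B3 B4.
have sy x a b : tcomp S x p a b = tcomp S a b x p by exact: curv_sym.
have rules := (al p i1, al p i2, al p i3, al p i4, ar p i1, ar p i2, ar p i3, ar p i4,
  (sy i1, sy i2, sy i3, sy i4), (zl i1, zl i2, zl i3, zl i4),
  (al i2 i1, al i3 i1, al i4 i1, al i3 i2, al i4 i2, al i4 i3)).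
rewrite /T /sharp !rules => B1 B2 B3 B4 V1 V2 V3 V4.
(* [E1] to [E4] come from the Bianchi identity, [E5] to [E8] from the first variation; after these
   eliminations the claim is a polynomial identity. *)
have E1 : tcomp S i1 i2 i3 p = tcomp S i1 i3 i2 p - tcomp S i2 i3 i1 p by lra.
have E2 : tcomp S i1 i2 i4 p = tcomp S i1 i4 i2 p - tcomp S i2 i4 i1 p by lra.
have E3 : tcomp S i3 i4 i1 p = tcomp S i1 i4 i3 p - tcomp S i1 i3 i4 p by lra.
have E4 : tcomp S i3 i4 i2 p = tcomp S i2 i4 i3 p - tcomp S i2 i3 i4 p by lra.
have E5 : tcomp S i1 i3 i3 p = tcomp S i2 i4 i3 p - tcomp S i1 i4 i4 p - tcomp S i2 i3 i4 p by lra.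
have E6 : tcomp S i1 i3 i4 p = tcomp S i2 i4 i4 p + tcomp S i1 i4 i3 p + tcomp S i2 i3 i3 p by lra.
have E7 : tcomp S i1 i3 i1 p = tcomp S i2 i4 i1 p - tcomp S i1 i4 i2 p - tcomp S i2 i3 i2 p by lra.
have E8 : tcomp S i1 i3 i2 p = tcomp S i2 i4 i2 p + tcomp S i1 i4 i1 p + tcomp S i2 i3 i1 p by lra.
rewrite !(E1, E2, E3, E4) !(E5, E6, E7, E8); ring.
Qed.

(** Pairs inside the frame cancel by the two variations within its span together with the vanishing
    of the isotropic curvature itself. *)
Let T_frame : T i1 i1 + T i1 i2 + T i1 i3 + T i1 i4 + (T i2 i1 + T i2 i2 + T i2 i3 + T i2 i4)
  + (T i3 i1 + T i3 i2 + T i3 i3 + T i3 i4) + (T i4 i1 + T i4 i2 + T i4 i3 + T i4 i4) = 0.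
Proof.
have [V1 V2] := isotropic_first_variation_frame pS eO S0'.
move: V1 V2 S0 (curv_bianchi i1 i2 i3 i4 cS).
rewrite /bivRe /bivIm !(bformDl, bformNl, bformDr, bformNr) !bform_outer !tform_ev /picc.
have sy a b c d : tcomp S a b c d = tcomp S c d a b by exact: curv_sym.
have rules := ((zl i1, zl i2, zl i3, zl i4), (zr i1, zr i2, zr i3, zr i4),
  (al i2 i1, al i3 i1, al i4 i1, al i3 i2, al i4 i2, al i4 i3),
  (ar i2 i1, ar i3 i1, ar i4 i1, ar i3 i2, ar i4 i2, ar i4 i3)).
have pairs := ((sy i1 i3 i1 i2, sy i1 i4 i1 i2, sy i2 i3 i1 i2, sy i2 i4 i1 i2, sy i3 i4 i1 i2),
  (sy i1 i4 i1 i3, sy i2 i3 i1 i3, sy i2 i4 i1 i3, sy i3 i4 i1 i3),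
  (sy i2 i3 i1 i4, sy i2 i4 i1 i4, sy i3 i4 i1 i4),
  (sy i2 i4 i2 i3, sy i3 i4 i2 i3, sy i3 i4 i2 i4)).
rewrite /T /sharp !rules !pairs => V1 V2 P0 B.
have E1 : tcomp S i1 i3 i3 i4 = tcomp S i2 i4 i3 i4 - tcomp S i1 i2 i1 i3 + tcomp S i1 i2 i2 i4 by lra.
have E2 : tcomp S i1 i4 i3 i4 = - tcomp S i2 i3 i3 i4 - tcomp S i1 i2 i1 i4 - tcomp S i1 i2 i2 i3 by lra.
have E3 : tcomp S i1 i2 i3 i4 = tcomp S i1 i3 i2 i4 - tcomp S i1 i4 i2 i3 by lra.
have E4 : tcomp S i1 i3 i1 i3 = 2 * tcomp S i1 i3 i2 i4 - 2 * tcomp S i1 i4 i2 i3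
  - tcomp S i1 i4 i1 i4 - tcomp S i2 i3 i2 i3 - tcomp S i2 i4 i2 i4 by lra.
rewrite !(E1, E2, E3, E4); ring.
Qed.

Let F p := p \notin [:: i1; i2; i3; i4].

Let sum4 (f : 'I_n -> R) : \sum_p f p = f i1 + f i2 + f i3 + f i4 + \sum_(p | F p) f p.
Proof.
have : [/\ i2 != i1, i3 != i1, i3 != i2 & [/\ i4 != i1, i4 != i2 & i4 != i3]].
  move: ui; rewrite /= !inE !negb_or !(eq_sym _ i4) !(eq_sym _ i3) (eq_sym i1 i2).
  by move=> /and4P[/and3P[-> -> ->] /andP[-> ->] -> _].
move=> [h21 h31 h32 [h41 h42 h43]].
rewrite (bigD1 i1) //= (bigD1 i2) //= (bigD1 i3) ?h31 ?h32 //= (bigD1 i4) ?h41 ?h42 ?h43 //= !addrA.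
by congr (_ + _); apply: eq_bigl => p; rewrite /F !inE !negb_or !andbA.
Qed.

Let sum44 (f : 'I_n -> 'I_n -> R) : \sum_p \sum_q f p q =
  (f i1 i1 + f i1 i2 + f i1 i3 + f i1 i4 + (f i2 i1 + f i2 i2 + f i2 i3 + f i2 i4)
  + (f i3 i1 + f i3 i2 + f i3 i3 + f i3 i4) + (f i4 i1 + f i4 i2 + f i4 i3 + f i4 i4))
  + \sum_(p | F p) ((f i1 p + f i2 p + f i3 p + f i4 p) + (f p i1 + f p i2 + f p i3 + f p i4))
  + \sum_(p | F p) \sum_(q | F q) f p q.
Proof.
under eq_bigr do rewrite sum4; rewrite big_split /= sum4 (sum4 (fun p => \sum_(q | F q) f p q)).
rewrite !big_split /=; ring.
Qed.

(* Trace of the product of the positive form of isotropic_hessian_ge0 with its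
   pull-back by (u, v) |-> (conj v, - conj u). *)
Let T_normal : 0 <= \sum_(p | F p) \sum_(q | F q) T p q.
Proof.
pose f (p : 'I_n) : 'rV[R]_n := if F p then ev p else 0.
pose vec (x : 'I_n -> R) : 'rV[R]_n := \row_p (if F p then x p else 0).
have nvec x : normal_to (ev i1) (ev i2) (ev i3) (ev i4) (vec x).
  have d i : ~~ F i -> dot (vec x) (ev i) = 0.
    move=> /negbTE Fi; rewrite /dot; under eq_bigr do rewrite evE.
    by rewrite sum_delta mxE Fi.
  by split; apply: d; rewrite /F negbK !inE eqxx ?orbT.
have fE p i : f p 0 i = (F p)%:R * (p == i)%:R.
  by rewrite /f; case: (F p); rewrite ?evE ?mxE ?mul0r ?mul1r // eq_sym.
have vecE x i : \sum_p x p * f p 0 i = vec x 0 i.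
  under eq_bigr do rewrite fE mulrA.
  by rewrite sum_delta mxE; case: (F i); rewrite ?mulr1 ?mulr0.
pose e1 : 'rV[R]_n := ev i1; pose e2 : 'rV[R]_n := ev i2.
pose e3 : 'rV[R]_n := ev i3; pose e4 : 'rV[R]_n := ev i4.
(* One copy of ['I_n] for each of u, u', v, v', the real and imaginary parts of the two
   variations. *)
pose I := (('I_n + 'I_n) + ('I_n + 'I_n))%type.
have sumI (G : I -> R) : \sum_i G i =
    \sum_p (G (inl (inl p)) + G (inl (inr p)) + (G (inr (inl p)) + G (inr (inr p)))).
  by rewrite big_sumType /= !big_sumType /= -!big_split.
pose X (i : I) := match i with
  | inl (inl p) => outer (f p) e3 | inl (inr p) => - outer (f p) e4
  | inr (inl p) => outer e1 (f p) | inr (inr p) => - outer e2 (f p) end.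
pose Y (i : I) := match i with
  | inl (inl p) => outer (f p) e4 | inl (inr p) => outer (f p) e3
  | inr (inl p) => outer e2 (f p) | inr (inr p) => outer e1 (f p) end.
pose X' (i : I) := match i with
  | inl (inl p) => - outer e1 (f p) | inl (inr p) => - outer e2 (f p)
  | inr (inl p) => outer (f p) e3 | inr (inr p) => outer (f p) e4 end.
pose Y' (i : I) := match i with
  | inl (inl p) => - outer e2 (f p) | inl (inr p) => outer e1 (f p)
  | inr (inl p) => outer (f p) e4 | inr (inr p) => - outer (f p) e3 end.
have bsuml (Z : I -> 'M[R]_n) y : bform S (\sum_i Z i) y = \sum_i bform S (Z i) y.
  by apply: (big_morph (fun z => bform S z y)) => [z1 z2|]; rewrite ?bformDl ?bform0l.
have gram (Z : I -> 'M[R]_n) (x : I -> R) : \sum_i \sum_j bform S (Z i) (Z j) * x i * x j =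
    bform S (\sum_i x i *: Z i) (\sum_i x i *: Z i).
  rewrite bsuml; apply: eq_bigr => i _; rewrite bform_sym // bsuml; apply: eq_bigr => j _.
  by rewrite bformZl bformZr bform_sym //; ring.
have XE x : \sum_i x i *: X i = varRe e1 e2 e3 e4 (vec (fun p => x (inl (inl p))))
    (vec (fun p => x (inl (inr p)))) (vec (fun p => x (inr (inl p)))) (vec (fun p => x (inr (inr p)))).
  apply/matrixP => a b; rewrite summxE sumI varReE -!vecE.
  rewrite (mulr_suml _ _ _ (e3 0 b)) (mulr_suml _ _ _ (e4 0 b)) !mulr_sumr -!sumrN -!big_split; apply: eq_bigr => p _ /=; rewrite !mxE; ring.
have YE x : \sum_i x i *: Y i = varIm e1 e2 e3 e4 (vec (fun p => x (inl (inl p))))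
    (vec (fun p => x (inl (inr p)))) (vec (fun p => x (inr (inl p)))) (vec (fun p => x (inr (inr p)))).
  apply/matrixP => a b; rewrite summxE sumI varImE -!vecE.
  rewrite (mulr_suml _ _ _ (e4 0 b)) (mulr_suml _ _ _ (e3 0 b)) !mulr_sumr -!big_split; apply: eq_bigr => p _ /=; rewrite !mxE; ring.
have X'E x : \sum_i x i *: X' i = varRe e1 e2 e3 e4 (vec (fun p => x (inr (inl p))))
    (vec (fun p => - x (inr (inr p)))) (vec (fun p => - x (inl (inl p)))) (vec (fun p => x (inl (inr p)))).
  apply/matrixP => a b; rewrite summxE sumI varReE -!vecE.
  rewrite (mulr_suml _ _ _ (e3 0 b)) (mulr_suml _ _ _ (e4 0 b)) !mulr_sumr -!sumrN -!big_split; apply: eq_bigr => p _ /=; rewrite !mxE; ring.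
have Y'E x : \sum_i x i *: Y' i = varIm e1 e2 e3 e4 (vec (fun p => x (inr (inl p))))
    (vec (fun p => - x (inr (inr p)))) (vec (fun p => - x (inl (inl p)))) (vec (fun p => x (inl (inr p)))).
  apply/matrixP => a b; rewrite summxE sumI varImE -!vecE.
  rewrite (mulr_suml _ _ _ (e4 0 b)) (mulr_suml _ _ _ (e3 0 b)) !mulr_sumr -!big_split; apply: eq_bigr => p _ /=; rewrite !mxE; ring.
have psd (Z W : I -> 'M[R]_n) : (forall x : I -> R, exists x0 x1 x2 x3,
     \sum_i x i *: Z i = varRe e1 e2 e3 e4 (vec x0) (vec x1) (vec x2) (vec x3) /\
     \sum_i x i *: W i = varIm e1 e2 e3 e4 (vec x0) (vec x1) (vec x2) (vec x3)) ->
   forall x : I -> R, 0 <= \sum_i \sum_j (bform S (Z i) (Z j) + bform S (W i) (W j)) * x i * x j.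
  move=> ZW x; have [x0 [x1 [x2 [x3 [Zx Wx]]]]] := ZW x.
  have -> : \sum_i \sum_j (bform S (Z i) (Z j) + bform S (W i) (W j)) * x i * x j =
      \sum_i \sum_j bform S (Z i) (Z j) * x i * x j + \sum_i \sum_j bform S (W i) (W j) * x i * x j.
    rewrite -big_split; apply: eq_bigr => i _; rewrite -big_split; apply: eq_bigr => j _ /=; ring.
  by rewrite !gram Zx Wx; exact: isotropic_hessian_ge0.
have XYs i j : bform S (X i) (X j) + bform S (Y i) (Y j) = bform S (X j) (X i) + bform S (Y j) (Y i).
  by rewrite (bform_sym (X i)) // (bform_sym (Y i)).
have XYp : forall x : I -> R, 0 <= \sum_i \sum_j (bform S (X i) (X j) + bform S (Y i) (Y j)) * x i * x j.
  by apply: psd => x; do 4![eexists]; split; [exact: XE|exact: YE].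
have XY'p : forall x : I -> R, 0 <= \sum_i \sum_j (bform S (X' i) (X' j) + bform S (Y' i) (Y' j)) * x i * x j.
  by apply: psd => x; do 4![eexists]; split; [exact: X'E|exact: Y'E].
have := psd_trace_ge0 XYs XYp XY'p.
have -> : \sum_i \sum_j (bform S (X i) (X j) + bform S (Y i) (Y j)) *
     (bform S (X' i) (X' j) + bform S (Y' i) (Y' j)) =
   2 * \sum_(p | F p) \sum_(q | F q) T p q; last by rewrite pmulr_rge0.
under eq_bigr do rewrite sumI.
(* The trace produces [T p q + T q p] termwise, so the other side is symmetrised first. *)
have -> : 2 * \sum_(p | F p) \sum_(q | F q) T p q = \sum_(p | F p) \sum_(q | F q) (T p q + T q p).
  under [RHS]eq_bigr do rewrite big_split /=.
  by rewrite big_split /= [X in _ = _ + X]exchange_big /= mulr_natl mulr2n.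
rewrite sumI [RHS]big_mkcond; apply: eq_bigr => p _.
rewrite -!big_split /= -[RHS](_ : \sum_q (if F p && F q then T p q + T q p else 0) = _); last first.
  case: (F p) => /=; last by rewrite big1.
  by rewrite [RHS]big_mkcond.
apply: eq_bigr => q _.
have zeros := (outer0l, outer0r, oppr0, bform0l, bform0r).
case Fp: (F p); last by rewrite /f Fp !zeros /=; ring.
case Fq: (F q); last by rewrite /f Fq !zeros /=; ring.
have rules := (al p i3, al p i4, ar q i3, ar q i4).
have sy i j : tcomp S i p j q = tcomp S j q i p by exact: curv_sym.
have sy' i j : tcomp S i q j p = tcomp S j p i q by exact: curv_sym.
have syms := ((sy i2 i1, sy i3 i1, sy i4 i1, sy i3 i2, sy i4 i2, sy i4 i3),
  (sy' i2 i1, sy' i3 i1, sy' i4 i1, sy' i3 i2, sy' i4 i2, sy' i4 i3),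
  (sy' i1 i1, sy' i2 i2, sy' i3 i3, sy' i4 i4)).
rewrite /f Fp Fq !(bformNl, bformNr) !bform_outer /e1 /e2 /e3 /e4 !tform_ev !rules /T /sharp /= !syms.
ring.
Qed.

Let isotropic_Q : 0 <= \sum_p \sum_q T p q.
Proof.
by rewrite sum44 T_frame add0r big1 ?add0r; [exact: T_normal|exact: T_mixed].
Qed.

(* The part of Q quadratic in the curvature operator is a sum of squares in the
   form of the isotropic curvature that does not use the Bianchi identity. *)
Lemma picc_Q_ge0 : 0 <= picc (Q S) i1 i2 i3 i4.
Proof.
have cQ := curv_Q cS.
have -> : picc (Q S) i1 i2 i3 i4 = tcomp (Q S) i1 i3 i1 i3 + tcomp (Q S) i1 i4 i1 i4
    + tcomp (Q S) i2 i3 i2 i3 + tcomp (Q S) i2 i4 i2 i4 - 2 * tcomp (Q S) i1 i3 i2 i4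
    + 2 * tcomp (Q S) i1 i4 i2 i3.
  have := curv_bianchi i1 i2 i3 i4 cQ; rewrite /picc (curv_sym i2 i3 i1 i4 cQ).
  rewrite (curv_antil i3 i1 i2 i4 cQ); lra.
have -> : tcomp (Q S) i1 i3 i1 i3 + tcomp (Q S) i1 i4 i1 i4
    + tcomp (Q S) i2 i3 i2 i3 + tcomp (Q S) i2 i4 i2 i4 - 2 * tcomp (Q S) i1 i3 i2 i4
    + 2 * tcomp (Q S) i1 i4 i2 i3 =
  \sum_p \sum_q ((tcomp S i1 i3 p q - tcomp S i2 i4 p q) ^+ 2
    + (tcomp S i1 i4 p q + tcomp S i2 i3 p q) ^+ 2) + \sum_p \sum_q T p q.
  rewrite !tcompQ /T !mulrDr !mulr_sumr -!(sumrN, big_split); apply: eq_bigr => p _ /=.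
  rewrite !mulr_sumr -!(sumrN, big_split); apply: eq_bigr => q _ /=.
  by rewrite /sharp; ring.
apply: addr_ge0; last exact: isotropic_Q.
by apply: sumr_ge0 => p _; apply: sumr_ge0 => q _; apply: addr_ge0; exact: sqr_ge0.
Qed.

End Wilking.

(** * Consequences of nonnegative isotropic curvature *)

Section PairwiseSums.
Variables (R : realType) (I : finType).

(** Adding x_k + x_l over all ordered pairs of distinct indices counts every entry 2 (|J| - 1)
    times. *)
Lemma sum_pairwise_ge0 (J : {set I}) (x : I -> R) : (1 < #|J|)%N ->
  (forall k l, k \in J -> l \in J -> k != l -> 0 <= x k + x l) ->
  0 <= \sum_(k in J) x k.
Proof.
move=> J1 xx; set X := \sum_(k in J) x k.
have m1 : 1 < #|J|%:R :> R by rewrite ltr1n.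
have : 0 <= \sum_(k in J) \sum_(l in J | l != k) (x k + x l).
  by apply: sumr_ge0 => k kJ; apply: sumr_ge0 => l /andP[lJ lk]; rewrite xx // eq_sym.
have -> : \sum_(k in J) \sum_(l in J | l != k) (x k + x l) = 2 * (#|J|%:R - 1) * X.
  transitivity (\sum_(k in J) (#|J|%:R * x k + X - 2 * x k)).
    apply: eq_bigr => k kJ.
    have : \sum_(l in J) (x k + x l) = #|J|%:R * x k + X.
      by rewrite big_split /= sumr_const -[x k *+ _]mulr_natl.
    by rewrite (bigD1 k) //= => h; lra.
  rewrite sumrB big_split /= -!mulr_sumr sumr_const -[X *+ _]mulr_natl -/X; ring.
by rewrite pmulr_rge0 //; lra.
Qed.

Lemma sqr_sum_le (J : {set I}) (x : I -> R) :
  (\sum_(k in J) x k) ^+ 2 <= #|J|%:R * \sum_(k in J) x k ^+ 2.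
Proof.
set X := \sum_(k in J) x k.
have : 0 <= \sum_(k in J) \sum_(l in J) (x k - x l) ^+ 2.
  by apply: sumr_ge0 => k _; apply: sumr_ge0 => l _; exact: sqr_ge0.
have -> : \sum_(k in J) \sum_(l in J) (x k - x l) ^+ 2 =
    2 * (#|J|%:R * (\sum_(k in J) x k ^+ 2)) - 2 * X ^+ 2.
  transitivity (\sum_(k in J) (#|J|%:R * x k ^+ 2 - 2 * X * x k + \sum_(l in J) x l ^+ 2)).
    apply: eq_bigr => k kJ.
    transitivity (\sum_(l in J) (x k ^+ 2 - 2 * x k * x l + x l ^+ 2)).
      by apply: eq_bigr => l _; ring.
    by rewrite big_split sumrB /= sumr_const -mulr_sumr -/X -[X in X - _]mulr_natl; ring.
  rewrite big_split sumrB /= -!mulr_sumr sumr_const -/X -[X in _ + X]mulr_natl; ring.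
lra.
Qed.

(** The difference of the two sides is the sum of x_k (X - x_k). At most one entry x_m is negative;
    its term equals x_m times the sum of the other entries and is distributed over them. The
    coefficient of x_k becomes X - x_k + x_m, which is nonnegative since at least two further
    entries are each at least -x_m; this is where four indices are required. *)
Lemma sum_sqr_le_pairwise (J : {set I}) (x : I -> R) : (3 < #|J|)%N ->
  (forall k l, k \in J -> l \in J -> k != l -> 0 <= x k + x l) ->
  \sum_(k in J) x k ^+ 2 <= (\sum_(k in J) x k) ^+ 2.
Proof.
move=> J3 xx; set X := \sum_(k in J) x k.
have XD k : k \in J -> X = x k + \sum_(l in J :\ k) x l.
  move=> kJ; rewrite /X (bigD1 k) //=; congr (_ + _); apply: eq_bigl => l.
  by rewrite !inE andbC.
have cD k : k \in J -> #|J :\ k| = #|J|.-1 by move=> kJ; rewrite (cardsD1 k J) kJ.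
have sub_ge0 k : k \in J -> 0 <= \sum_(l in J :\ k) x l.
  move=> kJ; apply: sum_pairwise_ge0; first by rewrite cD //; move: J3; case: #|J| => [|[|[]]].
  by move=> a b; rewrite !inE => /andP[_ aJ] /andP[_ bJ]; exact: xx.
rewrite -subr_ge0; have -> : X ^+ 2 - \sum_(k in J) x k ^+ 2 = \sum_(k in J) x k * (X - x k).
  rewrite expr2 {1}/X mulr_suml -sumrB; apply: eq_bigr => k _; ring.
have [/existsP[m /andP[mJ xm]]|/existsPn x0] := boolP [exists m, (m \in J) && (x m < 0)]; last first.
  apply: sumr_ge0 => k kJ; rewrite mulr_ge0 //; first by have := x0 k; rewrite kJ /= -leNgt.
  by have := sub_ge0 k kJ; have := XD k kJ; lra.
have Jm : forall f : I -> R, \sum_(k in J) f k = f m + \sum_(k in J :\ m) f k.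
  by move=> f; rewrite (bigD1 m) //=; congr (_ + _); apply: eq_bigl => l; rewrite !inE andbC.
have -> : \sum_(k in J) x k * (X - x k) = \sum_(k in J :\ m) (x k * (X - x k) + x m * x k).
  rewrite Jm big_split /= -(mulr_sumr _ _ _ (x m)) addrC; congr (_ + _).
  by congr (_ * _); have := XD m mJ; lra.
apply: sumr_ge0 => k.
rewrite !inE => /andP[km kJ].
have xk : 0 <= x k by have := xx _ _ kJ mJ km; lra.
suff : - x m <= X - x k by rewrite (XD m mJ) => h; nra.
have -> : X - x k = x m + \sum_(l in J :\ m :\ k) x l.
  rewrite (XD m mJ) (bigD1 k) /=; last by rewrite !inE km.
  have -> : \sum_(i in J :\ m | i != k) x i = \sum_(l in J :\ m :\ k) x l.
    by apply: eq_bigl => l; rewrite !inE andbC.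
  ring.
have : \sum_(l in J :\ m :\ k) (- x m) <= \sum_(l in J :\ m :\ k) x l.
  by apply: ler_sum => l; rewrite !inE => /and3P[_ lm lJ]; have := xx _ _ lJ mJ lm; lra.
have c2 : (1 < #|J :\ m :\ k|)%N.
  rewrite -ltnS; have := cardsD1 k (J :\ m); rewrite cD // !inE km kJ /= add1n => <-.
  by move: J3; case: #|J| => [|[|[|[]]]].
rewrite sumr_const -[_ *+ _]mulr_natl => h.
have : 2 <= #|J :\ m :\ k|%:R :> R by rewrite ler_nat.
nra.
Qed.

End PairwiseSums.

Lemma sum_setT (R : realType) (I : finType) (f : I -> R) : \sum_(i in [set: I]%SET) f i = \sum_i f i.
Proof. by apply: eq_bigl => i; rewrite inE. Qed.

Lemma sum_in_rem (R : realType) (I : finType) (J : {set I}) (f : I -> R) i : i \in J ->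
  \sum_(k in J) f k = f i + \sum_(k in J :\ i) f k.
Proof.
by move=> iJ; rewrite (bigD1 i) //=; congr (_ + _); apply: eq_bigl => k; rewrite !inE andbC.
Qed.

Lemma sum_offdiag (R : realType) (I : finType) (J : {set I}) (f : I -> I -> R) :
  \sum_(i in J) \sum_(j in J) f i j = \sum_(i in J) f i i + \sum_(i in J) \sum_(j in J :\ i) f i j.
Proof. by rewrite -big_split; apply: eq_bigr => i iJ /=; exact: sum_in_rem. Qed.

(* [K i j] stands for the sectional curvatures and [a] for the sums
   [K i1 p + K i2 p]. The Bianchi-free form of the condition, together with
   [2 K i1 i2 + \sum a <= 0], bounds the [K p q] from below by
   [(\sum a) / 2 - (a p + a q) / 2]. *)
Lemma weighted_sum_ge (R : realType) (I : finType) (J : {set I}) (K : I -> I -> R) (a : I -> R) (k12 : R) :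
  (2 < #|J|)%N ->
  (forall p, K p p = 0) ->
  (forall p q, p \in J -> q \in J -> p != q -> 0 <= a p + a q) ->
  (forall p q, p \in J -> q \in J -> p != q -> 0 <= 2 * k12 + 2 * K p q + a p + a q) ->
  (forall p q, K p q = K q p) ->
  2 * k12 + \sum_(p in J) a p <= 0 ->
  (\sum_(p in J) a p) ^+ 2 / 2 <= \sum_(p in J) a p * (a p + \sum_(q in J) K p q).
Proof.
move=> J2 K0 aa KK Ks; set T := \sum_(p in J) a p => k0; set m := #|J|%:R : R.
set S2 := \sum_(p in J) a p ^+ 2.
have T0 : 0 <= T by apply: sum_pairwise_ge0 => //; exact: ltnW.
have -> : \sum_(p in J) a p * (a p + \sum_(q in J) K p q) =
    S2 + (\sum_(p in J) \sum_(q in J) (a p + a q) * K p q) / 2.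
  have -> : \sum_(p in J) \sum_(q in J) (a p + a q) * K p q = 2 * \sum_(p in J) \sum_(q in J) a p * K p q.
    have ex : \sum_(p in J) \sum_(q in J) a p * K p q = \sum_(p in J) \sum_(q in J) a q * K p q.
      rewrite exchange_big; apply: eq_bigr => p _; apply: eq_bigr => q _; by rewrite (Ks q p).
    rewrite mulr_natl mulr2n {2}ex -big_split; apply: eq_bigr => p _ /=.
    by rewrite -big_split; apply: eq_bigr => q _ /=; ring.
  rewrite mulrAC divff ?pnatr_eq0 // mul1r -big_split; apply: eq_bigr => p _ /=.
  by rewrite mulrDr mulr_sumr expr2.
have L : \sum_(p in J) \sum_(q in J) (a p + a q) * (- (a p + a q) / 2 - k12)
   - \sum_(p in J) (2 * a p) * (- (2 * a p) / 2 - k12) <=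
   \sum_(p in J) \sum_(q in J) (a p + a q) * K p q.
  rewrite sum_offdiag [leRHS]sum_offdiag.
  have -> : \sum_(i in J) (a i + a i) * (- (a i + a i) / 2 - k12) =
     \sum_(p in J) (2 * a p) * (- (2 * a p) / 2 - k12) by apply: eq_bigr => p _; ring.
  have -> : \sum_(i in J) (a i + a i) * K i i = 0 by apply: big1 => p _; rewrite K0 mulr0.
  rewrite addrAC subrr; apply: lerD => //; apply: ler_sum => p pJ; apply: ler_sum => q.
  rewrite !inE => /andP[qp qJ]; apply: ler_wpM2l; first by apply: aa => //; rewrite eq_sym.
  by have := KK p q pJ qJ; rewrite eq_sym => /(_ qp); lra.
have sc c : \sum_(q in J) c = m * c by rewrite sumr_const mulr_natl.
have E1 : \sum_(p in J) \sum_(q in J) (a p + a q) * (- (a p + a q) / 2 - k12) =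
    - (m * S2) - T ^+ 2 - 2 * k12 * m * T.
  transitivity (\sum_(p in J) (m * (- (a p ^+ 2) / 2 - k12 * a p) - a p * T - S2 / 2 - k12 * T)).
    apply: eq_bigr => p _.
    transitivity (\sum_(q in J) ((- (a p ^+ 2) / 2 - k12 * a p) - a p * a q - a q ^+ 2 / 2 - k12 * a q)).
      by apply: eq_bigr => q _; field.
    by rewrite !sumrB !sc -!mulr_sumr -mulr_suml -/S2 -/T; ring.
  transitivity (\sum_(p in J) (- (m / 2) * a p ^+ 2 - (m * k12 + T) * a p - (S2 / 2 + k12 * T))).
    by apply: eq_bigr => p _; field.
  by rewrite !sumrB !sc -!mulr_sumr -/S2 -/T; field.
have E2 : \sum_(p in J) (2 * a p) * (- (2 * a p) / 2 - k12) = - 2 * S2 - 2 * k12 * T.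
  transitivity (\sum_(p in J) (- 2 * a p ^+ 2 - 2 * k12 * a p)).
    by apply: eq_bigr => p _; field.
  by rewrite sumrB -!mulr_sumr.
rewrite {}E1 {}E2 in L.
have S20 : 0 <= S2 by apply: sumr_ge0 => p _; exact: sqr_ge0.
(* In total the lower bound is (4 - m) S2 / 2 + (m - 2) T^2 / 2. For m = 3 the term in [S2] helps;
   from m = 4 on it is compensated by S2 <= T^2. *)
have [m3|m4] := leqP #|J| 3.
  have m3' : m = 3 by rewrite /m; congr (_%:R); apply/eqP; rewrite eqn_leq m3.
  rewrite m3' in L; have h : 0 <= - (2 * k12 + T) * T by rewrite mulr_ge0 //; lra.
  lra.
have m4' : 4 <= m by rewrite ler_nat.
have S2T : S2 <= T ^+ 2 by exact: sum_sqr_le_pairwise.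
have h1 : 0 <= (m - 4) * (T ^+ 2 - S2) by rewrite mulr_ge0 //; lra.
have h2 : 0 <= (m - 1) * (- (2 * k12 + T) * T) by rewrite mulr_ge0 ?mulr_ge0 //; lra.
lra.
Qed.

Section PICFacts.
Variables (R : realType) (n : nat) (S : tensor4 R n).
Hypotheses (n5 : (5 <= n)%N) (pS : PIC S).

Let cS : curvature_tensor S. Proof. by case: pS. Qed.

Lemma PIC_picc_ge0 i j k l : uniq [:: i; j; k; l] -> 0 <= picc S i j k l.
Proof.
move=> u; have := pS.2 (ev i) (ev j) (ev k) (ev l) (@orthonormal_frame_ev R n _ u).
by rewrite !tform_ev.
Qed.

Definition sec i j := tcomp S i j i j.

Lemma sec_sym i j : sec i j = sec j i.
Proof. by rewrite /sec (curv_antil i j _ _ cS) (curv_antir j i _ _ cS) opprK. Qed.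

Lemma sec_diag i : sec i i = 0.
Proof. exact: curv_iikl. Qed.

Lemma PIC_mixed_le i j k l : uniq [:: i; j; k; l] ->
  2 * `|tcomp S i j k l| <= sec i k + sec i l + sec j k + sec j l.
Proof.
move=> u; have h1 := PIC_picc_ge0 u.
have u2 : uniq [:: i; j; l; k].
  by move: u; rewrite /= !inE !negb_or !(eq_sym l k) => /and4P[/and3P[-> -> ->] /andP[-> ->] ->].
have := PIC_picc_ge0 u2; move: h1; rewrite /picc (curv_antir i j l k cS) /sec => h1 h2.
by case: (ger0P (tcomp S i j k l)) => _; lra.
Qed.

Lemma PIC_sec_ge0 i j k l : uniq [:: i; j; k; l] -> 0 <= sec i k + sec i l + sec j k + sec j l.
Proof. by move=> u; have := PIC_mixed_le u; have := normr_ge0 (tcomp S i j k l); lra. Qed.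

(** For fixed i and j the numbers sec i k + sec j k are pairwise nonnegative in sum, so their total
    over the remaining k in J is nonnegative. Adding over all pairs i, j counts the block 2 (|J| -
    2) times. *)
Lemma PIC_block_ge0 (J : {set 'I_n}) : (3 < #|J|)%N ->
  0 <= \sum_(i in J) \sum_(j in J) sec i j.
Proof.
move=> J3; set D := \sum_(i in J) _; pose d i := \sum_(j in J) sec i j.
have ij_ge0 i j : i \in J -> j \in J -> i != j -> 0 <= d i + d j - 2 * sec i j.
  move=> iJ jJ ij; have jJi : j \in J :\ i by rewrite !inE eq_sym ij.
  have -> : d i + d j - 2 * sec i j = \sum_(k in J :\ i :\ j) (sec i k + sec j k).
    rewrite big_split /= /d (sum_in_rem (sec i) iJ) (sum_in_rem (sec j) iJ).
    rewrite (sum_in_rem (sec i) jJi) (sum_in_rem (sec j) jJi) !sec_diag (sec_sym j i); ring.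
  apply: sum_pairwise_ge0.
    have := cardsD1 j (J :\ i); rewrite jJi; have := cardsD1 i J; rewrite iJ => e1 e2.
    by move: J3; rewrite e1 e2.
  move=> k l; rewrite !inE => /and3P[kj ki _] /and3P[lj li _] kl.
  have := @PIC_sec_ge0 i j k l; rewrite /= !inE !negb_or ij kl !(eq_sym i) ki li !(eq_sym j) kj lj /=.
  by move=> /(_ isT); lra.
have J3' : 3 < #|J|%:R :> R by rewrite (ltr_nat _ 3).
have : 0 <= \sum_(i in J) \sum_(j in J :\ i) (d i + d j - 2 * sec i j).
  apply: sumr_ge0 => i iJ; apply: sumr_ge0 => j; rewrite !inE => /andP[ji jJ].
  by apply: ij_ge0 => //; rewrite eq_sym.
have -> : \sum_(i in J) \sum_(j in J :\ i) (d i + d j - 2 * sec i j) = 2 * (#|J|%:R - 2) * D.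
  have := sum_offdiag J (fun i j => d i + d j - 2 * sec i j).
  have -> : \sum_(i in J) \sum_(j in J) (d i + d j - 2 * sec i j) = 2 * #|J|%:R * D - 2 * D.
    transitivity (\sum_(i in J) (#|J|%:R * d i + D - 2 * d i)).
      apply: eq_bigr => i _; rewrite sumrB big_split /= sumr_const -[X in X + _ - _]mulr_natl.
      by rewrite -mulr_sumr.
    rewrite sumrB big_split /= sumr_const -[X in _ + X - _]mulr_natl -!mulr_sumr -/D.
    ring.
  have -> : \sum_(i in J) (d i + d i - 2 * sec i i) = 2 * D.
    rewrite /D mulr_sumr; apply: eq_bigr => i _; rewrite sec_diag /d; ring.
  lra.
by rewrite pmulr_rge0 //; lra.
Qed.

Lemma Ric_diagE i : Ric S i i = \sum_p sec i p.
Proof. by rewrite RicE. Qed.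

Lemma scal_secE : scal S = \sum_(i in [set: 'I_n]%SET) \sum_(j in [set: 'I_n]%SET) sec i j.
Proof.
rewrite sum_setT; apply: eq_bigr => i _; rewrite sum_setT; exact: Ric_diagE.
Qed.

Lemma PIC_scal_ge0 : 0 <= scal S.
Proof. by rewrite scal_secE PIC_block_ge0 // cardsT card_ord ltnW. Qed.

(** scal - 2 Ric_ii is the block sum over the complement of i, which has at least four elements as n
    >= 5; scal >= 0 then removes the factor 2. *)
Lemma PIC_Ric_le_scal i : Ric S i i <= scal S.
Proof.
pose J := [set: 'I_n]%SET :\ i; have iT : i \in [set: 'I_n]%SET by rewrite inE.
have cJ : #|J|.+1 = n by have := cardsD1 i [set: 'I_n]%SET; rewrite iT cardsT card_ord add1n.
have : 0 <= \sum_(j in J) \sum_(k in J) sec j k.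
  by apply: PIC_block_ge0; rewrite -ltnS cJ.
have E : scal S = 2 * Ric S i i + \sum_(j in J) \sum_(k in J) sec j k.
  have RE j : \sum_(k in [set: 'I_n]%SET) sec j k = sec j i + \sum_(k in J) sec j k.
    exact: sum_in_rem.
  rewrite scal_secE (sum_in_rem _ iT) (eq_bigr _ (fun j _ => RE j)) big_split /=.
  rewrite Ric_diagE -sum_setT RE sec_diag; under [in LHS]eq_bigr do rewrite sec_sym.
  rewrite -/J; ring.
have := PIC_scal_ge0; lra.
Qed.

Lemma PIC_Ric4_ge0 i1 i2 i3 i4 : uniq [:: i1; i2; i3; i4] ->
  0 <= Ric S i1 i1 + Ric S i2 i2 + Ric S i3 i3 + Ric S i4 i4.
Proof.
move=> u; pose J := [set i in [:: i1; i2; i3; i4]]%SET.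
have cJ : #|J| = 4%N by rewrite cardsE; exact/card_uniqP.
have sJ (f : 'I_n -> R) : \sum_(i in J) f i = f i1 + f i2 + f i3 + f i4.
  rewrite (eq_bigl (mem [:: i1; i2; i3; i4])); last by move=> i; rewrite inE.
  by rewrite -big_uniq //= !big_cons big_nil addr0 !addrA.
have cJC : (#|~: J| + 4 = n)%N by rewrite -cJ addnC cardsC card_ord.
(* From n = 6 on the indices outside the frame can be paired; for n = 5 there is a single one, i5,
   and the sum equals scal - Ric_i5i5. *)
have [n6|n5'] := ltnP 5 n.
  have -> : Ric S i1 i1 + Ric S i2 i2 + Ric S i3 i3 + Ric S i4 i4 =
      \sum_(i in J) \sum_(j in J) sec i j + \sum_(p in ~: J) (sec i1 p + sec i2 p + sec i3 p + sec i4 p).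
    have RE i : Ric S i i = \sum_(j in J) sec i j + \sum_(p in ~: J) sec i p.
      by rewrite Ric_diagE (bigID (mem J)) /=; congr (_ + _); apply: eq_bigl => j; rewrite !inE.
    rewrite !RE (sJ (fun i => \sum_(j in J) sec i j)) !big_split /=; ring.
  apply: addr_ge0; first by apply: PIC_block_ge0; rewrite cJ.
  apply: sum_pairwise_ge0; first by rewrite -(ltn_add2r 4) cJC.
  move=> p q; rewrite !inE !negb_or => /and4P[p1 p2 p3 p4] /and4P[q1 q2 q3 q4] pq.
  move: u; rewrite /= !inE !negb_or => /and4P[/and3P[h12 _ _] _ h34 _].
  have := @PIC_sec_ge0 i1 i2 p q; have := @PIC_sec_ge0 i3 i4 p q.
  rewrite /= !inE !negb_or !(eq_sym i1) !(eq_sym i2) !(eq_sym i3) !(eq_sym i4).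
  rewrite p1 p2 p3 p4 q1 q2 q3 q4 pq h12 h34 /= => /(_ isT) a /(_ isT) b; lra.
have : #|~: J| = 1%N by apply/eqP; rewrite -(eqn_add2r 4) cJC eqn_leq n5' n5.
move=> /eqP/cards1P[i5 Ji5].
have : scal S = Ric S i1 i1 + Ric S i2 i2 + Ric S i3 i3 + Ric S i4 i4 + Ric S i5 i5.
  rewrite /scal (bigID (mem J)) /= sJ; congr (_ + _).
  rewrite (eq_bigl (mem [set i5]%SET)); first by rewrite big_set1.
  by move=> i; rewrite -Ji5 !inE.
have := PIC_Ric_le_scal i5; lra.
Qed.

Lemma PIC_Ric_bound i : `|Ric S i i| <= n%:R * scal S.
Proof.
have n5' : 5 <= n%:R :> R by rewrite ler_nat.
have s0 := PIC_scal_ge0; have h := PIC_Ric_le_scal i.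
rewrite ler_norml; apply/andP; split; last by nra.
(* The lower bound comes from the upper ones, Ric_ii being scal minus the remaining diagonal
   entries. *)
have : \sum_(j | j != i) Ric S j j <= \sum_(j < n | j != i) scal S.
  by apply: ler_sum => j _; exact: PIC_Ric_le_scal.
have E : scal S = Ric S i i + \sum_(j | j != i) Ric S j j by rewrite /scal (bigD1 i).
have : \sum_(j < n | j != i) scal S + scal S = n%:R * scal S.
  transitivity (\sum_(j < n) scal S); first by rewrite [RHS](bigD1 i) //= addrC.
  by rewrite sumr_const card_ord mulr_natl.
lra.
Qed.

End PICFacts.

Lemma frobenius_orthogonal (R : realType) n (g M : 'M[R]_n) : orthogonal_mx g ->
  frobenius (g *m M *m g^T) (g *m M *m g^T) = frobenius M M.
Proof.
have fE (N : 'M[R]_n) : frobenius N N = \tr (N *m N^T).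
  apply: eq_bigr => i _; rewrite mxE; apply: eq_bigr => j _; by rewrite mxE.
move=> gO; rewrite !fE !trmx_mul trmxK.
rewrite -!mulmxA (mulmxA g^T g) (mulmx1C gO) mul1mx mxtrace_mulC !mulmxA.
by rewrite -(mulmxA _ g^T g) (mulmx1C gO) mulmx1.
Qed.

Lemma PIC_pullback (R : realType) n (g : 'M[R]_n) (S : tensor4 R n) : orthogonal_mx g ->
  PIC S -> PIC (pullback g S).
Proof.
move=> gO [cS pS]; split; first exact: curv_pullback.
move=> e1 e2 e3 e4 eO; rewrite !tform_pullback; apply: pS.
have gd u v : dot (u *m g) (v *m g) = dot u v.
  have dE (x y : 'rV[R]_n) : dot x y = (x *m y^T) 0 0.
    by rewrite mxE; apply: eq_bigr => i _; rewrite mxE.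
  by rewrite !dE trmx_mul mulmxA -(mulmxA u) gO mulmx1.
move=> i j; have := eO i j.
by case: i => [|[|[|[|i]]]]; case: j => [|[|[|[|j]]]] //= /[apply]/[apply]; rewrite gd.
Qed.

Lemma PIC_frobenius_bound (R : realType) n (S : tensor4 R n) : (5 <= n)%N -> PIC S ->
  frobenius (Ric S) (Ric S) <= n%:R ^+ 3 * scal S ^+ 2.
Proof.
move=> n5 pS; have cS := pS.1.
have [g [gO _ gd]] := spectral_fixing 0 (Ric_sym cS).
have := PIC_Ric_bound n5 (PIC_pullback gO pS); rewrite scal_pullback // => b.
rewrite -(frobenius_orthogonal _ gO) -Ric_pullback //.
have -> : frobenius (Ric (pullback g S)) (Ric (pullback g S)) = \sum_i Ric (pullback g S) i i ^+ 2.
  apply: eq_bigr => i _; rewrite (bigD1 i) //= big1 ?addr0 ?expr2 // => j ji.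
  by rewrite Ric_pullback // gd ?mulr0 // eq_sym.
have -> : n%:R ^+ 3 * scal S ^+ 2 = \sum_(i < n) (n%:R * scal S) ^+ 2.
  by rewrite sumr_const card_ord -mulr_natl; ring.
apply: ler_sum => i _; rewrite -real_normK ?num_real // lerXn2r ?nnegrE //.
by rewrite mulr_ge0 // (PIC_scal_ge0 n5 pS).
Qed.

Lemma scal_sqr_le (R : realType) n (S : tensor4 R n) :
  scal S ^+ 2 <= n%:R * frobenius (Ric S) (Ric S).
Proof.
have := sqr_sum_le [set: 'I_n]%SET (fun i => Ric S i i).
rewrite cardsT card_ord !sum_setT => h; apply: le_trans h _.
apply: ler_wpM2l => //; apply: ler_sum => i _.
rewrite (bigD1 i) //= expr2 lerDl; apply: sumr_ge0 => j _; rewrite -expr2; exact: sqr_ge0.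
Qed.

(** * Evolution of the plane condition *)

Section PlaneSplit.
Variables (R : realType) (n : nat) (i j : 'I_n).
Hypothesis ij : i != j.

Definition off_plane : {set 'I_n} := [set p | (p != i) && (p != j)]%SET.

Lemma sum_plane (f : 'I_n -> R) : \sum_p f p = f i + f j + \sum_(p in off_plane) f p.
Proof.
rewrite (bigD1 i) //= (bigD1 j) /=; last by rewrite eq_sym.
by rewrite addrA; congr (_ + _); apply: eq_bigl => p; rewrite !inE.
Qed.

Lemma card_off_plane : (#|off_plane| + 2 = n)%N.
Proof.
have -> : off_plane = (~: [set i; j])%SET by apply/setP => p; rewrite !inE negb_or.
by rewrite -[RHS](card_ord n) -(cardsC [set i; j]%SET) cards2 ij addnC.
Qed.

Lemma sum_plane2 (f : 'I_n -> 'I_n -> R) : \sum_p \sum_q f p q =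
  f i i + f i j + f j i + f j j
  + \sum_(q in off_plane) (f i q + f j q + f q i + f q j)
  + \sum_(p in off_plane) \sum_(q in off_plane) f p q.
Proof.
under eq_bigr do rewrite sum_plane.
rewrite !big_split /= !sum_plane; ring.
Qed.

End PlaneSplit.

Section StarPlane.
Variables (R : realType) (n : nat) (S : tensor4 R n) (i j : 'I_n).
Hypotheses (cS : curvature_tensor S) (ij : i != j).
Local Notation J := (off_plane i j).

Lemma star_plane (M : 'M[R]_n) : M^T = M ->
  star S M i i = tcomp S i j i j * M j j + 2 * \sum_(q in J) tcomp S i j i q * M j q
    + \sum_(p in J) \sum_(q in J) tcomp S i p i q * M p q.
Proof.
move=> Ms; have Me a b : M a b = M b a by rewrite -{1}Ms mxE.
rewrite mxE (sum_plane2 ij) !(curv_iikl i _ _ cS) !(curv_ijkk i _ i cS) !mul0r !add0r mulr_sumr.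
congr (_ + _ + _); apply: eq_bigr => q _.
rewrite !(curv_iikl i _ _ cS) !(curv_ijkk i _ i cS) !mul0r (curv_sym i q i j cS) (Me q j); ring.
Qed.

End StarPlane.

Section PlaneEvolution.
Variables (R : realType) (n : nat) (S : tensor4 R n) (i j : 'I_n).
Hypotheses (cS : curvature_tensor S) (ij : i != j).
Local Notation J := (off_plane i j).

Lemma Q_plane : tcomp (Q S) i j i j =
  2 * tcomp S i j i j ^+ 2 + 2 * \sum_(q in J) tcomp S i j i q ^+ 2
  + 2 * \sum_(q in J) tcomp S i j j q ^+ 2
  + \sum_(p in J) \sum_(q in J) (tcomp S i j p q ^+ 2
      + 2 * (tcomp S i p i q * tcomp S j p j q - tcomp S i p j q * tcomp S j p i q)).
Proof.
have E1 : \sum_p \sum_q tcomp S i j p q * tcomp S i j p q =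
    2 * tcomp S i j i j ^+ 2 + 2 * \sum_(q in J) tcomp S i j i q ^+ 2
  + 2 * \sum_(q in J) tcomp S i j j q ^+ 2 + \sum_(p in J) \sum_(q in J) tcomp S i j p q ^+ 2.
  have Eq : \sum_(q in J) (tcomp S i j i q * tcomp S i j i q + tcomp S i j j q * tcomp S i j j q
      + tcomp S i j q i * tcomp S i j q i + tcomp S i j q j * tcomp S i j q j) =
      2 * \sum_(q in J) tcomp S i j i q ^+ 2 + 2 * \sum_(q in J) tcomp S i j j q ^+ 2.
    rewrite !mulr_sumr -big_split; apply: eq_bigr => q _ /=.
    by rewrite (curv_antir i j q i cS) (curv_antir i j q j cS); ring.
  rewrite (sum_plane2 ij) Eq !(curv_ijkk i j _ cS) (curv_antir i j j i cS) mulrNN -!expr2.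
  rewrite expr0n /= add0r addr0; ring.
have E2 : \sum_p \sum_q (tcomp S i p i q * tcomp S j p j q - tcomp S i p j q * tcomp S j p i q) =
    \sum_(p in J) \sum_(q in J) (tcomp S i p i q * tcomp S j p j q - tcomp S i p j q * tcomp S j p i q).
  have z := (fun k l => curv_iikl i k l cS, fun k l => curv_iikl j k l cS,
    fun k l => curv_ijkk k l i cS, fun k l => curv_ijkk k l j cS).
  rewrite (sum_plane2 ij) !z big1; first by rewrite !(mul0r, mulr0) subr0 !addr0 add0r.
  by move=> q _; rewrite !z; ring.
have -> : \sum_(p in J) \sum_(q in J) (tcomp S i j p q ^+ 2
      + 2 * (tcomp S i p i q * tcomp S j p j q - tcomp S i p j q * tcomp S j p i q)) =
    \sum_(p in J) \sum_(q in J) tcomp S i j p q ^+ 2 +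
    2 * \sum_(p in J) \sum_(q in J) (tcomp S i p i q * tcomp S j p j q - tcomp S i p j q * tcomp S j p i q).
  rewrite mulr_sumr -big_split; apply: eq_bigr => p _; by rewrite mulr_sumr -big_split.
by rewrite tcompQ E1 E2; ring.
Qed.

End PlaneEvolution.

(** On the boundary T >= 0 forces Sp >= c1 sg, while T itself is of order kap sg. Hence u is close
    to -Sp / 2 and the gain 2 u^2 / n is at least c1^2 sg^2 / (8 n). All error terms are O(n^5 kap
    sg^2), which explains the smallness condition with n^6. *)
Lemma plane_evolution_arith (R : realFieldType) (n s r1 r2 T Sp u sg f2 kap c1 D : R) :
  5 <= n -> 0 < sg -> 0 < kap -> kap <= 1 / 3 -> 0 < c1 -> c1 <= 1 ->
  500 * n ^+ 6 * kap <= c1 ^+ 2 ->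
  `|r1| <= n * sg -> `|r2| <= n * sg -> 0 <= f2 -> f2 <= n ^+ 3 * sg ^+ 2 ->
  Sp = r2 - r1 -> T = r1 + r2 - 2 * s -> u = (T - Sp) / 2 ->
  0 <= T -> T = kap * Sp - kap * c1 * sg ->
  2 * s * (r1 + r2) + 2 * kap * s * Sp - 4 * s ^+ 2 + 2 * u ^+ 2 / n - 4 * kap ^+ 2 * f2
    - 4 * n ^+ 2 * T ^+ 2 - n * (4 * n ^+ 2 * T ^+ 2 + 2 * n ^+ 2 * T * sg) <= D ->
  0 < D.
Proof.
move=> n5 sg0 k0 k1 c0 c1' kc r1b r2b f20 f2b SpE TE uE T0 TK DD.
move: kc f20 f2b uE DD r1b r2b; rewrite !ler_norml => kc f20 f2b uE DD /andP[r1l r1u] /andP[r2l r2u]; move: kc f20 f2b uE DD.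
have nsg : 0 < n * sg by rewrite mulr_gt0 //; lra.
have Spu : Sp <= 2 * (n * sg) by lra.
have kSp : kap * Sp <= 2 * n * kap * sg.
  have -> : 2 * n * kap * sg = kap * (2 * (n * sg)) by ring.
  by rewrite ler_pM2l.
have Tu : T <= 2 * n * kap * sg.
  have : 0 <= kap * c1 * sg by rewrite !mulr_ge0 // ltW.
  lra.
pose x := kap * sg; have x0 : 0 < x by rewrite mulr_gt0.
have {}Tu : T <= 2 * n * x by rewrite /x; lra.
have xs : x <= sg by rewrite /x ler_piMl //; lra.
have nx : n * x <= n * sg by rewrite ler_pM2l //; lra.
have kSp0 : kap * Sp = T + kap * c1 * sg by lra.
have cx : kap * c1 * sg <= x by rewrite mulrAC ler_piMr // ltW.
(* the five error terms, all of size [kap * sg ^+ 2] *)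
have b1 : - (8 * n ^+ 2 * (x * sg)) <= 2 * s * (r1 + r2) - 4 * s ^+ 2.
  have -> : 2 * s * (r1 + r2) - 4 * s ^+ 2 = T * (r1 + r2 - T) by rewrite TE; field.
  have h : - (4 * (n * sg)) <= r1 + r2 - T by lra.
  have : T * (4 * (n * sg)) <= 2 * n * x * (4 * (n * sg)) by rewrite ler_pM2r //; lra.
  have : 0 <= T * (r1 + r2 - T + 4 * (n * sg)) by rewrite mulr_ge0 //; lra.
  lra.
have b2 : - (12 * n ^+ 2 * (x * sg)) <= 2 * kap * s * Sp.
  have -> : 2 * kap * s * Sp = (T + kap * c1 * sg) * (r1 + r2 - T) by rewrite -kSp0 TE; field.
  have h : - (4 * (n * sg)) <= r1 + r2 - T by lra.
  have h0 : 0 <= T + kap * c1 * sg.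
    by rewrite addr_ge0 // !mulr_ge0 // ltW.
  have h1 : T + kap * c1 * sg <= 3 * n * x.
    have : x <= n * x by rewrite ler_peMl //; lra.
    lra.
  have : (T + kap * c1 * sg) * (4 * (n * sg)) <= 3 * n * x * (4 * (n * sg)) by rewrite ler_pM2r //; lra.
  have : 0 <= (T + kap * c1 * sg) * (r1 + r2 - T + 4 * (n * sg)) by rewrite mulr_ge0 //; lra.
  lra.
have T2 : T ^+ 2 <= 4 * n ^+ 2 * (x * sg).
  have : T * T <= (2 * n * x) * (2 * (n * sg)) by apply: ler_pM => //; lra.
  rewrite expr2; lra.
have Ts : T * sg <= 2 * n * (x * sg).
  have : T * sg <= 2 * n * x * sg by rewrite ler_pM2r.
  lra.
have b4 : 4 * n ^+ 2 * T ^+ 2 <= 16 * n ^+ 4 * (x * sg).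
  have : n ^+ 2 * T ^+ 2 <= n ^+ 2 * (4 * n ^+ 2 * (x * sg)) by rewrite ler_wpM2l // sqr_ge0.
  lra.
have b5 : n * (4 * n ^+ 2 * T ^+ 2 + 2 * n ^+ 2 * T * sg) <= (16 * n ^+ 5 + 4 * n ^+ 4) * (x * sg).
  have n30 : 0 <= n ^+ 3 by rewrite exprn_ge0 //; lra.
  have : n ^+ 3 * T ^+ 2 <= n ^+ 3 * (4 * n ^+ 2 * (x * sg)) by rewrite ler_wpM2l.
  have : n ^+ 3 * (T * sg) <= n ^+ 3 * (2 * n * (x * sg)) by rewrite ler_wpM2l.
  lra.
have xs0 : 0 < x * sg by rewrite mulr_gt0.
have n0 : 0 < n by lra.
have Spl : c1 * sg <= Sp.
  have : 0 <= kap * (Sp - c1 * sg) by lra.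
  by rewrite pmulr_rge0 // subr_ge0.
clear r1l r1u r2l r2u Spu kSp; move=> kc f20 f2b uE DD.
have b3 : 4 * kap ^+ 2 * f2 <= 4 * n ^+ 3 * (x * sg).
  have : kap ^+ 2 * f2 <= kap ^+ 2 * (n ^+ 3 * sg ^+ 2) by rewrite ler_wpM2l // sqr_ge0.
  have -> : kap ^+ 2 * (n ^+ 3 * sg ^+ 2) = n ^+ 3 * (x * x) by rewrite /x; ring.
  have : n ^+ 3 * (x * x) <= n ^+ 3 * (x * sg) by rewrite !ler_pM2l ?exprn_gt0 //; lra.
  lra.
have u2 : (c1 * sg) ^+ 2 / 16 <= u ^+ 2.
  have h : c1 * sg / 4 <= - u.
    have : kap * Sp <= Sp / 3.
      have Sp0 : 0 <= Sp by apply: le_trans Spl; rewrite mulr_ge0 // ltW.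
      by have -> : Sp / 3 = 1 / 3 * Sp; [field|rewrite ler_wpM2r].
    have : 0 < kap * c1 * sg by rewrite !mulr_gt0.
    lra.
  have -> : u ^+ 2 = (- u) ^+ 2 by rewrite sqrrN.
  have -> : (c1 * sg) ^+ 2 / 16 = (c1 * sg / 4) ^+ 2 by field.
  rewrite lerXn2r // nnegrE; first by rewrite divr_ge0 // mulr_ge0 // ltW.
  by apply: le_trans h; rewrite divr_ge0 // mulr_ge0 // ltW.
have gain : 125 / 2 * n ^+ 5 * (x * sg) <= 2 * u ^+ 2 / n.
  rewrite ler_pdivlMr //.
  have : 500 * n ^+ 6 * kap * sg ^+ 2 <= c1 ^+ 2 * sg ^+ 2 by rewrite ler_wpM2r // sqr_ge0.
  rewrite /x; lra.
have := mulr_gt0 (exprn_gt0 5 n0) xs0.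
have step k : 5 * (n ^+ k * (x * sg)) <= n ^+ k.+1 * (x * sg).
  by rewrite exprS -mulrA ler_wpM2r // mulr_ge0 ?exprn_ge0 // ltW.
have := step 2; have := step 3; have := step 4; lra.
Qed.

(** With V = a - U and a small, -4 U V is nearly 4 U^2. Completing squares spends U^2 on the cross
    term 4 k U r and U^2 on 4 a U, and 2 U^2 remains. *)
Lemma plane_diag_entry_ge (R : realFieldType) (k U r a W ab rb : R) :
  0 <= k -> k <= 1 -> `|a| <= ab -> `|r| <= rb ->
  2 * U ^+ 2 - 4 * k ^+ 2 * r ^+ 2 - 4 * ab ^+ 2 - 2 * ab * rb <=
  2 * (1 + k) * (U * r) + 2 * (1 - k) * ((a - U) * r) - 4 * (U * (a - U)) + 4 * (W * W).
Proof.
move=> k0 k1 ha hr; have a0 := normr_ge0 a; have r0 := normr_ge0 r.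
have h1 : `|a| * `|r| <= ab * rb by rewrite ler_pM.
have h2 : a ^+ 2 <= ab ^+ 2 by rewrite -real_normK ?num_real // lerXn2r ?nnegrE // (le_trans a0).
have h3 : (1 - k) * (- (a * r)) <= ab * rb.
  apply: le_trans h1; apply: (@le_trans _ _ ((1 - k) * (`|a| * `|r|))).
    by rewrite ler_wpM2l ?subr_ge0 // -normrM -normrN ler_norm.
  by rewrite ler_piMl ?mulr_ge0 //; lra.
have := sqr_ge0 (U + 2 * k * r); have := sqr_ge0 (U - 2 * a); have := sqr_ge0 W.
rewrite !expr2 in h2 *; lra.
Qed.

(** Off the diagonal V = -U exactly; the unsigned product W W' is (W + W')^2 - (W - W')^2 over 4,
    and only the difference is bounded by T. *)
Lemma plane_offdiag_entry_ge (R : realFieldType) (k U r W W' T : R) : `|W - W'| <= T ->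
  2 * U ^+ 2 - 4 * k ^+ 2 * r ^+ 2 - 4 * T ^+ 2 <=
  2 * (1 + k) * (U * r) + 2 * (1 - k) * (- U * r) - 2 * (W - W') ^+ 2
    - 4 * (U * - U) + 4 * (W * W').
Proof.
move=> hT; have h2 : (W - W') ^+ 2 <= T ^+ 2.
  by rewrite -real_normK ?num_real // lerXn2r ?nnegrE // (le_trans (normr_ge0 _) hT).
have := sqr_ge0 (U + 2 * k * r); have := sqr_ge0 (W + W'); have := sqr_ge0 U.
have := sqr_ge0 T; rewrite !expr2 in h2 *; lra.
Qed.

Section PlaneDerivative.
Variables (R : realType) (n : nat) (S : tensor4 R n) (i j : 'I_n) (kap c1 : R).
Hypotheses (n5 : (5 <= n)%N) (pS : PIC S) (ij : i != j).
Hypotheses (kap_gt0 : 0 < kap) (kap_le : kap <= 1 / 3) (c1_gt0 : 0 < c1) (c1_le : c1 <= 1)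
  (kap_small : 500 * n%:R ^+ 6 * kap <= c1 ^+ 2).
Local Notation J := (off_plane i j).
Local Notation r := (Ric S).
Local Notation Z p q := (tcomp S i j p q).
Local Notation U p q := (tcomp S i p i q).
Local Notation V p q := (tcomp S j p j q).
Local Notation W p q := (tcomp S i p j q).
Local Notation a p := (sec S i p + sec S j p).

Let cS : curvature_tensor S. Proof. by case: pS. Qed.

Let J2 : (2 < #|J|)%N.
Proof. by rewrite -(ltn_add2r 2) card_off_plane. Qed.

Lemma plane_trace : \sum_(p in J) a p = r i i + r j j - 2 * sec S i j.
Proof.
rewrite !Ric_diagE !(sum_plane ij) big_split /= !(sec_diag pS) (sec_sym pS j i); ring.
Qed.

Lemma plane_pair_ge0 p q : p \in J -> q \in J -> p != q -> 0 <= a p + a q.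
Proof.
rewrite !inE => /andP[pi pj] /andP[qi qj] pq.
have := @PIC_sec_ge0 _ _ _ pS i j p q; rewrite /= !inE !negb_or ij pq !(eq_sym i) pi qi !(eq_sym j) pj qj.
move=> /(_ isT); lra.
Qed.

Lemma plane_trace_ge0 : 0 <= \sum_(p in J) a p.
Proof. by apply: sum_pairwise_ge0; [exact: ltnW|exact: plane_pair_ge0]. Qed.

Lemma plane_mixed_le p q : p \in J -> q \in J -> 2 * `|Z p q| <= a p + a q \/ p = q.
Proof.
rewrite !inE => /andP[pi pj] /andP[qi qj]; case: (eqVneq p q) => [->|pq]; [by right|left].
have := @PIC_mixed_le _ _ _ pS i j p q; rewrite /= !inE !negb_or ij pq !(eq_sym i) pi qi !(eq_sym j) pj qj.
move=> /(_ isT); lra.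
Qed.

Lemma plane_le_trace p : p \in J -> a p <= \sum_(q in J) a q.
Proof.
move=> pJ; rewrite (sum_in_rem _ pJ) lerDl; apply: sum_pairwise_ge0.
  by have := cardsD1 p J; rewrite pJ add1n; move: J2 => /[swap] ->; rewrite ltnS.
by move=> k l; rewrite !in_setD1 => /andP[_ kJ] /andP[_ lJ]; exact: plane_pair_ge0.
Qed.

Lemma plane_abs_le_trace p : p \in J -> `|a p| <= n%:R * \sum_(q in J) a q.
Proof.
move=> pJ; set T := \sum_(q in J) a q; have T0 : 0 <= T by exact: plane_trace_ge0.
have aT q : q \in J -> a q <= T by exact: plane_le_trace.
rewrite ler_norml; apply/andP; split; last first.
  apply: le_trans (aT p pJ) _; by rewrite ler_peMl // (ler_nat _ 1) (leq_trans _ n5).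
have : \sum_(q in J :\ p) a q <= \sum_(q in J :\ p) T.
  by apply: ler_sum => q; rewrite in_setD1 => /andP[_ qJ]; exact: aT.
have TE : T = a p + \sum_(q in J :\ p) a q by exact: sum_in_rem.
rewrite sumr_const -[T *+ _]mulr_natl.
have cn : #|J :\ p|%:R + 3 = n%:R :> R.
  have := congr1 (fun k => k%:R : R) (card_off_plane ij); rewrite (cardsD1 p J) pJ add1n -addn1 !natrD; lra.
have <- := cn; nra.
Qed.

Hypothesis diagH : forall p q, p \in J -> q \in J -> p != q -> U p q + V p q = 0.
Hypotheses (first_i : forall q, q \in J -> (1 + kap) * r i q = 2 * tcomp S i j q j)
  (first_j : forall q, q \in J -> (1 - kap) * r j q = 2 * tcomp S j i q i).
Hypothesis boundary : (1 + kap) * r i i + (1 - kap) * r j j - 2 * sec S i j + kap * c1 * scal S = 0.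
Hypothesis scal_gt0 : 0 < scal S.

(** Entries with one index in the plane are handled by the first variation ([hj], [hi]). In the
    diagonalising basis the rest splits into entries, each bounded below by 2 U_pq^2 up to errors
    controlled by the trace T. *)
Lemma plane_derivative_gt0 :
  0 < 2 * (1 + kap) * star S r i i + 2 * (1 - kap) * star S r j j - 2 * tcomp (Q S) i j i j
    + 2 * (kap * c1) * frobenius r r.
Proof.
have k0 := kap_gt0; have k1 := kap_le; have c0 := c1_gt0; have sg0 := scal_gt0.
have [ka kb kc kd] : [/\ 0 <= 1 - kap, 0 <= 1 + kap, 0 <= 1 + 3 * kap & 0 <= 1 - 3 * kap] by split; lra.
have rs := Ric_sym cS; have re p q := Ric_symE p q cS.
set T := \sum_(p in J) a p; set s := sec S i j; set sg := scal S.
set f2 := frobenius r r.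
have T0 : 0 <= T by exact: plane_trace_ge0.
have TE : T = r i i + r j j - 2 * s by exact: plane_trace.
pose u := \sum_(p in J) U p p.
have uE : u = (T - (r j j - r i i)) / 2.
  have : r i i = s + u.
    by rewrite Ric_diagE (sum_plane ij) sec_diag // add0r.
  rewrite TE; lra.
have f20 : 0 <= f2 by apply: sumr_ge0 => p _; apply: sumr_ge0 => q _; rewrite -expr2 sqr_ge0.
have n5R : 5 <= n%:R :> R by rewrite ler_nat.
apply: (@plane_evolution_arith _ n%:R s (r i i) (r j j) T (r j j - r i i) u sg f2 kap c1) => //.
- exact: PIC_Ric_bound.
- exact: PIC_Ric_bound.
- exact: PIC_frobenius_bound.
- by move: boundary; rewrite -/s -/sg TE; lra.
have ji : j != i by rewrite eq_sym.
rewrite (star_plane cS ij rs) (star_plane cS ji rs) (Q_plane cS ij).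
have -> : off_plane j i = J by apply/setP => p; rewrite !inE andbC.
rewrite -/(sec S i j) -/s -/(sec S j i) (sec_sym pS j i) -/s.
set Aj := \sum_(q in J) tcomp S i j i q * r j q.
set Ai := \sum_(q in J) tcomp S j i j q * r i q.
set Bj := \sum_(q in J) tcomp S i j i q ^+ 2.
set Bi := \sum_(q in J) tcomp S i j j q ^+ 2.
(* The first variation gives S_ijiq = (1 - kap) r_jq / 2, so the difference is (1 - kap)(1 + 3 kap)
   / 4 times the sum of the r_jq^2. *)
have hj : Bj <= (1 + kap) * Aj.
  rewrite /Bj /Aj mulr_sumr; apply: ler_sum => q qJ.
  have := first_j qJ; rewrite (curv_antir j i q i cS) (curv_antil j i i q cS) => e.
  have -> : tcomp S i j i q = (1 - kap) * r j q / 2 by lra.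
  have h : 0 <= (1 - kap) * (1 + 3 * kap) * r j q ^+ 2.
    by rewrite mulr_ge0 ?sqr_ge0 // mulr_ge0.
  lra.
(* Here the factor is (1 + kap)(1 - 3 kap) / 4, which is the reason for kap <= 1/3. *)
have hi : Bi <= (1 - kap) * Ai.
  rewrite /Bi /Ai mulr_sumr; apply: ler_sum => q qJ.
  have := first_i qJ; rewrite (curv_antir i j q j cS) => e.
  have e2 : tcomp S i j j q = - ((1 + kap) * r i q / 2) by lra.
  rewrite (curv_antil j i j q cS) e2.
  have h : 0 <= (1 + kap) * (1 - 3 * kap) * r i q ^+ 2.
    by rewrite mulr_ge0 ?sqr_ge0 // mulr_ge0.
  lra.
set SU := \sum_(p in J) \sum_(q in J) U p q * r p q.
set SV := \sum_(p in J) \sum_(q in J) V p q * r p q.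
set SQ := \sum_(p in J) \sum_(q in J) _.
suff K : 2 * u ^+ 2 / n%:R - 4 * kap ^+ 2 * f2 - 4 * n%:R ^+ 2 * T ^+ 2
    - n%:R * (4 * n%:R ^+ 2 * T ^+ 2 + 2 * n%:R ^+ 2 * T * sg) <=
    2 * (1 + kap) * SU + 2 * (1 - kap) * SV - 2 * SQ.
  have : 0 <= 2 * (kap * c1) * f2 by rewrite !mulr_ge0 // ltW.
  lra.
have -> : 2 * (1 + kap) * SU + 2 * (1 - kap) * SV - 2 * SQ = \sum_(p in J) \sum_(q in J)
   (2 * (1 + kap) * (U p q * r p q) + 2 * (1 - kap) * (V p q * r p q) - 2 * Z p q ^+ 2
     - 4 * (U p q * V p q) + 4 * (W p q * W q p)).
  rewrite /SU /SV /SQ !mulr_sumr -big_split -sumrB; apply: eq_bigr => p _ /=.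
  rewrite !mulr_sumr -big_split -sumrB; apply: eq_bigr => q _ /=.
  by rewrite (curv_sym j p i q cS); ring.
have JR : #|J|%:R <= n%:R :> R.
  by rewrite ler_nat -[X in (_ <= X)%N](card_off_plane ij) leq_addr.
have J0 : 0 < #|J|%:R :> R by rewrite ltr0n (leq_trans _ J2).
pose d (p q : 'I_n) : R := (p == q)%:R.
apply: (@le_trans _ _ (\sum_(p in J) \sum_(q in J)
   (2 * U p q ^+ 2 - 4 * kap ^+ 2 * r p q ^+ 2 - 4 * T ^+ 2
    - (4 * n%:R ^+ 2 * T ^+ 2 + 2 * n%:R ^+ 2 * T * sg) * (q == p)%:R))).
  have -> : \sum_(p in J) \sum_(q in J) (2 * U p q ^+ 2 - 4 * kap ^+ 2 * r p q ^+ 2 - 4 * T ^+ 2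
      - (4 * n%:R ^+ 2 * T ^+ 2 + 2 * n%:R ^+ 2 * T * sg) * (q == p)%:R) =
    2 * (\sum_(p in J) \sum_(q in J) U p q ^+ 2)
      - 4 * kap ^+ 2 * (\sum_(p in J) \sum_(q in J) r p q ^+ 2) - 4 * #|J|%:R ^+ 2 * T ^+ 2
      - #|J|%:R * (4 * n%:R ^+ 2 * T ^+ 2 + 2 * n%:R ^+ 2 * T * sg).
    have sc (c : R) : \sum_(q in J) c = #|J|%:R * c by rewrite sumr_const mulr_natl.
    transitivity (\sum_(p in J) (2 * (\sum_(q in J) U p q ^+ 2)
      - 4 * kap ^+ 2 * (\sum_(q in J) r p q ^+ 2) - #|J|%:R * (4 * T ^+ 2)
      - (4 * n%:R ^+ 2 * T ^+ 2 + 2 * n%:R ^+ 2 * T * sg))).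
      apply: eq_bigr => p pJ; rewrite !sumrB sc -!mulr_sumr; congr (_ - _).
      by rewrite (sum_in_rem _ pJ) eqxx big1 ?addr0 ?mulr1 // => q; rewrite in_setD1 => /andP[/negPf ->].
    rewrite !sumrB !sc -!mulr_sumr; ring.
  have hU : u ^+ 2 / n%:R <= \sum_(p in J) \sum_(q in J) U p q ^+ 2.
    apply: (@le_trans _ _ (\sum_(p in J) U p p ^+ 2)).
      rewrite ler_pdivrMr; last by apply: lt_le_trans JR.
      apply: le_trans (sqr_sum_le J (fun p => U p p)) _; rewrite mulrC ler_wpM2l //.
      by apply: sumr_ge0 => p _; exact: sqr_ge0.
    apply: ler_sum => p pJ; rewrite (sum_in_rem _ pJ) lerDl.
    by apply: sumr_ge0 => q _; exact: sqr_ge0.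
  have hr : \sum_(p in J) \sum_(q in J) r p q ^+ 2 <= f2.
    rewrite /f2 /frobenius (sum_plane ij); apply: (@le_trans _ _ (\sum_(p in J) \sum_q r p q * r p q)).
      apply: ler_sum => p _; rewrite (sum_plane ij) -!expr2 lerDr addr_ge0 ?sqr_ge0 //.
    by rewrite lerDr addr_ge0 //; apply: sumr_ge0 => q _; rewrite -expr2 sqr_ge0.
  have hk : kap ^+ 2 * (\sum_(p in J) \sum_(q in J) r p q ^+ 2) <= kap ^+ 2 * f2.
    by rewrite ler_wpM2l // sqr_ge0.
  have hJ : #|J|%:R ^+ 2 * T ^+ 2 <= n%:R ^+ 2 * T ^+ 2.
    by rewrite ler_wpM2r ?sqr_ge0 // lerXn2r // nnegrE ltW // (lt_le_trans J0).
  have hn : #|J|%:R * (4 * n%:R ^+ 2 * T ^+ 2 + 2 * n%:R ^+ 2 * T * sg) <=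
      n%:R * (4 * n%:R ^+ 2 * T ^+ 2 + 2 * n%:R ^+ 2 * T * sg).
    by rewrite ler_wpM2r // addr_ge0 ?mulr_ge0 ?sqr_ge0 // ltW.
  lra.
apply: ler_sum => p pJ; apply: ler_sum => q qJ.
have [->|pq] := eqVneq p q.
  rewrite /= mulr1 (curv_ijkk i j q cS) expr0n /= mulr0 subr0.
  have := @plane_diag_entry_ge _ kap (U q q) (r q q) (a q) (W q q) (n%:R * T) (n%:R * sg)
    (ltW kap_gt0) _ (plane_abs_le_trace qJ) (PIC_Ric_bound n5 pS q).
  have -> : a q - U q q = V q q by rewrite /sec addrAC subrr add0r.
  have -> : kap <= 1 by lra.
  by move=> /(_ isT); have := sqr_ge0 T; have := sqr_ge0 (n%:R : R) => h1 h2; nra.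
rewrite /= mulr0 subr0.
have VE : V p q = - U p q by have := diagH pJ qJ pq; lra.
(* The Bianchi identity identifies the antisymmetric part of W with a mixed component, which PIC
   bounds through [plane_mixed_le]. *)
have ZE : Z p q = W p q - W q p.
  have := curv_bianchi i j p q cS; rewrite (curv_sym j p i q cS) (curv_antil p i j q cS); lra.
rewrite VE ZE; apply: plane_offdiag_entry_ge; rewrite -ZE.
have [h|e] := plane_mixed_le pJ qJ; last by rewrite e eqxx in pq.
have := plane_le_trace pJ; have := plane_le_trace qJ; rewrite -/T; lra.
Qed.

End PlaneDerivative.

(** * Evolution of the two lowest Ricci eigenvalues *)

Lemma sqr_sum3_le (R : realFieldType) (x y z : R) : (x + y + z) ^+ 2 <= 3 * (x ^+ 2 + y ^+ 2 + z ^+ 2).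
Proof.
have := sqr_ge0 (x - y); have := sqr_ge0 (x - z); have := sqr_ge0 (y - z); rewrite !expr2; lra.
Qed.

Section SmallParameters.
Variables (R : realFieldType) (n b gam th : R).
Hypotheses (n5 : 5 <= n) (b_gt0 : 0 < b) (b_small : 1000 * n ^+ 2 * b <= 1).
Hypotheses (gamE : gam = (1 / 2 + 1 / (4 * n)) * b ^+ 2) (thE : th = (1 - 1 / (16 * n)) * b).

Let n0 : 0 < n. Proof. exact: lt_le_trans n5. Qed.

Lemma inv_small : 0 < 1 / n /\ 1 / n <= 1 / 5.
Proof.
split; first by rewrite divr_gt0.
by rewrite ler_pdivrMr // mulrAC ler_pdivlMr //; have := n5; lra.
Qed.

Lemma small_nb : 1000 * (n * b) <= 1 / n.
Proof.
rewrite (ler_pdivlMr _ _ n0).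
have -> : 1000 * (n * b) * n = 1000 * n ^+ 2 * b by ring.
exact: b_small.
Qed.

Lemma small_b : 1000 * b <= 1 / n.
Proof.
have : 1 * b <= n * b by rewrite ler_pM2r //; have := n5; lra.
have := small_nb; lra.
Qed.

Lemma small_b1 : 1000 * b <= 1.
Proof. by have := small_b; have [_] := inv_small; lra. Qed.

Lemma th_split : th = b - (1 / n) * b / 16.
Proof. by rewrite thE; field; rewrite gt_eqF. Qed.

Lemma th_bounds : 0 <= th /\ th <= b.
Proof.
have [i0 i5] := inv_small; have b0 := b_gt0.
have ib : 0 <= (1 / n) * b by rewrite mulr_ge0 // ltW.
have ib5 : 0 <= (1 / 5 - 1 / n) * b by rewrite mulr_ge0 ?subr_ge0 // ltW.
rewrite th_split; split; lra.
Qed.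

Lemma gam_bounds : 0 <= gam /\ gam <= b ^+ 2.
Proof.
have [i0 i5] := inv_small.
have e : 1 / (4 * n) = (1 / n) / 4 by field; rewrite gt_eqF.
rewrite gamE e; split; first by rewrite mulr_ge0 ?sqr_ge0 //; lra.
by rewrite ler_piMl ?sqr_ge0 //; lra.
Qed.

Lemma small_gam : 1000 * gam <= b.
Proof.
have b0 := b_gt0; have : b * b <= b * (1 / 1000) by rewrite ler_pM2l //; have := small_b1; lra.
have [_] := gam_bounds; rewrite expr2; lra.
Qed.

Lemma small_ngam : 1000 * (n * gam) <= (1 / n) * b.
Proof.
have := ler_wpM2r (ltW b_gt0) small_nb.
have : n * gam <= n * b ^+ 2 by rewrite ler_pM2l //; case: gam_bounds.
rewrite expr2; lra.
Qed.

Variables (sg f2 : R).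
Hypotheses (sg_ge0 : 0 <= sg) (sgf2 : sg ^+ 2 <= n * f2).

Lemma f2_ge0 : 0 <= f2.
Proof. by rewrite -(pmulr_rge0 _ n0); apply: le_trans sgf2; exact: sqr_ge0. Qed.

Lemma bsg_sqr_le : 1000 * (b * sg) ^+ 2 <= (1 / n) * (b * f2).
Proof.
have b0 := b_gt0; have f20 := f2_ge0.
have h : b ^+ 2 * sg ^+ 2 <= b ^+ 2 * (n * f2) by rewrite ler_wpM2l // sqr_ge0.
have bf : 0 <= b * f2 by rewrite mulr_ge0 // ltW.
have := ler_wpM2r bf small_nb.
move: h; rewrite exprMn !expr2; lra.
Qed.

Lemma b_sg_sqr_le : b * (1 / n * sg) ^+ 2 <= (1 / n) * (b * f2).
Proof.
have h : b * sg ^+ 2 <= b * (n * f2) by rewrite ler_pM2l.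
have i2 : 0 <= (1 / n) * (1 / n) by rewrite mulr_ge0 // ltW // (inv_small.1).
have := ler_wpM2l i2 h.
have -> : 1 / n * (1 / n) * (b * (n * f2)) = 1 / n * (b * f2) by field; rewrite gt_eqF.
by rewrite exprMn !expr2; lra.
Qed.

End SmallParameters.

(** P stands for minus the Ricci trace of the shifted tensor on the plane. Inserting 2 z into 2 G -
    2 z P cancels P^2 exactly and leaves T'^2 + k N P - 2 k v P, where P is about N. *)
Lemma pinched_trace_gain (R : realFieldType) (k N u v P z G T' gS : R) :
  1 / 2 <= k -> k <= 1 -> 0 <= v -> v <= u -> 0 <= N -> k * N <= P -> P <= N + u / 20 + N / 16 ->
  2 * z = P - k * N + 2 * k * v -> k * gS = G - z * P -> (P ^+ 2 + T' ^+ 2) / 2 <= G ->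
  T' ^+ 2 + N ^+ 2 / 2 - 3 * (u * N) - u ^+ 2 <= 2 * gS.
Proof.
move=> k1 k2 v0 vu N0 P1 P2 zE gE GE.
have k0 : 0 < k by lra.
have P0 : 0 <= P by apply: le_trans P1; rewrite mulr_ge0 // ltW.
rewrite -(ler_pM2l k0).
have h1 : k * (k * N ^+ 2) <= k * (N * P).
  by rewrite ler_pM2l // expr2 mulrA (mulrC (k * N)) ler_wpM2l.
have h2 : k * (v * P) <= k * (u * (N + u / 20 + N / 16)).
  by rewrite ler_pM2l // ler_pM.
have h3 : k * T' ^+ 2 <= T' ^+ 2 by rewrite ler_piMl ?sqr_ge0.
have h4 : k / 2 * N ^+ 2 <= k * (k * N ^+ 2).
  by rewrite mulrA ler_wpM2r ?sqr_ge0 // ler_pM2l //; lra.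
have h5 : 0 <= k * (u * N) by apply: mulr_ge0; [exact: ltW|apply: mulr_ge0 => //; exact: le_trans vu].
have h6 : 0 <= k * u ^+ 2 by rewrite mulr_ge0 ?sqr_ge0 // ltW.
have e1 : 2 * (z * P) = P * P - k * (N * P) + 2 * (k * (v * P)).
  by rewrite mulrA zE; ring.
rewrite (_ : k * (2 * gS) = 2 * (k * gS)); last by ring.
rewrite gE !expr2 in h1 h2 h3 h4 h5 h6 GE *.
clear zE gE k1 k2 v0 vu N0 P1 P2 k0 P0; lra.
Qed.

(** Every product is a separate variable, so that the balance is linear; y stands for b |r|^2 / n,
    the gain due to th < b. *)
Lemma low_eigenvalue_sum (R : realFieldType) (y ds ud N2 t2 u2 uN gS bsF gs2 dF gF w : R) :
  0 <= ds -> 0 < N2 -> 0 <= y -> 0 <= t2 ->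
  1000 * u2 <= y -> 1000 * uN <= ds -> 1000 * ud <= ds ->
  t2 + N2 / 2 - 3 * uN - u2 <= 2 * gS -> - uN <= bsF -> gs2 <= u2 -> dF <= 2 * ud ->
  - uN <= gF -> 
  w <= y / 500 + N2 / 100 + y / 32 + (t2 + 9 * u2 + N2 / 16) / 100 ->
  0 < 2 * gS + 2 * bsF - 4 * w + y / 4 + 8 * ds - 8 * gs2 - 4 * dF + 4 * gF.
Proof. lra. Qed.

(** Bounds the negative term b w2, with w2 the trace of r^2 on the plane. Splitting bb into T / kap
    and e s / 16, the condition b <= e^2 kap^2 / 1000 makes b (T / kap)^2 at most T^2 / 1000. *)
Lemma low_eigenvalue_cross (R : realFieldType) (b u N F bb T' T kap e esg nd w2 y : R) :
  0 < b -> 1000 * b <= 1 -> 0 <= N -> 0 < kap -> 1000 * b <= e ^+ 2 * kap ^+ 2 -> 0 <= e -> e <= 1 / 5 ->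
  F ^+ 2 <= 8 * u ^+ 2 + 2 * N ^+ 2 -> 1000 * u ^+ 2 <= y -> b * esg ^+ 2 <= y ->
  kap * bb = T + kap * (esg / 16) -> 0 <= T -> T <= T' + 3 * u + 4 * nd -> 0 <= T' ->
  0 <= u -> 0 <= nd -> 64 * nd <= N -> 
  w2 <= F ^+ 2 / 2 + bb ^+ 2 ->
  b * w2 <= y / 500 + N ^+ 2 / 100 + y / 32 + (T' ^+ 2 + 9 * u ^+ 2 + N ^+ 2 / 16) / 100.
Proof.
move=> b0 b1 N0 k0 bk e0 e5 F2 u2 sE bbE T0 TE T'0 u0 nd0 ndN wE.
have T2 : T ^+ 2 <= 3 * (T' ^+ 2 + (3 * u) ^+ 2 + (4 * nd) ^+ 2).
  apply: le_trans (sqr_sum3_le _ _ _); rewrite lerXn2r ?nnegrE //.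
  by rewrite !addr_ge0 // mulr_ge0.
have nd2 : (64 * nd) ^+ 2 <= N ^+ 2 by rewrite lerXn2r ?nnegrE // mulr_ge0.
have h1 : b * w2 <= b * F ^+ 2 / 2 + b * bb ^+ 2.
  by have := ler_wpM2l (ltW b0) wE; clear; lra.
have h2 : b * bb ^+ 2 <= T ^+ 2 / 500 + y / 100.
  have e1 : bb = T / kap + esg / 16.
    by apply: (mulfI (lt0r_neq0 k0)); rewrite bbE; field; rewrite gt_eqF.
  have h : bb ^+ 2 <= 2 * (T / kap) ^+ 2 + 2 * (esg / 16) ^+ 2.
    by rewrite e1; have := sqr_ge0 (T / kap - esg / 16); clear; rewrite !expr2; lra.
  have hb : b * (T / kap) ^+ 2 <= T ^+ 2 / 1000.
    rewrite expr_div_n mulrA (ler_pdivrMr _ _ (exprn_gt0 2 k0)).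
    have he : e ^+ 2 * kap ^+ 2 <= kap ^+ 2.
      by rewrite ler_piMl ?sqr_ge0 // expr_le1 //; move: e5; clear; lra.
    have := ler_wpM2r (sqr_ge0 T) (le_trans bk he); clear; lra.
  have y0 : 0 <= y by have := sqr_ge0 u; move: u2; clear; lra.
  have := ler_wpM2l (ltW b0) h.
  clear - hb sE y0; rewrite mulrDr; rewrite !expr2 in hb sE *; lra.
have h3 : b * F ^+ 2 <= (8 * u ^+ 2 + 2 * N ^+ 2) / 1000.
  have := ler_wpM2r (sqr_ge0 F) b1; move: F2; clear; lra.
have N2 := sqr_ge0 N; have uu := sqr_ge0 u; have t2 := sqr_ge0 T'; have y0 : 0 <= y by have := sqr_ge0 u; move: u2; clear; lra.
clear - T2 nd2 h1 h2 h3 N2 t2 y0 u2 uu.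
rewrite !expr2 in T2 nd2 h1 h2 h3 N2 t2 u2 uu *; lra.
Qed.

Lemma low_eigenvalue_arith (R : realFieldType)
  (n b del gam sg F N th kap f2 w2 gS G T' T bb k z D : R) :
  5 <= n -> 0 < b -> 0 < del -> 0 < N -> 0 < kap -> 0 <= sg ->
  1000 * n ^+ 2 * b <= 1 -> 1000 * (b * N) <= del -> 1000 * n ^+ 2 * b <= kap ^+ 2 ->
  64 * (n * del) <= N ->
  gam = (1 / 2 + 1 / (4 * n)) * b ^+ 2 -> th = (1 - 1 / (16 * n)) * b ->
  k = 1 - (n - 2) * b -> z = b * sg + 2 * (n - 1) * (del - gam * sg) ->
  F = 2 * th * sg - N ->
  k * gS = G + z * (k * F - 2 * z) ->
  (k * F - 2 * z <= 0 -> ((k * F - 2 * z) ^+ 2 + T' ^+ 2) / 2 <= G) ->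
  0 <= T' -> 0 <= T -> T = T' + b * ((n - 4) * F + 2 * sg) + 4 * (n - 2) * (del - gam * sg) ->
  kap * bb = T + kap * (1 / (16 * n)) * sg ->
  w2 <= F ^+ 2 / 2 + bb ^+ 2 -> sg ^+ 2 <= n * f2 ->
  D = 2 * gS + 2 * (b * (sg * F - 2 * w2 + 2 * f2) + 2 * (del - gam * sg) * (2 * sg - F)) - 4 * th * f2 ->
  0 < D.
Proof.
move=> n5 b0 d0 N0 k0 s0 h1 h2 h3 h4 gE thE.
have n0 : 0 < n by exact: lt_le_trans n5.
have nn : n != 0 by rewrite gt_eqF.
have [i0 i5] := inv_small n5.
have nb := small_nb n5 h1; have b1 := small_b1 n5 b0 h1.
have ngam := small_ngam n5 b0 h1 gE; have [g0 gb] := gam_bounds n5 gE.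
have gb1 := small_gam n5 b0 h1 gE.
have thE' := th_split n5 thE; have [th0 thb] := th_bounds n5 b0 thE.
have u0 : 0 <= b * sg by rewrite mulr_ge0 // ltW.
have [e eE] : exists e, e = 1 / n by exists (1 / n).
rewrite -eE in i0 i5 nb ngam thE'.
move=> kE zE FE gSE GE T'0 T0 TE bbE w2E f2E ->.
have f20 := f2_ge0 n5 f2E; have bu := bsg_sqr_le n5 b0 h1 f2E; have be := b_sg_sqr_le n5 b0 f2E.
rewrite -eE in bu be.
have y0 : 0 <= e * (b * f2) by apply: mulr_ge0; [exact: ltW|apply: mulr_ge0 => //; exact: ltW].
set u := b * sg in u0 bu zE.
have eu0 : 0 <= e * u by rewrite mulr_ge0 // ltW.
have eu5 : e * u <= u / 5 by move: (ler_wpM2r u0 i5); clear; lra.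
have gs0 : 0 <= gam * sg by rewrite mulr_ge0.
have ngs : 1000 * (n * (gam * sg)) <= e * u.
  by move: (ler_wpM2r s0 ngam); rewrite /u; clear; lra.
have gs1 : gam * sg <= u by move: (ler_wpM2r s0 gb1) gs0; rewrite -/u; clear; lra.
pose v := th * sg.
have v0 : 0 <= v by rewrite mulr_ge0.
have vu : v <= u by rewrite ler_wpM2r.
have vE : v = u - e * u / 16 by rewrite /v /u thE'; ring.
have nu : 1000 * (n * b * u) <= e * u.
  by move: (ler_wpM2r u0 nb); clear; lra.
have d0' := ltW d0; have N0' := ltW N0.
have nd0 : 0 <= n * del by rewrite mulr_ge0 // ltW.
have FE' : F = 2 * v - N by rewrite FE /v; ring.
have FN : - N <= F by rewrite FE'; move: v0; clear; lra.
have k1 : k <= 1.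
  have : 0 <= (n - 2) * b by rewrite mulr_ge0 ?(ltW b0) // subr_ge0; apply: le_trans n5; clear; lra.
  by rewrite kE; clear; lra.
have k2 : 1 / 2 <= k by rewrite kE; move: nb i5 b0; clear; lra.
have nv : n * b * v <= n * b * u by rewrite ler_wpM2l // mulr_ge0 ?ltW.
have bv : 0 <= b * v by rewrite mulr_ge0 // ltW.
have LE : - (k * F - 2 * z) = k * N + (2 * u - 2 * (k * v) - 4 * (n - 1) * (gam * sg)) + 4 * (n - 1) * del.
  by rewrite zE FE'; ring.
have d41 : 0 <= 4 * (n - 1) * del by move: nd0 d0' n5; clear => *; rewrite !mulr_ge0 // subr_ge0; lra.
have d42 : 4 * (n - 1) * del <= N / 16 by move: h4 d0'; clear; lra.
have L1 : 0 <= 2 * u - 2 * (k * v) - 4 * (n - 1) * (gam * sg).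
  have : k * v <= v by rewrite ler_piMl.
  by move: vE eu0 ngs gs0; clear; lra.
have L2 : 2 * u - 2 * (k * v) - 4 * (n - 1) * (gam * sg) <= u / 20.
  have g4 : 0 <= 4 * (n - 1) * (gam * sg).
    by rewrite mulr_ge0 // mulr_ge0 // subr_ge0; apply: le_trans n5; clear; lra.
  by rewrite kE; move: g4 nv bv vE eu0 eu5 nu u0; clear; lra.
have P1 : k * N <= - (k * F - 2 * z) by rewrite LE; move: d41 L1; clear; lra.
have kN : k * N <= N by rewrite ler_piMl.
have P2 : - (k * F - 2 * z) <= N + u / 20 + N / 16 by rewrite LE; move: d42 L2 kN; clear; lra.
have kN0 : 0 <= k * N by apply: mulr_ge0 => //; apply: le_trans k2; clear; lra.
have S1 := @pinched_trace_gain _ k N u v (- (k * F - 2 * z)) z G T' gS k2 k1 v0 vu N0' P1 P2.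
have S2 : T' ^+ 2 + N ^+ 2 / 2 - 3 * (u * N) - u ^+ 2 <= 2 * gS.
  apply: S1; first by rewrite FE'; ring.
    by rewrite gSE; ring.
  by rewrite sqrrN; apply: GE; rewrite -oppr_ge0; exact: le_trans P1.
(* The gap between b and [th] is the only source of the positive term in |r|^2. *)
have thf : 4 * th * f2 = 4 * b * f2 - e * (b * f2) / 4 by rewrite thE'; field.
have S3 : b * w2 <= e * (b * f2) / 500 + N ^+ 2 / 100 + e * (b * f2) / 32
    + (T' ^+ 2 + 9 * u ^+ 2 + N ^+ 2 / 16) / 100.
  apply: (@low_eigenvalue_cross _ b u N F bb T' T kap e (e * sg) (n * del)) => //.
  - have := ler_wpM2l (sqr_ge0 e) h3.
    rewrite (_ : e ^+ 2 * (1000 * n ^+ 2 * b) = 1000 * b) //.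
    by rewrite eE; field.
  - exact: ltW.
  - rewrite FE'; have := sqr_ge0 (2 * v + N).
    have : v ^+ 2 <= u ^+ 2 by rewrite lerXn2r ?nnegrE.
    by clear; rewrite !expr2; lra.
  - by rewrite bbE eE; field; rewrite nn.
  - rewrite TE; have g4 : 0 <= 4 * (n - 2) * (gam * sg).
      by rewrite mulr_ge0 // mulr_ge0 // subr_ge0; apply: le_trans n5; clear; lra.
    have : b * ((n - 4) * F) <= 2 * (n * b * v).
      rewrite FE'; have : 0 <= (n - 4) * (b * N).
        by rewrite mulr_ge0 ?subr_ge0 ?mulr_ge0 ?(ltW b0) //; apply: le_trans n5; clear; lra.
      by move: bv; clear; lra.
    by move: g4 nv nu eu5 eu0 u0 d0'; rewrite /u; clear; lra.
have S4 := @low_eigenvalue_sum _ (e * (b * f2)) (del * sg) (del * u) (N ^+ 2) (T' ^+ 2) (u ^+ 2) (u * N) gS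
  (u * F) (gam * sg ^+ 2) (del * F) (gam * sg * F) (b * w2).
apply: lt_le_trans (S4 _ _ _ _ _ _ _ _ _ _ _ _ _) _ => //.
- exact: mulr_ge0.
- exact: exprn_gt0.
- exact: sqr_ge0.
- by have := ler_wpM2r s0 h2; rewrite /u; clear; lra.
- have ds : 0 <= del * sg by exact: mulr_ge0.
  by have := ler_wpM2r ds b1; rewrite /u; clear; lra.
- by rewrite -mulrN ler_wpM2l.
- by rewrite /u exprMn ler_wpM2r // sqr_ge0.
- rewrite FE'; have := ler_wpM2l d0' vu; have := mulr_ge0 d0' N0'; clear; lra.
- have := ler_wpM2l gs0 FN; have := ler_wpM2r N0' gs1; clear; lra.
rewrite thf le_eqVlt; apply/orP; left; apply/eqP; rewrite /u; ring.
Qed.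

(** * A curvature tensor shifted by a multiple of its own Ricci tensor *)

Section RicciShift.
Variables (R : realType) (n : nat) (A S : tensor4 R n) (b c : R).
Hypotheses (cA : curvature_tensor A) (cS : curvature_tensor S).
Hypothesis AE : A = S + KN (b *: Ric A + c *: 1%:M) 1%:M.
Local Notation k := (1 - (n%:R - 2) * b).
Local Notation z := (b * scal A + 2 * (n%:R - 1) * c).

Lemma scal_trace (B : tensor4 R n) : scal B = \tr (Ric B). Proof. by []. Qed.

Lemma shift_trace : \tr (b *: Ric A + c *: 1%:M) = b * scal A + c * n%:R.
Proof. by rewrite mxtraceD !mxtraceZ mxtrace1 -scal_trace. Qed.

Lemma shift_sym : (b *: Ric A + c *: 1%:M)^T = b *: Ric A + c *: 1%:M :> 'M[R]_n.
Proof. by rewrite linearD /= !linearZ /= trmx1 (Ric_sym cA). Qed.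

Lemma Ric_shift p q : Ric S p q = k * Ric A p q - z * (p == q)%:R.
Proof.
have := congr1 (fun B : tensor4 R n => Ric B p q) AE; rewrite RicD Ric_KN1 shift_trace !mxE => h.
rewrite -[p == q]/(p == q : bool) in h *; move: h; set d := (p == q)%:R; lra.
Qed.

Lemma scal_shift : scal S = (1 - 2 * (n%:R - 1) * b) * scal A - 2 * n%:R * (n%:R - 1) * c.
Proof.
rewrite /scal; under eq_bigr do rewrite Ric_shift eqxx mulr1.
rewrite sumrB sumr_const card_ord -mulr_sumr -[_ *+ n]mulr_natl -/(scal A); ring.
Qed.

Lemma starD (B C : tensor4 R n) (M : 'M[R]_n) : star (B + C) M = star B M + star C M.
Proof.
apply/matrixP => p q; rewrite !mxE -big_split; apply: eq_bigr => x _ /=.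
by rewrite -big_split; apply: eq_bigr => y _ /=; rewrite tcompD mulrDl.
Qed.

Lemma star_lin (B : tensor4 R n) (x y : R) (M N : 'M[R]_n) :
  star B (x *: M + y *: N) = x *: star B M + y *: star B N.
Proof.
apply/matrixP => p q; rewrite !mxE !mulr_sumr -big_split; apply: eq_bigr => s _ /=.
by rewrite !mulr_sumr -big_split; apply: eq_bigr => t _ /=; rewrite !mxE; ring.
Qed.

Lemma star1 (B : tensor4 R n) : star B 1%:M = Ric B.
Proof.
apply/matrixP => p q; rewrite RicE mxE; apply: eq_bigr => s _.
under eq_bigr do rewrite idE (eq_sym s).
by rewrite sum_delta.
Qed.

Lemma KN_linl (x y : R) (M N L : 'M[R]_n) :
  KN (x *: M + y *: N) L = x *: KN M L + y *: KN N L.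
Proof. by apply: tcomp_inj => i j p q; rewrite tcompD !tcompZ !KNE !mxE; ring. Qed.

Lemma starZ (B : tensor4 R n) (x : R) (M : 'M[R]_n) : star (x *: B) M = x *: star B M.
Proof.
apply/matrixP => p q; rewrite !mxE mulr_sumr; apply: eq_bigr => s _ /=.
by rewrite mulr_sumr; apply: eq_bigr => t _ /=; rewrite tcompZ mulrA.
Qed.

Lemma star_id (M : 'M[R]_n) : star (KN 1%:M 1%:M) M = 2 *: (\tr M *: 1%:M - M^T).
Proof.
apply/matrixP => i q; rewrite mxE.
under eq_bigr do under eq_bigr do rewrite mulrC.
rewrite contract_KN13 !mxE.
under [X in _ - X - _]eq_bigr do rewrite idE mulrC eq_sym.
under [X in _ - _ - X]eq_bigr do rewrite idE mulrC.
under [X in _ + _ * X]eq_bigr => p _.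
  under eq_bigr => t _ do rewrite idE (eq_sym p t).
  rewrite sum_delta; over.
by rewrite !sum_delta /mxtrace; ring.
Qed.

Lemma star_shift (r := Ric A) p q : star A r p q = star S r p q
  + b * (scal A * r p q - 2 * (r *m r) p q + frobenius r r * (p == q)%:R)
  + 2 * c * (scal A * (p == q)%:R - r p q).
Proof.
rewrite {1}AE starD KN_linl starD !starZ star_KN1 ?(Ric_sym cA) // star_id (Ric_sym cA) -scal_trace.
by rewrite !mxE; ring.
Qed.

(** The estimates concern the PIC tensor [S] acting on its own Ricci tensor, the derivative concerns
    [S] acting on [Ric A]. The two Ricci tensors differ by a factor and a multiple of the identity,
    and [star S 1%:M] is [Ric S]. *)
Lemma star_Ric_shift p q :
  k * star S (Ric A) p q = star S (Ric S) p q + z * Ric S p q.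
Proof.
have E : k *: Ric A = 1 *: Ric S + z *: 1%:M.
  by apply/matrixP => x y; move: (Ric_shift x y); move: (Ric S) (Ric A) z => rS rA z0; rewrite !mxE => ->; ring.
have := congr1 (fun M => star S M p q) E; rewrite star_lin star1.
have := star_lin S k 0 (Ric A) 0; rewrite !scale0r !addr0 => ->.
move: (star S (Ric A)) (star S (Ric S)) (Ric S) => X Y Z; by rewrite !mxE mul1r.
Qed.

End RicciShift.

Section LowEigenvalue.
Variables (R : realType) (n : nat) (A S : tensor4 R n) (b del gam th N kap bb : R) (i j : 'I_n).
Local Notation r := (Ric A).
Local Notation sg := (scal A).
Local Notation c := (del - gam * scal A).
Local Notation J := (off_plane i j).
Local Notation T := (r i i + r j j - 2 * sec A i j).
Hypotheses (n5 : (5 <= n)%N) (cA : curvature_tensor A) (pS : PIC S)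
  (AE : A = S + KN (b *: r + c *: 1%:M) 1%:M).
Hypotheses (ij : i != j) (b_gt0 : 0 < b) (del_gt0 : 0 < del) (N_gt0 : 0 < N) (kap_gt0 : 0 < kap).
Hypotheses (b_small : 1000 * n%:R ^+ 2 * b <= 1) (bN_small : 1000 * (b * N) <= del)
  (b_kap : 1000 * n%:R ^+ 2 * b <= kap ^+ 2) (N_large : 64 * (n%:R * del) <= N).
Hypotheses (gamE : gam = (1 / 2 + 1 / (4 * n%:R)) * b ^+ 2) (thE : th = (1 - 1 / (16 * n%:R)) * b).
Hypothesis diagH : forall p q, p \in J -> q \in J -> p != q ->
  tcomp S i p i q + tcomp S j p j q = 0.
Hypotheses (first_i : forall q, q \in J -> r i q = 0) (first_j : forall q, q \in J -> r j q = 0).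
Hypothesis boundary : r i i + r j j = 2 * th * sg - N.
Hypotheses (bbE : kap * bb = T + kap * (1 / (16 * n%:R)) * sg)
  (gap_diag : `|r i i - r j j| <= bb) (gap_mixed : `|2 * r i j| <= bb) (T_ge0 : 0 <= T) (sg_ge0 : 0 <= sg).

Let cS : curvature_tensor S. Proof. by case: pS. Qed.
Local Notation k := (1 - (n%:R - 2) * b).
Local Notation z := (b * sg + 2 * (n%:R - 1) * c).
Local Notation rho := (Ric S).
Local Notation a p := (sec S i p + sec S j p).

Let rhoE p q : rho p q = k * r p q - z * (p == q)%:R.
Proof. exact: Ric_shift. Qed.

(** The vanishing mixed Ricci terms and [diagH] leave the sum of a_p rho_pp, where rho_pp is a_p
    plus sectional curvatures off the plane, as in [weighted_sum_ge]. The remaining term sec_ij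
    (rho_ii + rho_jj) is at least half the square of the trace, because the trace is nonpositive. *)
Lemma low_eigenvalue_star : rho i i + rho j j <= 0 ->
  ((rho i i + rho j j) ^+ 2 + (\sum_(p in J) a p) ^+ 2) / 2 <=
  star S rho i i + star S rho j j.
Proof.
move=> h; have rs := Ric_sym cS.
have ji : j != i by rewrite eq_sym.
have rE : rho i i + rho j j = 2 * sec S i j + \sum_(p in J) a p.
  by rewrite !Ric_diagE !(sum_plane ij) big_split /= !(sec_diag pS) (sec_sym pS j i); ring.
have T0 : 0 <= \sum_(p in J) a p by exact: plane_trace_ge0.
rewrite (star_plane cS ij rs) (star_plane cS ji rs).
have -> : off_plane j i = J by apply/setP => p; rewrite !inE andbC.
have ni q : q \in J -> rho i q = 0.
  by move=> qJ; rewrite rhoE first_i //; move: qJ; rewrite inE => /andP[qi _]; rewrite eq_sym (negPf qi) !mulr0 subr0.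
have nj q : q \in J -> rho j q = 0.
  by move=> qJ; rewrite rhoE first_j //; move: qJ; rewrite inE => /andP[_ qj]; rewrite eq_sym (negPf qj) !mulr0 subr0.
rewrite [X in _ + 2 * X + _ + _]big1; last by move=> q qJ; rewrite nj ?mulr0.
rewrite [X in _ + (_ + 2 * X + _)]big1; last by move=> q qJ; rewrite ni ?mulr0.
rewrite -/(sec S i j) -/(sec S j i) (sec_sym pS j i).
have E : \sum_(p in J) \sum_(q in J) tcomp S i p i q * rho p q
    + \sum_(p in J) \sum_(q in J) tcomp S j p j q * rho p q =
    \sum_(p in J) a p * (a p + \sum_(q in J) sec S p q).
  rewrite -big_split; apply: eq_bigr => p pJ /=; rewrite -big_split /= (sum_in_rem _ pJ) big1 ?addr0.
    rewrite -mulrDl -/(sec S i p) -/(sec S j p); congr (_ * _).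
    by rewrite Ric_diagE (sum_plane ij) !(sec_sym pS p).
  move=> q; rewrite in_setD1 => /andP[qp qJ]; rewrite -mulrDl diagH ?mul0r // eq_sym //.
have J2 : (2 < #|J|)%N by rewrite -(ltn_add2r 2) card_off_plane.
have aa p q : p \in J -> q \in J -> p != q -> 0 <= a p + a q by exact: plane_pair_ge0.
have W := @weighted_sum_ge _ _ J (sec S) (fun p => a p) (sec S i j) J2 (sec_diag pS) aa _ (sec_sym pS) _.
have {W} := W _ _; rewrite -E -rE => /(_ _ h) W.
have {}W : (\sum_(p in J) a p) ^+ 2 / 2 <= \sum_(p in J) \sum_(q in J) tcomp S i p i q * rho p q
    + \sum_(p in J) \sum_(q in J) tcomp S j p j q * rho p q.
  apply: W => p q; rewrite !inE => /andP[pi pj] /andP[qi qj] pq.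
  have u1 : uniq [:: i; p; j; q].
    by rewrite /= !inE !negb_or ij pq !(eq_sym i) pi qi pj (eq_sym j) qj.
  have u2 : uniq [:: i; q; j; p].
    by rewrite /= !inE !negb_or ij (eq_sym q p) pq !(eq_sym i) pi qi qj (eq_sym j) pj.
  have := PIC_sec_ge0 pS u1; have := PIC_sec_ge0 pS u2.
  by rewrite (sec_sym pS q j) (sec_sym pS q p) (sec_sym pS p j); lra.
have : 0 <= - (rho i i + rho j j) * \sum_(p in J) a p by rewrite mulr_ge0 // oppr_ge0.
have -> : sec S i j = ((rho i i + rho j j) - \sum_(p in J) a p) / 2 by rewrite rE; field.
move: W; lra.
Qed.

Lemma low_eigenvalue_derivative_gt0 :
  0 < 2 * star A r i i + 2 * star A r j j - 4 * th * frobenius r r.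
Proof.
pose F := 2 * th * sg - N.
have rs := Ric_sym cA; have rE x y := Ric_symE x y cA.
have sgE : sg = \sum_p r p p by [].
apply: (@low_eigenvalue_arith _ n%:R b del gam sg F N th kap (frobenius r r)
  ((r *m r) i i + (r *m r) j j) (star S r i i + star S r j j) (star S rho i i + star S rho j j)
  (\sum_(p in J) a p) T bb k z) => //.
- by rewrite ler_nat.
- rewrite mulrDr !(star_Ric_shift AE) !rhoE !eqxx !mulr1 /F -boundary.
  move: (star S rho i i) (star S rho j j) => x y; ring.
- have -> : k * F - 2 * z = rho i i + rho j j.
    by rewrite !rhoE !eqxx !mulr1 /F -boundary; ring.
  exact: low_eigenvalue_star.
- exact: plane_trace_ge0.
- have sE : sec A i j = sec S i j + b * (r i i + r j j) + 2 * c.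
    rewrite /sec {1}AE tcompD KNE !mxE !eqxx (negPf ij) eq_sym (negPf ij).
    by rewrite !mulr0 !subr0 !mulr1; ring.
  have -> : \sum_(p in J) a p = k * (r i i + r j j) - 2 * z - 2 * sec S i j.
    by rewrite (plane_trace pS ij) !rhoE !eqxx !mulr1; ring.
  by rewrite sE /F -boundary; ring.
(* On the plane tr(r^2) = (r_ii + r_jj)^2 / 2 + (r_ii - r_jj)^2 / 2 + 2 r_ij^2, and the two gap
   bounds each contribute bb^2 / 2. *)
- have w p : (r *m r) p p = \sum_q r p q ^+ 2.
    by rewrite mxE; apply: eq_bigr => q _; rewrite (rE q p).
  rewrite !w !(sum_plane ij) /= !big1; first last.
  - by move=> q qJ; rewrite first_i ?expr0n.
  - by move=> q qJ; rewrite first_j ?expr0n.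
  have bb0 : 0 <= bb by exact: le_trans gap_diag.
  have h1 : (r i i - r j j) ^+ 2 <= bb ^+ 2.
    by rewrite -real_normK ?num_real // lerXn2r ?nnegrE.
  have h2 : (2 * r i j) ^+ 2 <= bb ^+ 2.
    by rewrite -real_normK ?num_real // lerXn2r ?nnegrE.
  rewrite (rE j i) !addr0 /F -boundary; move: h1 h2.
  by move: (r i i) (r j j) (r i j) => x y t; rewrite !expr2; lra.
- exact: scal_sqr_le.
rewrite !(star_shift cA AE) !eqxx !mulr1 /F -boundary; ring.
Qed.

End LowEigenvalue.

(** * Evolution of the shifted isotropic curvature *)

(** Here e = 1/n, u = b s, t = b times the Ricci trace on the frame, d = [del], m = n - 1, w = n b N
    and C = (gam s)^2. Keeping t apart from u matters, since the trace has no upper bound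
    proportional to u. *)
Lemma isotropic_pinching_sum (R : realFieldType) (e u t N tau' bN w d X eta eps k b m C : R) :
  0 <= u -> 0 <= t -> 0 <= tau' -> 0 <= N -> 0 < d -> 0 <= eta -> 1000 * eta <= e -> 16 * eps = e ->
  0 < e -> e <= 1 / 5 -> 0 <= k -> k <= 1 -> 0 <= b -> 1000 * b <= e ^+ 2 ->
  N * t <= 2 * (bN * tau') + 8 * (e * u * w) + 16 * (w * d) ->
  1000 * bN <= d -> 0 <= w -> 1000 * w <= d -> b * N ^+ 2 <= d ^+ 2 ->
  4 <= m -> 32 * m * C <= e ^+ 2 * u ^+ 2 / 10 ->
  X = 4 * (1 - eta) * ((2 * (1 - eps) * u - N) * t - b * (2 * (1 - eps) * u - N) ^+ 2)
    + 8 * (d * tau') + 32 * m * d ^+ 2 - (4 + 2 * e) * (k * (u * t)) - 32 * m * C - 4 * (u * t)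
    + t ^+ 2 + 4 * (e ^+ 2 * u ^+ 2) ->
  0 < X.
Proof.
move=> u0 t0 tau0 N0 d0 eta0 etae epse e0 e5 k0 k1 b0 be Nt hbN w0 wd bN2 m4 hC ->.
have ut0 : 0 <= u * t by exact: mulr_ge0.
have eu0 : 0 <= e * (u * t) by apply: mulr_ge0 => //; exact: ltW.
have eta1 : eta <= 1 by move: etae e5; clear; lra.
have h1 : - (26 / 10) * (e * (u * t)) <=
    8 * (1 - eta) * (1 - eps) * (u * t) - (4 + 2 * e) * (k * (u * t)) - 4 * (u * t).
  have k1' : (4 + 2 * e) * (k * (u * t)) <= (4 + 2 * e) * (u * t).
    by rewrite ler_wpM2l ?ler_piMl //; move: e0; clear; lra.
  have e1 : eps = e / 16 by move: epse; clear; lra.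
  have h : eta * (u * t) <= e / 1000 * (u * t) by rewrite ler_wpM2r //; move: etae; clear; lra.
  have h' : 0 <= eta * eps * (u * t).
    by rewrite mulr_ge0 // mulr_ge0 // e1; move: e0; clear; lra.
  by rewrite e1 in h' *; move: k1' h h' eu0; clear; lra.
have h2 : b * (2 * (1 - eps) * u - N) ^+ 2 <= e ^+ 2 * u ^+ 2 / 100 + 2 * d ^+ 2.
  have v2 : (2 * (1 - eps) * u - N) ^+ 2 <= 8 * u ^+ 2 + 2 * N ^+ 2.
    have v1 : ((1 - eps) * u) ^+ 2 <= u ^+ 2.
      have : 0 <= 1 - eps <= 1 by move: epse e0 e5; clear; lra.
      move=> /andP[p0 p1].
      by rewrite lerXn2r ?nnegrE ?mulr_ge0 // ler_piMl.
    by have := sqr_ge0 (2 * (1 - eps) * u + N); move: v1; clear; rewrite !expr2; lra.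
  have := ler_wpM2l b0 v2; have := ler_wpM2r (sqr_ge0 u) be; have := mulr_ge0 b0 (sqr_ge0 u).
  have := mulr_ge0 (sqr_ge0 e) (sqr_ge0 u).
  by move: bN2; clear; lra.
have h2p : 0 <= b * (2 * (1 - eps) * u - N) ^+ 2 by rewrite mulr_ge0 // sqr_ge0.
have h2' : 4 * (1 - eta) * (b * (2 * (1 - eps) * u - N) ^+ 2) <= 4 * (e ^+ 2 * u ^+ 2 / 100 + 2 * d ^+ 2).
  apply: le_trans (ler_wpM2l _ h2) => //.
  by have := mulr_ge0 eta0 h2p; clear; lra.
have h3 : 4 * (1 - eta) * (N * t) <= 4 * (N * t).
  by have := mulr_ge0 eta0 (mulr_ge0 N0 t0); clear; lra.
have h4 : 8 * (bN * tau') <= 8 * (d * tau') / 1000 by have := ler_wpM2r tau0 hbN; clear; lra.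
have h5 : 32 * (e * u * w) <= e ^+ 2 * u ^+ 2 + 256 * w ^+ 2.
  by have := sqr_ge0 (e * u - 16 * w); clear; rewrite !expr2; lra.
have h6 : 1000 * w ^+ 2 <= d ^+ 2.
  have := ler_wpM2r w0 wd; have := ler_wpM2l (ltW d0) wd; have := mulr_ge0 w0 (ltW d0).
  by clear; rewrite !expr2; lra.
have h7 : 1000 * (w * d) <= d ^+ 2 by have := ler_wpM2r (ltW d0) wd; rewrite expr2; clear; lra.
(* The terms in u t cancel up to -(13/5) e u t; this remainder is absorbed by t^2 and part of 4 e^2
   u^2 in a perfect square. *)
have h8 : - (26 / 10) * (e * (u * t)) + t ^+ 2 + 169 / 100 * (e ^+ 2 * u ^+ 2) >= 0.
  by have := sqr_ge0 (t - 13 / 10 * (e * u)); clear; rewrite !expr2; lra.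
have h9 : 128 * d ^+ 2 <= 32 * m * d ^+ 2.
  by have := ler_wpM2r (sqr_ge0 d) m4; clear; lra.
have d2 : 0 < d ^+ 2 by exact: exprn_gt0.
have dt : 0 <= d * tau' by apply: mulr_ge0 => //; exact: ltW.
have eu2 : 0 <= e ^+ 2 * u ^+ 2 by rewrite mulr_ge0 // sqr_ge0.
move: h1 h2' h3 h4 h5 h6 h7 h8 h9 d2 dt eu2 hC Nt.
set Y := b * _ ^+ 2; set Z := e ^+ 2 * u ^+ 2; set E := e * (u * t); set U := u * t; set V := N * t.
rewrite (_ : 4 * (1 - eta) * ((2 * (1 - eps) * u - N) * t - Y) =
  8 * (1 - eta) * (1 - eps) * U - 4 * (1 - eta) * V - 4 * (1 - eta) * Y); last by rewrite /U /V; ring.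
set A1 := 8 * (1 - eta) * (1 - eps) * U; set A2 := 4 * (1 - eta) * V; set A3 := 4 * (1 - eta) * Y.
set A4 := (4 + 2 * e) * _; set A5 := 32 * m * C; set A6 := 32 * m * _.
set A7 := e * u * w; set A8 := bN * tau'; clear; lra.
Qed.

Lemma isotropic_pinching_arith (R : realFieldType)
  (n b del gam th N sg tau tau' det q4 f2 PQ c k D : R) :
  5 <= n -> 0 < b -> 0 < del -> 0 < N -> 0 <= sg ->
  1000 * n ^+ 2 * b <= 1 -> 1000 * (n * (b * N)) <= del -> b * N ^+ 2 <= del ^+ 2 ->
  gam = (1 / 2 + 1 / (4 * n)) * b ^+ 2 -> th = (1 - 1 / (16 * n)) * b ->
  c = del - gam * sg -> k = 1 - (n - 2) * b ->
  tau' = k * tau - 4 * (b * sg) - 8 * (n - 1) * c -> 0 <= tau' ->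
  (2 * th * sg - N) * (tau - (2 * th * sg - N)) <= det ->
  tau ^+ 2 <= 4 * q4 -> sg ^+ 2 <= n * f2 -> 0 <= PQ ->
  D = PQ + (4 * b - 2 * (n - 2) * b ^+ 2) * det
    + 8 * c * (k * tau - 4 * b * sg - 4 * (n - 1) * c)
    - 4 * b ^+ 2 * sg * tau + 4 * b ^+ 2 * q4 + (16 * gam - 8 * b ^+ 2) * f2 ->
  0 < D.
Proof.
move=> n5 b0 d0 N0 s0 h1 h2 h3 gE thE.
have n0 : 0 < n by exact: lt_le_trans n5.
have nn : n != 0 by rewrite gt_eqF.
have [i0 i5] := inv_small n5.
have nb := small_nb n5 h1; have b1 := small_b1 n5 b0 h1.
have ngam := small_ngam n5 b0 h1 gE; have [g0 gb] := gam_bounds n5 gE.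
have thE' := th_split n5 thE.
have [e eE] : exists e, e = 1 / n by exists (1 / n).
rewrite -eE in i0 i5 nb ngam thE'.
have en : e * n = 1 by rewrite eE; field.
have be : 1000 * b <= e ^+ 2.
  have := ler_wpM2r (sqr_ge0 e) h1; rewrite mul1r.
  have -> : 1000 * n ^+ 2 * b * e ^+ 2 = 1000 * b * (e * n) ^+ 2 by ring.
  by rewrite en expr1n mulr1.
move=> cE kE tE t0 dE q4E f2E PQ0 ->.
have b0' := ltW b0; have N0' := ltW N0; have d0' := ltW d0.
pose u := b * sg.
have u0 : 0 <= u by exact: mulr_ge0.
have eu0 : 0 <= e * u by apply: mulr_ge0 => //; exact: ltW.
have eu5 : e * u <= u / 5 by move: (ler_wpM2r u0 i5); clear; lra.
have n10 : 0 <= n - 1 by move: n5; clear; lra.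
have gs0 : 0 <= gam * sg by rewrite mulr_ge0.
have ngs : 1000 * (n * (gam * sg)) <= e * u.
  by move: (ler_wpM2r s0 ngam); rewrite /u; clear; lra.
have ngs1 : 0 <= (n - 1) * (gam * sg) by exact: mulr_ge0.
have nd0 : 0 <= (n - 1) * del by exact: mulr_ge0.
have k1 : k <= 1.
  have : 0 <= (n - 2) * b by rewrite mulr_ge0 // subr_ge0; apply: le_trans n5; clear; lra.
  by rewrite kE; clear; lra.
have k2 : 1 / 2 <= k by rewrite kE; move: nb i5 b0; clear; lra.
have k0 : 0 < k by apply: lt_le_trans k2; clear; lra.
have ktE : k * tau = tau' + 4 * u + 8 * ((n - 1) * del) - 8 * ((n - 1) * (gam * sg)).
  by rewrite tE cE /u; ring.
have tau0 : 0 <= tau.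
  rewrite -(pmulr_rge0 _ k0) ktE; move: t0 u0 nd0 ngs eu5 gs0; clear; lra.
have tauU : tau <= 2 * tau' + 8 * u + 16 * ((n - 1) * del).
  have := ler_wpM2r tau0 k2; move: ktE ngs1; clear; lra.
have bN0 : 0 <= b * N by exact: mulr_ge0.
pose w := n * (b * N).
have w0 : 0 <= w by rewrite mulr_ge0 // ltW.
pose eta := (n - 2) * b / 2.
have eta0 : 0 <= eta.
  rewrite /eta divr_ge0 // mulr_ge0 // subr_ge0; apply: le_trans n5; clear; lra.
have C0 : 0 <= (gam * sg) ^+ 2 by exact: sqr_ge0.
have hC : 32 * (n - 1) * (gam * sg) ^+ 2 <= e ^+ 2 * u ^+ 2 / 10.
  have h : 1000 * (n * (gam * sg)) * (gam * sg) <= e * u * (gam * sg) by exact: ler_wpM2r.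
  have h' : 1000 * (gam * sg) <= e * u.
    have : 1 * (gam * sg) <= n * (gam * sg) by rewrite ler_wpM2r //; apply: le_trans n5; clear; lra.
    by move: ngs; clear; lra.
  have := ler_wpM2l eu0 h'; move: h C0 (mulr_ge0 eu0 eu0); clear; rewrite !expr2; lra.
have bt0 : 0 <= b * tau by exact: mulr_ge0.
have S := @isotropic_pinching_sum _ e u (b * tau) N tau' (b * N) w del _ eta (e / 16) k b (n - 1)
  ((gam * sg) ^+ 2) u0 bt0 t0 N0' d0 eta0 _ _ i0 i5 (ltW k0) k1 b0' be _ _ w0 h2 h3 _ hC erefl.
apply: lt_le_trans (S _ _ _ _ _) _.
- by rewrite /eta; move: nb b0' i0; clear; lra.
- by clear; lra.
- have := ler_wpM2l bN0 tauU.
  have -> : e * u * w = u * (b * N).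
    have -> : e * u * w = (e * n) * u * (b * N) by rewrite /w; ring.
    by rewrite en mul1r.
  have : (n - 1) * (b * N * del) <= w * del.
    by rewrite /w -(mulrA n); apply: ler_wpM2r; [exact: mulr_ge0|clear; lra].
  by clear; lra.
- have : 1 * (b * N) <= w by rewrite /w ler_wpM2r //; apply: le_trans n5; clear; lra.
  by move: h2; rewrite /w; clear; lra.
- by move: n5; clear; lra.
have K0 : 0 <= 4 * b - 2 * (n - 2) * b ^+ 2.
  have : 0 <= 4 * b * (1 - (n * b)) by rewrite mulr_ge0 ?mulr_ge0 //; move: nb i5; clear; lra.
  by have := sqr_ge0 b; rewrite !expr2; move: (mulr_ge0 (ltW n0) (mulr_ge0 b0' b0')); clear; lra.
have D1 := ler_wpM2l K0 dE.
have D2 : (b * tau) ^+ 2 <= 4 * b ^+ 2 * q4.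
  by have := ler_wpM2l (sqr_ge0 b) q4E; rewrite exprMn; clear; lra.
(* The excess of [gam] over b^2 / 2 pays through s^2 <= n |r|^2. *)
have D3 : 4 * (e ^+ 2 * u ^+ 2) <= (16 * gam - 8 * b ^+ 2) * f2.
  have -> : 16 * gam - 8 * b ^+ 2 = 4 * (e * b ^+ 2) by rewrite gE eE; field.
  have := ler_wpM2l (mulr_ge0 (sqr_ge0 e) (sqr_ge0 b)) f2E.
  have -> : e ^+ 2 * b ^+ 2 * (n * f2) = (e * n) * (e * b ^+ 2 * f2) by ring.
  by rewrite en mul1r /u exprMn; clear; lra.
have g2 : 0 <= 32 * (gam * b * sg ^+ 2) by rewrite !mulr_ge0 // sqr_ge0.
have thE2 : th = (1 - e / 16) * b by rewrite thE'; ring.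
have gE2 : gam = (1 / 2 + e / 4) * b ^+ 2 by rewrite gE eE; congr (_ * _); field.
have E : 8 * c * (k * tau - 4 * b * sg - 4 * (n - 1) * c) =
   8 * (del * tau') + 32 * (n - 1) * del ^+ 2 - (4 + 2 * e) * (k * (u * (b * tau)))
   + 32 * (gam * b * sg ^+ 2) - 32 * (n - 1) * (gam * sg) ^+ 2.
  have -> : (4 + 2 * e) * (k * (u * (b * tau))) = 8 * gam * k * sg * tau.
    by rewrite gE2 /u; field.
  by rewrite tE cE; ring.
rewrite E; apply: (@le_trans _ _ (PQ + (4 * b - 2 * (n - 2) * b ^+ 2) * ((2 * th * sg - N) * (tau - (2 * th * sg - N)))
  + (8 * (del * tau') + 32 * (n - 1) * del ^+ 2 - (4 + 2 * e) * (k * (u * (b * tau)))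
   + 32 * (gam * b * sg ^+ 2) - 32 * (n - 1) * (gam * sg) ^+ 2) - 4 * b ^+ 2 * sg * tau
  + (b * tau) ^+ 2 + 4 * (e ^+ 2 * u ^+ 2))); last first.
  by move: D1 D2 D3; clear; lra.
have -> : (4 * b - 2 * (n - 2) * b ^+ 2) * ((2 * th * sg - N) * (tau - (2 * th * sg - N))) =
  4 * (1 - eta) * ((2 * (1 - e / 16) * u - N) * (b * tau) - b * (2 * (1 - e / 16) * u - N) ^+ 2).
  by rewrite thE2 /eta /u; field.
by move: PQ0 g2; rewrite /u; clear; lra.
Qed.

Section PiccKN.
Variables (R : realType) (n : nat) (i1 i2 i3 i4 : 'I_n).
Hypothesis u4 : uniq [:: i1; i2; i3; i4].
Local Notation pc B := (picc B i1 i2 i3 i4).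
Local Notation tr4 M := (M i1 i1 + M i2 i2 + M i3 i3 + M i4 i4).

Lemma picc_lin (x y : R) (B C : tensor4 R n) : pc (x *: B + y *: C) = x * pc B + y * pc C.
Proof. by rewrite /picc !tcompD !tcompZ; ring. Qed.

Lemma KN_linr (x y : R) (M N L : 'M[R]_n) :
  KN L (x *: M + y *: N) = x *: KN L M + y *: KN L N.
Proof. by rewrite !(KNC L) KN_linl. Qed.

Lemma picc_KN1 (M : 'M[R]_n) : pc (KN M 1%:M) = 2 * tr4 M.
Proof.
move: u4; rewrite /= !inE !negb_or => /and4P[/and3P[/negPf h12 /negPf h13 /negPf h14]].
move=> /andP[/negPf h23 /negPf h24] /negPf h34 _.
by rewrite /picc !KNE !idE !eqxx !(eq_sym i3) !(eq_sym i4) ?(h13, h14, h23, h24) !mulr0 !mulr1; ring.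
Qed.

Lemma picc_id : pc (KN 1%:M 1%:M) = 8 :> R.
Proof. by rewrite picc_KN1 !idE !eqxx /=; ring. Qed.

Lemma picc_KN_shift (M : 'M[R]_n) (x y x' y' : R) :
  pc (KN (x *: M + y *: 1%:M) (x' *: M + y' *: 1%:M)) =
  x * x' * pc (KN M M) + 2 * (x * y' + y * x') * tr4 M + 8 * y * y'.
Proof.
rewrite (KN_linl x y M 1%:M) picc_lin !(KN_linr x' y' M 1%:M).
rewrite !(picc_lin x' y') (KNC 1%:M M) picc_id picc_KN1.
ring.
Qed.

Lemma picc_Q_KN (S : tensor4 R n) (M : 'M[R]_n) : curvature_tensor S -> M^T = M ->
  pc (Q (S + KN M 1%:M)) = pc (Q S) + 2 * pc (KN (star S M) 1%:M) + 2 * pc (KN (Ric S) M)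
  + (n%:R - 2) * pc (KN M M) + 2 * \tr M * pc (KN M 1%:M)
  - 2 * pc (KN (M *m M) 1%:M) + frobenius M M * pc (KN 1%:M 1%:M).
Proof.
move=> cS Ms; have E a d e f := @tcompQ_KN _ _ S M a d e f cS Ms.
rewrite /picc !E.
move: (KN (star S M) 1%:M) (KN (Ric S) M) (KN (M *m M) 1%:M) (KN M M) (KN M 1%:M) (KN 1%:M 1%:M) (Q S).
by move=> X1 X2 X3 X4 X5 X6 X7; move: (\tr M) (frobenius M M) => x y; ring.
Qed.

End PiccKN.

Section Isotropic.
Variables (R : realType) (n : nat) (A S : tensor4 R n) (b del gam th N : R) (i1 i2 i3 i4 : 'I_n).
Local Notation r := (Ric A).
Local Notation sg := (scal A).
Local Notation c := (del - gam * scal A).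
Local Notation k := (1 - (n%:R - 2) * b).
Local Notation z := (b * sg + 2 * (n%:R - 1) * c).
Local Notation tr4 M := (M i1 i1 + M i2 i2 + M i3 i3 + M i4 i4).
Hypotheses (n5 : (5 <= n)%N) (cA : curvature_tensor A) (pS : PIC S)
  (AE : A = S + KN (b *: r + c *: 1%:M) 1%:M) (u4 : uniq [:: i1; i2; i3; i4]).

Let cS : curvature_tensor S. Proof. by case: pS. Qed.

(** The left side is the functional of condition (1) along [Q A]. Expanding [Q] of the shift
    produces 4 b times the trace of [star S r], a term without sign, which the Ricci part of the
    functional cancels exactly; the other terms are quadratic in the Ricci tensor and c. *)
Lemma picc_shift_derivative :
  picc (Q A) i1 i2 i3 i4 - 4 * b * tr4 (star A r) + 16 * gam * frobenius r r =
  picc (Q S) i1 i2 i3 i4 + (4 * b - 2 * (n%:R - 2) * b ^+ 2) * (picc (KN r r) i1 i2 i3 i4 / 2)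
    + 8 * c * (k * tr4 r - 4 * b * sg - 4 * (n%:R - 1) * c)
    - 4 * b ^+ 2 * sg * tr4 r + 4 * b ^+ 2 * tr4 (r *m r) + (16 * gam - 8 * b ^+ 2) * frobenius r r.
Proof.
have Ms := shift_sym b c cA.
rewrite {1}AE (picc_Q_KN i1 i2 i3 i4 cS Ms) !(star_shift cA AE) !eqxx (shift_trace A b c).
have RE : Ric S = k *: r + (- z) *: 1%:M.
  apply/matrixP => p q; have := Ric_shift AE p q; move: (Ric S) (Ric A) z => X Y w -> .
  by rewrite !mxE; ring.
have E1 : star S (b *: r + c *: 1%:M) = b *: star S r + c *: Ric S by rewrite star_lin star1.
have E2 : (b *: r + c *: 1%:M) *m (b *: r + c *: 1%:M) = b ^+ 2 *: (r *m r) + (2 * b * c) *: r + c ^+ 2 *: 1%:M.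
  rewrite mulmxDl !mulmxDr -!scalemxAl -!scalemxAr !mulmx1 !mul1mx !scalerA.
  by apply/matrixP => p q; move: (r *m r) r c => X Y w; rewrite !mxE; ring.
have E3 : frobenius (b *: r + c *: 1%:M) (b *: r + c *: 1%:M) =
    b ^+ 2 * frobenius r r + 2 * b * c * sg + c ^+ 2 * n%:R.
  rewrite /frobenius; transitivity (\sum_p (b ^+ 2 * (\sum_q r p q * r p q) + 2 * b * c * r p p + c ^+ 2)).
    apply: eq_bigr => p _; move: c => w.
    transitivity (\sum_q (b ^+ 2 * (r p q * r p q) + 2 * b * w * r p q * (q == p)%:R
        + w ^+ 2 * (q == p)%:R * (q == p)%:R)).
      by apply: eq_bigr => q _; move: r => M; rewrite !mxE (eq_sym p q); ring.
    by rewrite !big_split /= -mulr_sumr !sum_delta eqxx mulr1.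
  rewrite !big_split /= -!mulr_sumr sumr_const card_ord; congr (_ + _).
  by rewrite -[c *+ n]mulr_natr mulrA -expr2.
have K M := @picc_KN1 R n i1 i2 i3 i4 u4 M.
rewrite (picc_id R u4) (K (star S _)) (K (b *: r + _)) (K (_ *m _)) (picc_KN_shift u4 r b c b c).
rewrite {1}RE (picc_KN_shift u4 r k (- z) b c) E1 E2 E3.
have RI p : Ric S p p = k * r p p - z by rewrite (Ric_shift AE) eqxx mulr1.
move: (picc (Q S) _ _ _ _) (picc (KN _ _) _ _ _ _) => P1 P2.
move: (star S r) (r *m r) (frobenius r r) sg RI => X Y f s.
move: (Ric S) r => rS rA RI; rewrite !mxE !eqxx !RI.
by rewrite /= !mulr1n; field.
Qed.

(** Determinant of the Hermitian form that r induces on the isotropic plane, whose off-diagonal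
    entry is r(zeta, conj(eta)). *)
Lemma isotropic_det :
  picc (KN r r) i1 i2 i3 i4 / 2 = (r i1 i1 + r i2 i2) * (r i3 i3 + r i4 i4)
   - (r i1 i3 + r i2 i4) ^+ 2 - (r i2 i3 - r i1 i4) ^+ 2.
Proof.
have rE p q : r p q = r q p by exact: Ric_symE.
rewrite /picc !KNE (rE i3) (rE i3 i2) (rE i4) (rE i4 i2).
by move: (Ric A) => M; field.
Qed.

Lemma isotropic_shift_derivative_gt0 :
  0 < b -> 0 < del -> 0 < N -> 0 <= sg ->
  1000 * n%:R ^+ 2 * b <= 1 -> 1000 * (n%:R * (b * N)) <= del -> b * N ^+ 2 <= del ^+ 2 ->
  gam = (1 / 2 + 1 / (4 * n%:R)) * b ^+ 2 -> th = (1 - 1 / (16 * n%:R)) * b ->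
  (2 * th * sg - N) * (tr4 r - (2 * th * sg - N)) <= picc (KN r r) i1 i2 i3 i4 / 2 ->
  picc S i1 i2 i3 i4 = 0 ->
  0 < picc (Q A) i1 i2 i3 i4 - 4 * b * tr4 (star A r) + 16 * gam * frobenius r r.
Proof.
move=> b0 d0 N0 s0 h1 h2 h3 gE thE dE P0.
apply: (@isotropic_pinching_arith _ n%:R b del gam th N sg (tr4 r) (tr4 (Ric S))
  (picc (KN r r) i1 i2 i3 i4 / 2) (tr4 (r *m r))
  (frobenius r r) (picc (Q S) i1 i2 i3 i4) c k) => //.
- by rewrite ler_nat.
- by rewrite !(Ric_shift AE) !eqxx !mulr1; ring.
- exact: PIC_Ric4_ge0.
- have rE p q : r p q = r q p by exact: Ric_symE.
  have q p : r p p ^+ 2 <= (r *m r) p p.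
    rewrite [leRHS]mxE (bigD1 p) //= expr2 lerDl; apply: sumr_ge0 => x _.
    by rewrite (rE x) -expr2 sqr_ge0.
  have := q i1; have := q i2; have := q i3; have := q i4.
  move: (r i1 i1) (r i2 i2) (r i3 i3) (r i4 i4) => x y w t.
  have := sqr_ge0 (x - y); have := sqr_ge0 (x - w); have := sqr_ge0 (x - t).
  have := sqr_ge0 (y - w); have := sqr_ge0 (y - t); have := sqr_ge0 (w - t).
  rewrite !expr2; lra.
- exact: scal_sqr_le.
- exact: picc_Q_ge0.
rewrite picc_shift_derivative; ring.
Qed.

End Isotropic.

(* A hermitian 2x2 form with diagonal [x], [y] and off-diagonal entry [p + i q]. *)
Lemma hermitian_det_ge0 (R : realFieldType) (x y p q : R) :
  (forall c s t : R, 0 <= c ^+ 2 * x + (s ^+ 2 + t ^+ 2) * y + 2 * c * (s * p + t * q)) ->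
  p ^+ 2 + q ^+ 2 <= x * y.
Proof.
move=> h; have y0 : 0 <= y by have := h 0 1 0; rewrite !expr2; lra.
set w := p ^+ 2 + q ^+ 2.
have [y_gt0|y_le0] := ltP 0 y.
  have := h y (- p) (- q).
  have -> : y ^+ 2 * x + ((- p) ^+ 2 + (- q) ^+ 2) * y + 2 * y * (- p * p + - q * q) =
    y * (x * y - w) by rewrite /w; ring.
  by rewrite pmulr_rge0 // subr_ge0.
have {y_le0 y0} yE : y = 0 by apply/eqP; rewrite eq_le y0 y_le0.
rewrite yE mulr0 leNgt; apply/negP => w0.
have := h 1 (- (x + 1) / (2 * w) * p) (- (x + 1) / (2 * w) * q).
have -> : 1 ^+ 2 * x + ((- (x + 1) / (2 * w) * p) ^+ 2 + (- (x + 1) / (2 * w) * q) ^+ 2) * y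
   + 2 * 1 * (- (x + 1) / (2 * w) * p * p + - (x + 1) / (2 * w) * q * q) = - 1.
  rewrite yE mulr0 addr0 (_ : - (x + 1) / (2 * w) * p * p + - (x + 1) / (2 * w) * q * q =
    - (x + 1) / (2 * w) * w); last by rewrite /w; ring.
  by field; rewrite gt_eqF.
by lra.
Qed.

(** * Invariance of sets given by linear inequalities *)

Section LinearPullback.
Variables (R : realType) (n : nat).

Lemma cvg_tcomp (T : Type) (F : set_system T) {FF : Filter F} (B : T -> tensor4 R n) B0 i j k l :
  B t @[t --> F] --> B0 -> tcomp (B t) i j k l @[t --> F] --> tcomp B0 i j k l.
Proof. by move=> h; apply: (@cvg_comp _ _ _ B (fun A : tensor4 R n => tcomp A i j k l) _ _ _ h); exact: coord_continuous. Qed.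

Definition linear_functional (lam : tensor4 R n -> R) :=
  forall x A B, lam (x *: A + B) = x * lam A + lam B.

Lemma cvg_pullback_entry (T : Type) (F : set_system T) {FF : Filter F} (x : T -> 'rV[R]_(n * n))
    (B : T -> tensor4 R n) x0 B0 i j k l :
  x t @[t --> F] --> x0 -> B t @[t --> F] --> B0 ->
  tcomp (pullback (vec_mx (x t)) (B t)) i j k l @[t --> F] -->
  tcomp (pullback (vec_mx x0) B0) i j k l.
Proof.
move=> hx hB.
have e a b : row a (vec_mx (x t)) 0 b @[t --> F] --> row a (vec_mx x0) 0 b.
  have -> : row a (vec_mx x0) 0 b = vec_mx x0 a b by rewrite mxE.
  under eq_fun do rewrite mxE.
  by apply: (@cvg_comp _ _ _ x (fun y => vec_mx y a b) _ _ _ hx); exact: cvg_vec_mx.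
under eq_fun do rewrite tcomp_pullback /tform; rewrite tcomp_pullback /tform.
do 4![apply: cvg_sum_ord => ?].
by do 4!apply: cvgM => //; exact: cvg_tcomp.
Qed.

Lemma cvg_linear_pullback (lam : tensor4 R n -> R) (T : Type) (F : set_system T) {FF : Filter F}
    (x : T -> 'rV[R]_(n * n)) (B : T -> tensor4 R n) x0 B0 : linear_functional lam ->
  x t @[t --> F] --> x0 -> B t @[t --> F] --> B0 ->
  lam (pullback (vec_mx (x t)) (B t)) @[t --> F] --> lam (pullback (vec_mx x0) B0).
Proof.
move=> ll hx hB.
under eq_fun do rewrite (lin_expand ll); rewrite (lin_expand ll).
apply: cvg_sum_ord => c; apply: cvgM; last exact: cvg_cst.
case/mxvec_indexP: c => a b; case/mxvec_indexP: a => i j; case/mxvec_indexP: b => k l.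
exact: cvg_pullback_entry.
Qed.

Lemma cvg_linear (lam : tensor4 R n -> R) (T : Type) (F : set_system T) {FF : Filter F}
    (B : T -> tensor4 R n) B0 : linear_functional lam ->
  B t @[t --> F] --> B0 -> lam (B t) @[t --> F] --> lam B0.
Proof.
move=> ll hB; under eq_fun do rewrite (lin_expand ll); rewrite (lin_expand ll).
apply: cvg_sum_ord => c; apply: cvgM; last exact: cvg_cst.
by apply: (@cvg_comp _ _ _ B (fun A : tensor4 R n => A 0 c) _ _ _ hB); exact: coord_continuous.
Qed.

End LinearPullback.

Section Barrier.
Variables (R : realType) (n : nat) (J : finType) (lam : J -> tensor4 R n -> R) (m : J -> R).
Hypothesis lin : forall j, linear_functional (lam j).

(** Quantifying over all pullbacks makes the set O(n)-invariant, so an inequality at its boundary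
    has to be proved at the standard frame only. *)
Definition barrier_set : set (tensor4 R n) := [set A | curvature_tensor A /\
  forall j g, orthogonal_mx g -> 0 <= lam j (pullback g A) + m j].

Lemma barrier_set_pullback g A : orthogonal_mx g -> barrier_set A -> barrier_set (pullback g A).
Proof.
move=> gO [cA hA]; split; first exact: curv_pullback.
by move=> j h hO; rewrite pullbackM; apply: hA; exact: orthogonal_mxM.
Qed.

Lemma convex_barrier_set : convex_set barrier_set.
Proof.
move=> A B l; rewrite !inE => -[cA hA] [cB hB].
have l0 : 0 <= l%:num :> R by []. have l1 : 0 <= 1 - l%:num :> R by rewrite subr_ge0.
have -> : conv l A B = l%:num *: A + (1 - l%:num) *: B by [].
split; first by apply: curvD; exact: curvZ.
move=> j g gO; rewrite pullbackD !pullbackZ lin.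
have := lin j (1 - l%:num) (pullback g B) 0; rewrite addr0 => ->.
have := lin j (-1) 0 0; rewrite scaler0 addr0 => h0.
have := mulr_ge0 l0 (hA j g gO); have := mulr_ge0 l1 (hB j g gO); lra.
Qed.

Lemma closed_curvature : closed (@curvature_tensor R n).
Proof.
have cc i j k l : continuous (fun A : tensor4 R n => tcomp A i j k l).
  by move=> A; exact: coord_continuous.
have ce (f h : tensor4 R n -> R) : continuous f -> continuous h -> closed [set x | f x = h x].
  move=> fc hc; rewrite (_ : mkset _ = [set x | f x - h x = 0]).
    by apply: closed_cont_eq => x; exact: (cvgB (fc x) (hc x)).
  by apply/seteqP; split=> x /= => [->|/subr0_eq //]; rewrite subrr.
have cN (f : tensor4 R n -> R) : continuous f -> continuous (fun x => - f x).
  by move=> fc x; exact: (cvgN (fc x)).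
have cD (f h : tensor4 R n -> R) : continuous f -> continuous h -> continuous (fun x => f x + h x).
  by move=> fc hc x; exact: (cvgD (fc x) (hc x)).
rewrite (_ : @curvature_tensor R n = \bigcap_(x in [set: 'I_n * 'I_n * 'I_n * 'I_n])
   ([set A | tcomp A x.1.1.1 x.1.1.2 x.1.2 x.2 = - tcomp A x.1.1.2 x.1.1.1 x.1.2 x.2] `&`
    [set A | tcomp A x.1.1.1 x.1.1.2 x.1.2 x.2 = - tcomp A x.1.1.1 x.1.1.2 x.2 x.1.2] `&`
    [set A | tcomp A x.1.1.1 x.1.1.2 x.1.2 x.2 = tcomp A x.1.2 x.2 x.1.1.1 x.1.1.2] `&`
    [set A | tcomp A x.1.1.1 x.1.1.2 x.1.2 x.2 + tcomp A x.1.1.2 x.1.2 x.1.1.1 x.2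
      + tcomp A x.1.2 x.1.1.1 x.1.1.2 x.2 = 0])).
  apply: closed_bigI => -[[[i j] k] l] _ /=.
  apply: closedI; [apply: closedI; [apply: closedI|]|].
  - exact: (ce _ _ (cc i j k l) (cN _ (cc j i k l))).
  - exact: (ce _ _ (cc i j k l) (cN _ (cc i j l k))).
  - exact: (ce _ _ (cc i j k l) (cc k l i j)).
  - exact: (closed_cont_eq (cD _ _ (cD _ _ (cc i j k l) (cc j k i l)) (cc k i j l))).
apply/seteqP; split=> A.
  by move=> cA [[[i j] k] l] _ /=; have [] := cA i j k l.
by move=> cA i j k l; have [[[/= h1 h2] h3] h4] := cA (i, j, k, l) I.
Qed.

Lemma closed_barrier_set : closed barrier_set.
Proof.
rewrite (_ : barrier_set = @curvature_tensor R n `&`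
   \bigcap_(x in [set x : J * 'M[R]_n | orthogonal_mx x.2]) [set A | 0 <= lam x.1 (pullback x.2 A) + m x.1]).
  apply: closedI; first exact: closed_curvature.
  apply: closed_bigI => -[j g] gO /=.
  rewrite (_ : mkset _ = (fun A => lam j (pullback g A) + m j) @^-1` [set y | 0 <= y]) //.
  apply: preimage_closed; last exact: closed_ge.
  have h : continuous (fun A => lam j (pullback g A)).
    move=> A; have := @cvg_linear_pullback R n (lam j) _ (nbhs A) _ (fun=> mxvec g) id (mxvec g) A (lin j).
    by rewrite mxvecK; apply; [exact: cvg_cst|exact: cvg_id].
  by move=> A _; exact: (cvgD (h A) (cvg_cst (m j))).
apply/seteqP; split=> A [cA hA]; split => //.
  by move=> [j g] /= gO; exact: hA.
by move=> j g gO; exact: (hA (j, g)).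
Qed.


Hypothesis boundary : forall B j, barrier_set B -> lam j B + m j = 0 -> 0 < lam j (Q B).

(** Each orthogonal matrix x has a neighbourhood on which the constraint persists for a short time:
    by continuity if it is strict at A, by the sign of the difference quotient if it is active.
    Compactness of the group makes the time uniform. *)
Lemma barrier_step (A : tensor4 R n) (ts : R) (F : set_system R) (X : R -> tensor4 R n) : Filter F ->
  barrier_set A -> (\forall s \near F, ts < s) -> (\forall s \near F, curvature_tensor (X s)) ->
  X s @[s --> F] --> A -> (s - ts)^-1 *: (X s - A) @[s --> F] --> Q A ->
  \forall s \near F, barrier_set (X s).
Proof.
move=> FF GA Fs FC XA XQ.
have K j : \forall s \near F, @orthogonal_rV R n `<=` (fun x => orthogonal_mx (vec_mx x) ->
    0 <= lam j (pullback (vec_mx x) (X s)) + m j).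
  apply: ((compact_near_coveringP _).1 (@compact_orthogonal_rV R n)) => x xO.
  have hx : z.1 @[z --> filter_prod (nbhs x) F] --> x by exact: cvg_fst.
  have hs : z.2 @[z --> filter_prod (nbhs x) F] --> F by exact: cvg_snd.
  have L (B : R -> tensor4 R n) B0 : B s @[s --> F] --> B0 ->
     lam j (pullback (vec_mx z.1) (B z.2)) @[z --> filter_prod (nbhs x) F] --> lam j (pullback (vec_mx x) B0).
    move=> BB; apply: (@cvg_linear_pullback _ _ _ _ _ _ (fun z => z.1) (fun z => B z.2) x B0 (lin j) hx).
    exact: (cvg_comp _ _ hs BB).
  have := GA.2 j _ xO; rewrite le_eqVlt => /predU1P[e|pos].
    have Q0 : 0 < lam j (pullback (vec_mx x) (Q A)).
      by rewrite -pullbackQ //; apply: boundary; [exact: barrier_set_pullback|].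
    have N1 : \forall z \near filter_prod (nbhs x) F,
        0 < lam j (pullback (vec_mx z.1) ((z.2 - ts)^-1 *: (X z.2 - A))).
      by apply: (cvgr_gt _ (L _ _ XQ)).
    have N2 : \forall z \near filter_prod (nbhs x) F, ts < z.2 by exact: (hs _ Fs).
    near=> z => zO.
    have zs : 0 < z.2 - ts by rewrite subr_gt0; near: z.
    have zQ : 0 < lam j (pullback (vec_mx z.1) ((z.2 - ts)^-1 *: (X z.2 - A))) by near: z.
    have E : X z.2 = (z.2 - ts) *: ((z.2 - ts)^-1 *: (X z.2 - A)) + A.
      by rewrite scalerA divff ?gt_eqF // scale1r subrK.
    (* At nearby matrices [z.1] the constraint need not be active; its value at A is still
       nonnegative, and the increment is positive. *)
    rewrite E pullbackD pullbackZ lin -addrA addr_ge0 //; last exact: GA.2.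
    by rewrite mulr_ge0 // ltW.
  have N1 : \forall z \near filter_prod (nbhs x) F,
      - m j < lam j (pullback (vec_mx z.1) (X z.2)).
    by apply: (cvgr_gt _ (L _ _ XA)); rewrite -subr_gt0 opprK.
  near=> z => _; rewrite -lerBlDr sub0r ltW //; near: z; exact: N1.
have KJ : \forall s \near F, forall j, @orthogonal_rV R n `<=` (fun x => orthogonal_mx (vec_mx x) ->
    0 <= lam j (pullback (vec_mx x) (X s)) + m j).
  exact: filter_forall.
near=> s; split; first by near: s.
move=> j g gO; have := near KJ s => /(_ _ j (mxvec g)); rewrite /orthogonal_rV /= mxvecK.
by apply=> //; near: s.
Unshelve. all: by end_near.
Qed.

(** [ts] is the infimum of the times spent outside. Closedness places X(ts) in the set, and
    [barrier_step] keeps the solution there a little longer, against the choice of [ts]. *)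
Lemma barrier_set_invariant (I : set R) (X : R -> tensor4 R n) : is_interval I -> Hamilton_solution I X ->
  forall t0 t, I t0 -> I t -> t0 <= t -> barrier_set (X t0) -> barrier_set (X t).
Proof.
move=> Iint sol t0 t It0 It t0t G0; have [//|nG] := pselect (barrier_set (X t)).
exfalso.
have Iin s : t0 <= s <= t -> I s by exact: Iint.
pose E := [set s | t0 <= s <= t /\ ~ barrier_set (X s)].
have E0 : E !=set0 by exists t; rewrite /E /= t0t lexx.
have El : lbound E t0 by move=> s [/andP[]].
have hE : has_inf E by split => //; exists t0.
set ts := inf E.
have t0ts : t0 <= ts by exact: lb_le_inf.
have tst : ts <= t by apply: ge_inf; [exists t0|rewrite /E /= t0t lexx].
have before s : t0 <= s -> s < ts -> barrier_set (X s).
  move=> t0s sts; have st := le_trans (ltW sts) tst.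
  apply: contrapT => nGs; move: sts; rewrite ltNge => /negP; apply.
  by apply: ge_inf; [exists t0|split=> //; rewrite t0s st].
have Its : I ts by apply: Iin; rewrite t0ts tst.
have [cts dts] := sol ts Its.
(* One-sided filters inherit the derivative; continuity follows on writing X(s) as X(ts) plus (s -
   ts) times the difference quotient. *)
have cX (F : set_system R) : Filter F -> F `=>` within I ts^' -> F --> ts -> 
    [/\ (s - ts)^-1 *: (X s - X ts) @[s --> F] --> Q (X ts) & X s @[s --> F] --> X ts].
  move=> FF FI Fts; have h : (s - ts)^-1 *: (X s - X ts) @[s --> F] --> Q (X ts).
    by apply: cvg_trans dts; exact: cvg_app.
  split=> //.
  have h2 : (fun s => (s - ts) *: ((s - ts)^-1 *: (X s - X ts)) + X ts) @ F --> 0 *: Q (X ts) + X ts.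
    apply: cvgD; last exact: cvg_cst.
    apply: cvgZ => //; rewrite -(subrr ts); apply: cvgB => //; exact: cvg_cst.
  have E' : (fun s => (s - ts) *: ((s - ts)^-1 *: (X s - X ts)) + X ts) = X.
    apply/funext => s; have [->|ne] := eqVneq s ts; first by rewrite subrr scale0r add0r.
    by rewrite scalerA divff ?subr_eq0 // scale1r subrK.
  by rewrite E' scale0r add0r in h2.
have Gts : barrier_set (X ts).
  have [<-//|ne] := eqVneq t0 ts.
  have t0lt : t0 < ts by rewrite lt_neqAle ne.
  have [_ Xl] : [/\ (s - ts)^-1 *: (X s - X ts) @[s --> ts^'-] --> Q (X ts) & X s @[s --> ts^'-] --> X ts].
    apply: cX; last exact: cvg_at_left_filter.
    move=> P PI; have PI' : nbhs ts [set s | s != ts -> I s -> P s] by exact: PI.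
    near=> s.
    have : s != ts -> I s -> P s by near: s; apply: cvg_within; exact: PI'.
    apply; first by rewrite lt_eqF.
    apply: Iin; apply/andP; split; first by near: s; exact: nbhs_left_ge.
    by apply: le_trans tst; near: s; exact: nbhs_left_le.
  apply: (@closed_cvg _ _ _ _ X _ closed_barrier_set _ _ Xl); near=> s; apply: before => //.
  by near: s; exact: nbhs_left_ge.
have tslt : ts < t.
  rewrite lt_neqAle tst andbT; apply/eqP => e; apply: nG; by rewrite -e.
have [Xd Xr] : [/\ (s - ts)^-1 *: (X s - X ts) @[s --> ts^'+] --> Q (X ts) & X s @[s --> ts^'+] --> X ts].
  apply: cX; last exact: cvg_at_right_filter.
  move=> P PI; have PI' : nbhs ts [set s | s != ts -> I s -> P s] by exact: PI.
    near=> s.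
  have : s != ts -> I s -> P s by near: s; apply: cvg_within; exact: PI'.
  apply; first by rewrite gt_eqF.
  apply: Iin; apply/andP; split; first by apply: le_trans t0ts _; near: s; exact: nbhs_right_ge.
  by near: s; exact: nbhs_right_le.
have : \forall s \near ts^'+, barrier_set (X s).
  apply: (@barrier_step (X ts) ts) => //; near=> s => //.
  have [] := sol s _ => //; apply: Iin; apply/andP; split.
    by apply: le_trans t0ts _; near: s; exact: nbhs_right_ge.
  by near: s; exact: nbhs_right_le.
rewrite /at_right /within /= => /nbhs_ballP[e e0 he].
have [s Es se] := inf_adherent e0 hE.
have tss : ts <= s by apply: ge_inf => //; exists t0.
case: Es => _; apply; move: tss; rewrite le_eqVlt => /predU1P[<-//|tss].
by apply: he => //; rewrite /ball /= ltr0_norm ?subr_lt0 // opprB ltrBlDl.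
Unshelve. all: by end_near.
Qed.

End Barrier.

(** * The pinching set *)

Section BasisForms.
Variables (R : realType) (n : nat).

Lemma qform_ev (M : 'M[R]_n) i j : qform M (ev i) (ev j) = M i j.
Proof.
rewrite /qform; under eq_bigr do under eq_bigr do rewrite !evE.
by under eq_bigr do rewrite sum_delta; rewrite sum_delta.
Qed.

Lemma Ric_formE (A : tensor4 R n) u v : Ric_form A u v = qform (Ric A) u v.
Proof. by []. Qed.

Lemma orthonormal_frame2P (u v : 'rV[R]_n) :
  dot u u = 1 -> dot v v = 1 -> dot u v = 0 -> orthonormal_frame [:: u; v].
Proof.
move=> uu vv uv [|[|//]] [|[|//]] _ _ //=; by rewrite ?uu ?vv ?uv // dotC uv.
Qed.

Lemma tcompN (A : tensor4 R n) i j k l : tcomp (- A) i j k l = - tcomp A i j k l.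
Proof. by rewrite -scaleN1r tcompZ mulN1r. Qed.

Lemma pullbackN g (A : tensor4 R n) : pullback g (- A) = - pullback g A.
Proof. by rewrite -scaleN1r pullbackZ scaleN1r. Qed.

(** The Jacobi operator of the j-th basis vector. Rotating one vector of a plane with the other
    fixed turns the sectional curvature into this quadratic form. *)
Definition jacobi (A : tensor4 R n) (j : 'I_n) : 'M[R]_n := \matrix_(p, q) tcomp A p j q j.

Lemma jacobiE (A : tensor4 R n) j u v : tform A u (ev j) v (ev j) = qform (jacobi A j) u v.
Proof.
rewrite /tform /qform; apply: eq_bigr => p _; rewrite exchange_big /=; apply: eq_bigr => q _.
transitivity (\sum_a tcomp A p a q j * u 0 p * v 0 q * (a == j)%:R).
  apply: eq_bigr => a _; under eq_bigr do rewrite !evE; rewrite sum_delta; ring.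
by rewrite sum_delta mxE.
Qed.

End BasisForms.

Section PinchingSet.
Variables (R : realType) (n : nat) (b del gam th N kap c1 : R) (o1 o2 o3 o4 : 'I_n).

Definition ric_shift (A : tensor4 R n) : tensor4 R n :=
  A - b *: KN (Ric A) 1%:M + (gam * scal A) *: KN 1%:M 1%:M.

(** [None], [Some true] and [Some false] are the conditions (1), (2) and (3), at one fixed frame;
    the pullbacks in [barrier_set] supply the others. *)
Definition pinching_functional (j : option bool) (A : tensor4 R n) : R :=
  match j with
  | None => picc (ric_shift A) o1 o2 o3 o4
  | Some true => (1 + kap) * Ric A o1 o1 + (1 - kap) * Ric A o2 o2
      - 2 * tcomp A o1 o2 o1 o2 + kap * c1 * scal A
  | Some false => Ric A o1 o1 + Ric A o2 o2 - 2 * th * scal A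
  end.

(** 8 is the isotropic curvature of id (.) id, so the first offset amounts to subtracting [del]
    times that tensor. *)
Definition pinching_offset (j : option bool) : R :=
  match j with None => - (8 * del) | Some true => 0 | Some false => N end.

Definition pinching_set := barrier_set pinching_functional pinching_offset.

Definition shifted (A : tensor4 R n) := ric_shift A - del *: KN 1%:M 1%:M.

Lemma linear_ric_shift x A B : ric_shift (x *: A + B) = x *: ric_shift A + ric_shift B.
Proof.
apply: tcomp_inj => i j k l; rewrite /ric_shift RicD RicZ scalD scalZ.
rewrite !(tcompD, tcompN, tcompZ) !KNE; move: (Ric A) (Ric B) => X Y; rewrite !mxE; ring.
Qed.

Lemma linear_pinching_functional j : linear_functional (pinching_functional j).
Proof.
move=> x A B; case: j => [[]|] /=.
- by rewrite RicD RicZ scalD scalZ tcompD tcompZ; move: (Ric A) (Ric B) => X Y; rewrite !mxE; ring.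
- by rewrite RicD RicZ scalD scalZ; move: (Ric A) (Ric B) => X Y; rewrite !mxE; ring.
- by rewrite linear_ric_shift; move: (ric_shift A) (ric_shift B) => X Y; rewrite /picc !tcompD !tcompZ; ring.
Qed.

Lemma ric_shift_pullback g A : orthogonal_mx g ->
  ric_shift (pullback g A) = pullback g (ric_shift A).
Proof.
move=> gO; rewrite /ric_shift Ric_pullback // scal_pullback //.
by rewrite !(pullbackD, pullbackN, pullbackZ) !pullback_KN !mulmx1 gO.
Qed.

Lemma shifted_pullback g A : orthogonal_mx g -> shifted (pullback g A) = pullback g (shifted A).
Proof.
move=> gO; rewrite /shifted ric_shift_pullback //; move: (ric_shift A) => B.
by rewrite !(pullbackD, pullbackN, pullbackZ) !pullback_KN !mulmx1 gO.
Qed.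

Lemma shiftedE A : A = shifted A + KN (b *: Ric A + (del - gam * scal A) *: 1%:M) 1%:M.
Proof.
apply: tcomp_inj => i j k l; rewrite /shifted /ric_shift.
rewrite !(tcompD, tcompN, tcompZ) !KNE.
by move: (Ric A) => M; rewrite !mxE; ring.
Qed.

Hypotheses (v1 : o1 = 0%N :> nat) (v2 : o2 = 1%N :> nat) (v3 : o3 = 2%N :> nat) (v4 : o4 = 3%N :> nat).

Lemma standard_uniq : uniq [:: o1; o2; o3; o4].
Proof. by rewrite /= !inE -!val_eqE /= v1 v2 v3 v4. Qed.

Lemma standard_ge4 : (4 <= n)%N.
Proof. by have := ltn_ord o4; rewrite v4. Qed.

Lemma picc_shifted A : picc (shifted A) o1 o2 o3 o4 = pinching_functional None A - 8 * del.
Proof.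
rewrite /= -[8](picc_id R standard_uniq) /shifted; move: (ric_shift A) (KN _ _) => X Y.
by rewrite /picc !(tcompD, tcompN, tcompZ); ring.
Qed.

Lemma curv_ric_shift A : curvature_tensor A -> curvature_tensor (ric_shift A).
Proof.
move=> cA; apply: curvD; last by apply: curvZ; apply: curv_KN; rewrite trmx1.
by apply: curvB => //; apply: curvZ; apply: curv_KN; [exact: Ric_sym|rewrite trmx1].
Qed.

Lemma curv_shifted A : curvature_tensor A -> curvature_tensor (shifted A).
Proof.
move=> cA; apply: curvB; first exact: curv_ric_shift.
by apply: curvZ; apply: curv_KN; rewrite trmx1.
Qed.

Lemma frame_pullback2 (u v : 'rV[R]_n) : orthonormal_frame [:: u; v] ->
  exists g, [/\ orthogonal_mx g, row o1 g = u & row o2 g = v].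
Proof.
move=> uv; have [|g gO gr] := orthonormal_frame_extend _ uv.
  exact: leq_trans standard_ge4.
by exists g; split=> //; rewrite gr ?v1 ?v2.
Qed.

Section Members.
Variable A : tensor4 R n.
Hypothesis GA : pinching_set A.

Lemma pinching_curv : curvature_tensor A. Proof. by case: GA. Qed.

Lemma pinching_PIC : PIC (shifted A).
Proof.
split; first exact: curv_shifted pinching_curv.
move=> e1 e2 e3 e4 eO; have [|g gO gr] := orthonormal_frame_extend _ eO; first exact: standard_ge4.
have := GA.2 None g gO; rewrite -picc_shifted shifted_pullback // /picc !tcomp_pullback.
by rewrite !gr ?v1 ?v2 ?v3 ?v4.
Qed.

Lemma pinching_plane u v : orthonormal_frame [:: u; v] ->
  0 <= (1 + kap) * qform (Ric A) u u + (1 - kap) * qform (Ric A) v v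
    - 2 * tform A u v u v + kap * c1 * scal A.
Proof.
move=> /frame_pullback2[g [gO <- <-]]; rewrite !qform_row -Ric_pullback // -tcomp_pullback.
by rewrite -[scal A](scal_pullback A gO); have := GA.2 (Some true) g gO; rewrite /= addr0.
Qed.

Lemma pinching_low_eigenvalues u v : orthonormal_frame [:: u; v] ->
  0 <= qform (Ric A) u u + qform (Ric A) v v - 2 * th * scal A + N.
Proof.
move=> /frame_pullback2[g [gO <- <-]]; rewrite !qform_row -Ric_pullback //.
by rewrite -[scal A](scal_pullback A gO); have := GA.2 (Some false) g gO.
Qed.

End Members.

End PinchingSet.

Section RotationForms.
Variables (R : realType) (n : nat).

Lemma tformZ1 (A : tensor4 R n) c u v w z : tform A (c *: u) v w z = c * tform A u v w z.
Proof. rewrite /tform; do 4![rewrite mulr_sumr; apply: eq_bigr => ? _]; rewrite mxE; ring. Qed.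

Lemma tformZ2 (A : tensor4 R n) c u v w z : tform A u (c *: v) w z = c * tform A u v w z.
Proof. rewrite /tform; do 4![rewrite mulr_sumr; apply: eq_bigr => ? _]; rewrite mxE; ring. Qed.

Lemma tformZ3 (A : tensor4 R n) c u v w z : tform A u v (c *: w) z = c * tform A u v w z.
Proof. rewrite /tform; do 4![rewrite mulr_sumr; apply: eq_bigr => ? _]; rewrite mxE; ring. Qed.

Lemma tformZ4 (A : tensor4 R n) c u v w z : tform A u v w (c *: z) = c * tform A u v w z.
Proof. rewrite /tform; do 4![rewrite mulr_sumr; apply: eq_bigr => ? _]; rewrite mxE; ring. Qed.

Lemma tform_rotation (A : tensor4 R n) x y c s : curvature_tensor A ->
  tform A (c *: x + s *: y) ((- s) *: x + c *: y) (c *: x + s *: y) ((- s) *: x + c *: y) =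
  (c ^+ 2 + s ^+ 2) ^+ 2 * tform A x y x y.
Proof.
move=> cA; rewrite !(tform_lin1, tform_lin2, tform_lin3, tform_lin4, tformZ1, tformZ2, tformZ3, tformZ4).
have z1 u w z : tform A u u w z = 0 by have := tform_anti u u w z cA; lra.
have z2 u w z : tform A w z u u = 0 by rewrite tform_sym // z1.
rewrite !(z1, z2) (tform_anti y x x y) // (tform_anti y x y x) // (tform_antir x y y x) //.
ring.
Qed.

Lemma qform_rotation (M : 'M[R]_n) x y c s : M^T = M ->
  qform M (c *: x + s *: y) (c *: x + s *: y) =
  c ^+ 2 * qform M x x + 2 * c * s * qform M x y + s ^+ 2 * qform M y y.
Proof.
by move=> Ms; rewrite !(qform_linl, qform_linr, qformZl, qformZr) (qform_sym y x Ms); ring.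
Qed.

Lemma qform_addM (M N : 'M[R]_n) u v : qform (M + N) u v = qform M u v + qform N u v.
Proof.
rewrite /qform; do 2![rewrite -big_split; apply: eq_bigr => ? _ /=].
by rewrite mxE; ring.
Qed.

Lemma jacobi_sym (A : tensor4 R n) j : curvature_tensor A -> (jacobi A j)^T = jacobi A j.
Proof. by move=> cA; apply/matrixP => p q; rewrite !mxE curv_sym. Qed.

Lemma jacobi_pullback (A : tensor4 R n) g j p q : curvature_tensor A -> row j g = ev j ->
  tcomp (pullback g A) j p j q = (g *m jacobi A j *m g^T) p q.
Proof.
by move=> cA gj; rewrite tcomp_pullback gj -qform_row -jacobiE tform_anti // tform_antir // opprK.
Qed.

Lemma rotation_dot (x y : 'rV[R]_n) c s : dot x x = 1 -> dot y y = 1 -> dot x y = 0 ->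
  dot (c *: x + s *: y) (c *: x + s *: y) = c ^+ 2 + s ^+ 2.
Proof.
by move=> xx yy xy; rewrite !(dotDl, dotDr, dotZl, dotZr) (dotC y x) xx yy xy; ring.
Qed.

End RotationForms.

(** Nonnegativity of the four-trace tau' gives tau at least 3.9 b s up to lower order; then 2 b tau
    exceeds 7.8 b^2 s, whereas 8 gam s is at most 4.4 b^2 s. *)
Lemma pinching_margin_arith (R : realFieldType) (n b del gam sg tau tau' c : R) :
  5 <= n -> 0 < b -> 0 < del -> 0 <= sg -> 1000 * n ^+ 2 * b <= 1 ->
  gam = (1 / 2 + 1 / (4 * n)) * b ^+ 2 -> c = del - gam * sg ->
  tau' = (1 - (n - 2) * b) * tau - 4 * (b * sg) - 8 * (n - 1) * c -> 0 <= tau' ->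
  b ^+ 2 * sg <= 2 * (b * tau) + 8 * c.
Proof.
move=> n5 b0 d0 s0 h1 gE -> tE t0.
have [i0 i5] := inv_small n5.
have nb := small_nb n5 h1; have ngam := small_ngam n5 b0 h1 gE; have [g0 _] := gam_bounds n5 gE.
have n0 : 0 < n by exact: lt_le_trans n5.
have u0 : 0 <= b * sg by rewrite mulr_ge0 // ltW.
have gs0 : 0 <= gam * sg by rewrite mulr_ge0.
have ngs : 1000 * ((n - 1) * (gam * sg)) <= b * sg.
  have h := ler_wpM2r s0 ngam; have h' := ler_wpM2r u0 i5.
  by move: h h' gs0 u0; clear; lra.
have n1 : 0 <= (n - 1) * del by rewrite mulr_ge0 ?(ltW d0) // subr_ge0; move: n5; clear; lra.
have kt : 39 / 10 * (b * sg) <= (1 - (n - 2) * b) * tau.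
  by move: tE t0 n1 ngs u0; clear; lra.
have k1 : 0 < 1 - (n - 2) * b by move: nb i5 b0; clear; lra.
have tau0 : 0 <= tau by rewrite -(pmulr_rge0 _ k1); apply: le_trans kt; rewrite mulr_ge0.
have n2 : 0 <= (n - 2) * b * tau.
  by rewrite mulr_ge0 // mulr_ge0 ?(ltW b0) // subr_ge0; move: n5; clear; lra.
have bt : b * (39 / 10 * (b * sg)) <= b * tau.
  by rewrite ler_pM2l //; move: kt n2; clear; lra.
have gb : gam <= 55 / 100 * b ^+ 2.
  have e : 1 / (4 * n) = (1 / n) / 4 by field; rewrite gt_eqF.
  by rewrite gE e; apply: ler_wpM2r; [exact: sqr_ge0|move: i5; clear; lra].
have := ler_wpM2r s0 gb; have := mulr_ge0 (sqr_ge0 b) s0.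
by move: bt d0; rewrite !expr2; clear; lra.
Qed.

(** The hypothesis says that the shifted tensor has nonnegative scalar curvature. For s <= 0 all its
    terms would be nonpositive and the one with [del] negative. *)
Lemma shift_scal_gt0_arith (R : realFieldType) (n b del gam sg : R) :
  5 <= n -> 0 < del -> 0 <= gam -> 1000 * n ^+ 2 * b <= 1 ->
  0 <= (1 - 2 * (n - 1) * b) * sg - 2 * n * (n - 1) * (del - gam * sg) -> 0 < sg.
Proof.
move=> n5 d0 g0 h1 h; have [i0 i5] := inv_small n5; have nb := small_nb n5 h1.
have n0 : 0 < n by exact: lt_le_trans n5.
rewrite ltNge; apply/negP => s0; move: h; apply/negP; rewrite -ltNge.
have nn : 0 < n * (n - 1) by rewrite mulr_gt0 // subr_gt0; move: n5; clear; lra.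
have a1 := mulr_gt0 nn d0.
have a2 := mulr_ge0 (ltW nn) (mulr_ge0 g0 (_ : 0 <= - sg)).
have {}a2 := a2 ltac:(by rewrite oppr_ge0).
have b1 : 0 <= 1 - 2 * (n - 1) * b.
  have [bp|bn] := ltP 0 b; first by move: nb i5 bp; clear; lra.
  have := mulr_ge0 (_ : 0 <= n - 1) (_ : 0 <= - b); rewrite oppr_ge0 bn subr_ge0 => /(_ _ isT) h.
  have {}h := h ltac:(by apply: le_trans n5; clear; lra).
  by move: h; clear; lra.
have := mulr_ge0 b1 (_ : 0 <= - sg); rewrite oppr_ge0 s0 => /(_ isT) a3.
by move: a1 a2 a3; clear; lra.
Qed.

(** * Positivity of the derivative for each of the three conditions *)

Section BoundaryDerivative.
Variables (R : realType) (n : nat) (b del gam th N kap : R) (o1 o2 o3 o4 : 'I_n).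
Hypotheses (v1 : o1 = 0%N :> nat) (v2 : o2 = 1%N :> nat) (v3 : o3 = 2%N :> nat) (v4 : o4 = 3%N :> nat).
Local Notation c1 := (1 / (16 * n%:R)).
Local Notation functional := (pinching_functional b gam th kap c1 o1 o2 o3 o4).
Local Notation offset := (pinching_offset del N).
Local Notation G := (pinching_set b del gam th N kap c1 o1 o2 o3 o4).
Local Notation shifted := (shifted b del gam).
Hypotheses (n5 : (5 <= n)%N) (b_gt0 : 0 < b) (del_gt0 : 0 < del) (N_gt0 : 0 < N)
  (kap_gt0 : 0 < kap) (kap_le : kap <= 1 / 3) (kap_small : 500 * n%:R ^+ 6 * kap <= c1 ^+ 2).
Hypotheses (b_small : 1000 * n%:R ^+ 2 * b <= 1) (bN_small : 1000 * (n%:R * (b * N)) <= del)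
  (b_kap : 1000 * n%:R ^+ 2 * b <= kap ^+ 2) (bN2_small : b * N ^+ 2 <= del ^+ 2)
  (N_large : 64 * (n%:R * del) <= N).
Hypotheses (gamE : gam = (1 / 2 + 1 / (4 * n%:R)) * b ^+ 2) (thE : th = (1 - 1 / (16 * n%:R)) * b).

Let n5R : 5 <= n%:R :> R. Proof. by rewrite ler_nat. Qed.
Let u4 : uniq [:: o1; o2; o3; o4]. Proof. exact: standard_uniq. Qed.
Let o12 : o1 != o2. Proof. by rewrite -val_eqE /= v1 v2. Qed.

Let off_ge2 p : p \in off_plane o1 o2 -> (2 <= p)%N.
Proof. by rewrite inE -!val_eqE /= v1 v2; case: (p : nat) => [|[|]]. Qed.

Lemma pinching_scal_gt0 A : G A -> 0 < scal A.
Proof.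
move=> GA; have pS := pinching_PIC v1 v2 v3 v4 GA.
have [g0 _] := gam_bounds n5R gamE.
apply: (@shift_scal_gt0_arith _ n%:R b del gam) => //.
by rewrite -(scal_shift (shiftedE b del gam A)) PIC_scal_ge0.
Qed.

Lemma pinching_picc A : G A -> b ^+ 2 * scal A <= picc A o1 o2 o3 o4.
Proof.
move=> GA; have pS := pinching_PIC v1 v2 v3 v4 GA; have s0 := ltW (pinching_scal_gt0 GA).
have AE := shiftedE b del gam A.
have RE p : Ric (shifted A) p p = (1 - (n%:R - 2) * b) * Ric A p p
    - (b * scal A + 2 * (n%:R - 1) * (del - gam * scal A)).
  by rewrite (Ric_shift AE) eqxx mulr1.
have PE : picc A o1 o2 o3 o4 = picc (shifted A) o1 o2 o3 o4
    + 2 * (b * (Ric A o1 o1 + Ric A o2 o2 + Ric A o3 o3 + Ric A o4 o4)) + 8 * (del - gam * scal A).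
  have KE := picc_KN1 u4 (b *: Ric A + (del - gam * scal A) *: 1%:M).
  have E : picc A o1 o2 o3 o4 = picc (shifted A) o1 o2 o3 o4
      + picc (KN (b *: Ric A + (del - gam * scal A) *: 1%:M) 1%:M) o1 o2 o3 o4.
    have add (X Y : tensor4 R n) : picc (X + Y) o1 o2 o3 o4 = picc X o1 o2 o3 o4 + picc Y o1 o2 o3 o4.
      by rewrite /picc !tcompD; ring.
    by rewrite {1}AE add.
  rewrite E KE; move: (Ric A) => M; rewrite !mxE !eqxx /= !mulr1n; ring.
have P0 := PIC_picc_ge0 pS u4; have t0 := PIC_Ric4_ge0 n5 pS u4.
rewrite !RE in t0.
have := @pinching_margin_arith _ n%:R b del gam (scal A)
  (Ric A o1 o1 + Ric A o2 o2 + Ric A o3 o3 + Ric A o4 o4) _ _ n5R b_gt0 del_gt0 s0 b_small gamE erefl erefl.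
set X := (X in 0 <= X -> _) => H; have X0 : 0 <= X by move: t0; rewrite /X; lra.
by rewrite PE; move: (H X0) P0; lra.
Qed.

Lemma pinching_set_pullback g A : orthogonal_mx g -> G A -> G (pullback g A).
Proof. exact: barrier_set_pullback. Qed.

Lemma pinching_PIC_margin A e1 e2 e3 e4 : G A -> orthonormal_frame [:: e1; e2; e3; e4] ->
  b ^+ 2 * scal A <= tform A e1 e3 e1 e3 + tform A e1 e4 e1 e4
         + tform A e2 e3 e2 e3 + tform A e2 e4 e2 e4 - 2 * tform A e1 e2 e3 e4.
Proof.
move=> GA eO; have [|g gO gr] := orthonormal_frame_extend _ eO; first exact: standard_ge4 v4.
have := pinching_picc (pinching_set_pullback gO GA); rewrite scal_pullback // /picc !tcomp_pullback.
by rewrite !gr ?v1 ?v2 ?v3 ?v4.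
Qed.

Lemma pinching_PIC_self A : G A -> PIC A.
Proof.
move=> GA; split; first by case: GA.
move=> e1 e2 e3 e4 eO; apply: le_trans (pinching_PIC_margin GA eO).
by rewrite mulr_ge0 ?sqr_ge0 // ltW // pinching_scal_gt0.
Qed.

(** Conditions (2) and (3) see only the plane of the first two vectors, so the basis of its
    complement is free for diagonalisation. *)
Lemma functional_fixing j g A : j != None -> orthogonal_mx g -> row o1 g = ev o1 -> row o2 g = ev o2 ->
  functional j (pullback g A) = functional j A.
Proof.
move=> jN gO g1 g2; have E i : row i g = ev i -> Ric (pullback g A) i i = Ric A i i.
  by move=> gi; rewrite Ric_pullback // -qform_row gi qform_ev.
by case: j jN => // -[] _ /=; rewrite !E // scal_pullback // tcomp_pullback g1 g2 tform_ev.
Qed.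

Let ev_frame p q : p != q -> orthonormal_frame [:: ev p; ev q : 'rV[R]_n].
Proof. by move=> pq; apply: (@orthonormal_frame_ev R n [:: p; q]); rewrite /= inE pq. Qed.

Let rotated_frame p q r c s : uniq [:: p; q; r] -> c ^+ 2 + s ^+ 2 = 1 ->
  orthonormal_frame [:: c *: ev p + s *: ev q; ev r : 'rV[R]_n] /\
  orthonormal_frame [:: ev r; c *: ev p + s *: ev q : 'rV[R]_n].
Proof.
move=> u cs; have [pq pr qr] : [/\ p != q, p != r & q != r].
  by move: u; rewrite /= !inE negb_or => /andP[/andP[-> ->] /andP[-> _]].
have D : dot (c *: ev p + s *: ev q) (c *: ev p + s *: ev q : 'rV[R]_n) = 1.
  by rewrite rotation_dot ?dot_ev ?eqxx ?(negPf pq).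
have E : dot (c *: ev p + s *: ev q) (ev r : 'rV[R]_n) = 0.
  by rewrite dotDl !dotZl !dot_ev (negPf pr) (negPf qr) !mulr0 addr0.
by split; apply: orthonormal_frame2P; rewrite ?D ?dot_ev ?eqxx // dotC.
Qed.

(** One vector of the plane is rotated towards q while the other stays fixed; at a boundary point
    the functional is minimal along this circle. *)
Lemma plane_first_variation A : G A -> functional (Some true) A = 0 ->
  (forall q, q \in off_plane o1 o2 -> (1 + kap) * Ric A o1 q = 2 * tcomp A o1 o2 q o2) /\
  (forall q, q \in off_plane o1 o2 -> (1 - kap) * Ric A o2 q = 2 * tcomp A o2 o1 q o1).
Proof.
move=> GA; rewrite /= => h0; have cA := pinching_curv GA; have rs := Ric_sym cA.
have F u v := pinching_plane v1 v2 v4 GA (u := u) (v := v).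
split=> q qJ; move: (qJ); rewrite inE => /andP[q1 q2]; apply/subr0_eq.
  apply: (@rotation_minimum _ ((1 + kap) * (Ric A q q - Ric A o1 o1)
    - 2 * (tcomp A q o2 q o2 - tcomp A o1 o2 o1 o2))) => c s cs.
  have uq : uniq [:: o1; q; o2] by rewrite /= !inE negb_or (eq_sym o1) q1 o12 q2.
  have := F _ _ (rotated_frame uq cs).1.
  rewrite jacobiE !qform_rotation ?jacobi_sym // !qform_ev ![jacobi _ _ _ _]mxE.
  by move: h0; have -> : c ^+ 2 = 1 - s ^+ 2 by [lra]; move: (Ric A) => M; lra.
apply: (@rotation_minimum _ ((1 - kap) * (Ric A q q - Ric A o2 o2)
    - 2 * (tcomp A q o1 q o1 - tcomp A o2 o1 o2 o1))) => c s cs.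
have uq : uniq [:: o2; q; o1] by rewrite /= !inE negb_or (eq_sym o2) q2 q1 (eq_sym o2) o12.
have := F _ _ (rotated_frame uq cs).2.
rewrite tform_anti // tform_antir // opprK.
rewrite jacobiE !qform_rotation ?jacobi_sym // !qform_ev ![jacobi _ _ _ _]mxE.
have e : tcomp A o2 o1 o2 o1 = tcomp A o1 o2 o1 o2 by rewrite curv_antil // curv_antir // opprK.
by move: h0; have -> : c ^+ 2 = 1 - s ^+ 2 by [lra]; rewrite e; move: (Ric A) => M; lra.
Qed.

Lemma low_eigenvalue_first_variation A : G A -> functional (Some false) A + N = 0 ->
  (forall q, q \in off_plane o1 o2 -> Ric A o1 q = 0) /\
  (forall q, q \in off_plane o1 o2 -> Ric A o2 q = 0).
Proof.
move=> GA; rewrite /= => h0; have cA := pinching_curv GA; have rs := Ric_sym cA.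
have F u v := pinching_low_eigenvalues v1 v2 v4 GA (u := u) (v := v).
split=> q qJ; move: (qJ); rewrite inE => /andP[q1 q2].
  apply: (@rotation_minimum _ (Ric A q q - Ric A o1 o1)) => c s cs.
  have uq : uniq [:: o1; q; o2] by rewrite /= !inE negb_or (eq_sym o1) q1 o12 q2.
  have := F _ _ (rotated_frame uq cs).1; rewrite !qform_rotation // !qform_ev.
  by move: h0; have -> : c ^+ 2 = 1 - s ^+ 2 by [lra]; move: (Ric A) => M; lra.
apply: (@rotation_minimum _ (Ric A q q - Ric A o2 o2)) => c s cs.
have uq : uniq [:: o2; q; o1] by rewrite /= !inE negb_or (eq_sym o2) q2 q1 (eq_sym o2) o12.
have := F _ _ (rotated_frame uq cs).2; rewrite !qform_rotation // !qform_ev.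
by move: h0; have -> : c ^+ 2 = 1 - s ^+ 2 by [lra]; move: (Ric A) => M; lra.
Qed.

(** The forms in question add up to a sum of two Jacobi operators. It is used with [A] for condition
    (2) and with [shifted A] for (3), in each case the PIC tensor to which the estimates apply. *)
Lemma diagonalise_off_plane (B : tensor4 R n) : curvature_tensor B ->
  exists g : 'M[R]_n, [/\ orthogonal_mx g, row o1 g = ev o1, row o2 g = ev o2 &
    forall p q, p \in off_plane o1 o2 -> q \in off_plane o1 o2 -> p != q ->
      tcomp (pullback g B) o1 p o1 q + tcomp (pullback g B) o2 p o2 q = 0].
Proof.
move=> cB; have Ms : (jacobi B o1 + jacobi B o2)^T = jacobi B o1 + jacobi B o2.
  by rewrite linearD /= !jacobi_sym.
have [g [gO g2 gd]] := spectral_fixing 2 Ms.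
have g1 : row o1 g = ev o1 by apply: g2; rewrite v1.
have {}g2 : row o2 g = ev o2 by apply: g2; rewrite v2.
exists g; split=> // p q /off_ge2 p2 /off_ge2 q2 pq.
by have := gd p q p2 q2 pq; rewrite !jacobi_pullback // -!qform_row qform_addM.
Qed.

Lemma plane_boundary A : G A -> functional (Some true) A = 0 -> 0 < functional (Some true) (Q A).
Proof.
move=> GA h0; have [g [gO g1 g2 gd]] := diagonalise_off_plane (pinching_curv GA).
rewrite -(@functional_fixing _ g) // -pullbackQ //.
have {}h0 : functional (Some true) (pullback g A) = 0 by rewrite functional_fixing.
have {}GA := pinching_set_pullback gO GA; move: (pullback g A) GA h0 gd => B GB h0 gd.
have cB := pinching_curv GB; have [f1 f2] := plane_first_variation GB h0.
have c0 : (0 : R) < c1 by rewrite divr_gt0 // mulr_gt0 // ltr0n (leq_trans _ n5).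
have cl : c1 <= (1 : R).
  by rewrite ler_pdivrMr ?mul1r ?mulr_gt0 // ?ltr0n ?(leq_trans _ n5) //; have := n5R; lra.
have := @plane_derivative_gt0 R n B o1 o2 kap c1 n5 (pinching_PIC_self GB) o12 kap_gt0 kap_le c0 cl
  kap_small gd f1 f2 h0 (pinching_scal_gt0 GB).
rewrite /= Ric_Q // scal_Q //; move: (star B (Ric B)) => S; rewrite !mxE; set X := tcomp _ _ _ _ _.
set f := frobenius _ _; lra.
Qed.

Lemma low_eigenvalue_gap A : G A -> forall bb,
  kap * bb = Ric A o1 o1 + Ric A o2 o2 - 2 * tcomp A o1 o2 o1 o2 + kap * c1 * scal A ->
  `|Ric A o1 o1 - Ric A o2 o2| <= bb /\ `|2 * Ric A o1 o2| <= bb.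
Proof.
move=> GA bb bbE; have cA := pinching_curv GA; have rs := Ric_sym cA.
have F u v := pinching_plane v1 v2 v4 GA (u := u) (v := v).
have kb x : 0 <= bb * kap + x * kap -> - x <= bb.
  by rewrite -mulrDl pmulr_lge0 // => h; rewrite lerNl -subr_ge0 opprK addrC.
have e : tcomp A o2 o1 o2 o1 = tcomp A o1 o2 o1 o2 by rewrite curv_antil // curv_antir // opprK.
split; rewrite ler_norml lerNl.
  have f1 := F _ _ (ev_frame o12); have o21 : o2 != o1 by rewrite eq_sym.
  have f2 := F _ _ (ev_frame o21).
  rewrite !qform_ev !tform_ev in f1 f2; rewrite e in f2.
  by rewrite -[X in _ && (X <= _)]opprK !kb //; move: (Ric A) f1 f2 bbE => M; lra.
pose a : R := Num.sqrt (1 / 2).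
have a2 : a ^+ 2 = 1 / 2 by rewrite sqr_sqrtr //; lra.
have aa : a ^+ 2 + a ^+ 2 = 1 by lra.
have aN : (- a) ^+ 2 = a ^+ 2 by rewrite sqrrN.
have xx p : dot (ev p : 'rV[R]_n) (ev p) = 1 by rewrite dot_ev eqxx.
have xy : dot (ev o1 : 'rV[R]_n) (ev o2) = 0 by rewrite dot_ev (negPf o12).
pose u : 'rV[R]_n := a *: ev o1 + a *: ev o2; pose v : 'rV[R]_n := (- a) *: ev o1 + a *: ev o2.
have uu : dot u u = 1 by rewrite rotation_dot.
have vv : dot v v = 1 by rewrite rotation_dot // aN.
have uv : dot u v = 0.
  by rewrite !(dotDl, dotDr, dotZl, dotZr) (dotC (ev o2)) !xx xy; ring.
have vu : dot v u = 0 by rewrite dotC.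
have f1 := F _ _ (orthonormal_frame2P uu vv uv).
have f2 := F _ _ (orthonormal_frame2P vv uu vu).
have t1 : tform A u v u v = tcomp A o1 o2 o1 o2 by rewrite tform_rotation // aa expr1n mul1r tform_ev.
have t2 : tform A v u v u = tcomp A o1 o2 o1 o2 by rewrite tform_anti // tform_antir // opprK.
rewrite t1 !qform_rotation // !qform_ev aN a2 in f1; rewrite t2 !qform_rotation // !qform_ev aN a2 in f2.
have e1 : 2 * a * a = 1 by rewrite -mulrA -expr2 a2; lra.
have e2 : 2 * - a * a = - 1 by rewrite mulrN mulNr e1.
rewrite e1 e2 in f1 f2.
by rewrite -[X in _ && (X <= _)]opprK !kb //; move: (Ric A) f1 f2 bbE => M; lra.
Qed.

Lemma low_eigenvalue_boundary A : G A -> functional (Some false) A + N = 0 ->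
  0 < functional (Some false) (Q A).
Proof.
move=> GA h0; have cS := curv_shifted b del gam (pinching_curv GA).
have [g [gO g1 g2 gd]] := diagonalise_off_plane cS.
rewrite -shifted_pullback // in gd.
rewrite -(@functional_fixing _ g) // -pullbackQ //.
have {}h0 : functional (Some false) (pullback g A) + N = 0 by rewrite functional_fixing.
have {}GA := pinching_set_pullback gO GA; move: (pullback g A) GA h0 gd => B GB h0 gd.
have cB := pinching_curv GB; have [f1 f2] := low_eigenvalue_first_variation GB h0.
have s0 := ltW (pinching_scal_gt0 GB); have pB := pinching_PIC_self GB.
pose bb := (Ric B o1 o1 + Ric B o2 o2 - 2 * tcomp B o1 o2 o1 o2 + kap * c1 * scal B) / kap.
have bbE : kap * bb = Ric B o1 o1 + Ric B o2 o2 - 2 * tcomp B o1 o2 o1 o2 + kap * c1 * scal B.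
  by rewrite /bb mulrC divfK // gt_eqF.
have [gp1 gp2] := low_eigenvalue_gap GB bbE.
have T0 : 0 <= Ric B o1 o1 + Ric B o2 o2 - 2 * sec B o1 o2.
  by rewrite -(plane_trace pB o12); exact: plane_trace_ge0.
have bN' : 1000 * (b * N) <= del.
  have h : b * N <= n%:R * (b * N).
    by rewrite ler_peMl ?mulr_ge0 ?(ltW b_gt0) ?(ltW N_gt0) // ler1n (leq_trans _ n5).
  by have h' := bN_small; move: h h'; set X := n%:R * _; set Y := b * N; lra.
have bd : Ric B o1 o1 + Ric B o2 o2 = 2 * th * scal B - N by move: h0; rewrite /=; lra.
have := @low_eigenvalue_derivative_gt0 R n B (shifted B) b del gam th N kap bb o1 o2 n5 cB
  (pinching_PIC v1 v2 v3 v4 GB) (shiftedE b del gam B) o12 b_gt0 del_gt0 N_gt0 kap_gt0 b_small bN'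
  b_kap N_large gamE thE gd f1 f2 bd bbE gp1 gp2 T0 s0.
rewrite /= Ric_Q // scal_Q //; move: (star B (Ric B)) => S; rewrite !mxE.
by set f := frobenius _ _; lra.
Qed.

Lemma low_eigenvalues_scaled A u v rho : G A -> dot u u = rho -> dot v v = rho -> dot u v = 0 ->
  (2 * th * scal A - N) * rho <= qform (Ric A) u u + qform (Ric A) v v.
Proof.
move=> GA uu vv uv; have [r0|r_neq0] := eqVneq rho 0.
  have -> : u = 0 by apply: dot_eq0; rewrite uu.
  have -> : v = 0 by apply: dot_eq0; rewrite vv.
  by rewrite -(scale0r (0 : 'rV[R]_n)) !qformZl !mul0r r0 mulr0 addr0.
have r0 : 0 < rho by rewrite lt_neqAle eq_sym r_neq0 -uu dot_ge0.
pose a := (Num.sqrt rho)^-1.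
have a2 : a * a = rho^-1 by rewrite -expr2 exprVn sqr_sqrtr // ltW.
have fr : orthonormal_frame [:: a *: u; a *: v].
  by apply: orthonormal_frame2P; rewrite !(dotZl, dotZr) ?uu ?vv ?uv ?mulr0 // mulrA a2 mulVf.
have := pinching_low_eigenvalues v1 v2 v4 GA fr; rewrite !(qformZl, qformZr) !mulrA a2 => h.
have := mulr_ge0 (ltW r0) h; move: (qform _ u u) (qform _ v v) (scal A) => x y s.
have -> : rho * (rho^-1 * x + rho^-1 * y - 2 * th * s + N) = x + y - (2 * th * s - N) * rho by field.
by rewrite subr_ge0.
Qed.

Lemma isotropic_functionalE A : functional None A =
  picc A o1 o2 o3 o4 - 2 * b * (Ric A o1 o1 + Ric A o2 o2 + Ric A o3 o3 + Ric A o4 o4)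
  + 8 * gam * scal A.
Proof.
rewrite /= /ric_shift -(picc_id R u4); have K := picc_KN1 u4 (Ric A).
have -> : 2 * b * (Ric A o1 o1 + Ric A o2 o2 + Ric A o3 o3 + Ric A o4 o4) =
  b * picc (KN (Ric A) 1%:M) o1 o2 o3 o4 by rewrite K; ring.
move: (KN (Ric A) 1%:M) (KN 1%:M 1%:M) {K} => X Y; rewrite /picc !(tcompD, tcompN, tcompZ); ring.
Qed.

Lemma isotropic_boundary A : G A -> functional None A - 8 * del = 0 -> 0 < functional None (Q A).
Proof.
move=> GA h0; have cA := pinching_curv GA; have pS := pinching_PIC v1 v2 v3 v4 GA.
have P0 : picc (shifted A) o1 o2 o3 o4 = 0 by rewrite (picc_shifted b del gam th kap c1 v1 v2 v3 v4).
have s0 := ltW (pinching_scal_gt0 GA).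
set m0 := 2 * th * scal A - N; set r := Ric A.
have rs : r^T = r by exact: Ric_sym.
have dE : m0 * (r o1 o1 + r o2 o2 + r o3 o3 + r o4 o4 - m0) <= picc (KN r r) o1 o2 o3 o4 / 2.
  rewrite isotropic_det // -/r.
  have H : (r o1 o3 + r o2 o4) ^+ 2 + (r o2 o3 - r o1 o4) ^+ 2 <=
      (r o1 o1 + r o2 o2 - m0) * (r o3 o3 + r o4 o4 - m0).
    apply: hermitian_det_ge0 => c s t.
    (* u + iv = c zeta + (s + it) eta is isotropic. Condition (3) on these vectors makes the
       Hermitian form of r minus [m0] times the metric nonnegative on the plane, so its determinant
       is nonnegative. *)
    pose u : 'rV[R]_n := c *: ev o1 + (s *: ev o3 + (- t) *: ev o4).
    pose v : 'rV[R]_n := c *: ev o2 + (t *: ev o3 + s *: ev o4).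
    have [n13 n14 n23 n24] : [/\ o1 == o3 = false, o1 == o4 = false, o2 == o3 = false & o2 == o4 = false].
      by rewrite -!val_eqE /= v1 v2 v3 v4.
    have n34 : o3 == o4 = false by rewrite -val_eqE /= v3 v4.
    have n12 := negPf o12.
    have D := (dotDl, dotDr, dotZl, dotZr, dot_ev, eqxx, eq_sym o2 o1, eq_sym o3 o1, eq_sym o3 o2,
      eq_sym o4 o1, eq_sym o4 o2, eq_sym o4 o3, n12, n13, n14, n23, n24, n34, mulr0, mulr1, addr0, add0r).
    have uu : dot u u = c ^+ 2 + s ^+ 2 + t ^+ 2 by rewrite /u !D; ring.
    have vv : dot v v = c ^+ 2 + s ^+ 2 + t ^+ 2 by rewrite /v !D; ring.
    have uv : dot u v = 0 by rewrite /u /v !D; ring.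
    have := low_eigenvalues_scaled GA uu vv uv; rewrite -/r -/m0 /u /v.
    rewrite !(qform_linl, qform_linr, qformZl, qformZr) !qform_ev.
    have rE p q : r p q = r q p by exact: Ric_symE.
    rewrite (rE o3 o1) (rE o4 o1) (rE o3 o2) (rE o4 o2) (rE o4 o3).
    by rewrite /r; move: (Ric A) => M; move: m0 => m; lra.
  move: H; set X := (r o1 o3 + _) ^+ 2; set Y := (r o2 o3 - _) ^+ 2.
  by clearbody X Y; move: r m0 {rs} => M m; lra.
have := isotropic_shift_derivative_gt0 n5 cA pS (shiftedE b del gam A) u4 b_gt0 del_gt0 N_gt0 s0 b_small
  bN_small bN2_small gamE thE dE P0.
rewrite isotropic_functionalE Ric_Q // scal_Q //; move: (star A (Ric A)) => S; rewrite !mxE.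
by set X := picc _ _ _ _ _; set f := frobenius _ _; lra.
Qed.

Lemma pinching_boundary A j : G A -> functional j A + offset j = 0 -> 0 < functional j (Q A).
Proof.
case: j => [[]|] GA h.
- by apply: plane_boundary => //; move: h; rewrite addr0.
- exact: low_eigenvalue_boundary.
- exact: isotropic_boundary.
Qed.

End BoundaryDerivative.

(** * Choice of the parameters *)

Section CompactMargin.
Variables (R : realType) (n : nat) (K : set (tensor4 R n)).
Hypotheses (Kcompact : compact K) (KPIC : K `<=` interior_in (@curvature_tensor R n) (@PIC R n)).
Local Notation Id := (KN (1%:M : 'M[R]_n) 1%:M).

Lemma interior_PIC A : K A -> PIC A.
Proof. by move=> /KPIC[cA hA]; exact: (nbhs_singleton hA). Qed.

(** Interior points tolerate a small shift, uniformly near each point; compactness of [K] selects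
    one shift for all. *)
Lemma compact_PIC_margin : exists2 s : R, 0 < s & forall A, K A -> PIC (A - s *: Id).
Proof.
have H : \forall s \near (0 : R)^'+, K `<=` (fun A => curvature_tensor A -> PIC (A - s *: Id)).
  apply: ((compact_near_coveringP K).1 Kcompact) => A KA; have [cA hA] := KPIC KA.
  have hx : z.1 @[z --> filter_prod (nbhs A) (0 : R)^'+] --> A by exact: cvg_fst.
  have hs : z.2 @[z --> filter_prod (nbhs A) (0 : R)^'+] --> (0 : R).
    have h : z.2 @[z --> filter_prod (nbhs A) (0 : R)^'+] --> (0 : R)^'+ by exact: cvg_snd.
    by apply: cvg_trans h _; exact: cvg_within.
  have h : z.1 - z.2 *: Id @[z --> filter_prod (nbhs A) (0 : R)^'+] --> A - 0 *: Id.
    by apply: cvgB => //; apply: cvgZ => //; exact: cvg_cst.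
  rewrite scale0r subr0 in h.
  have hN : nbhs A [set B | curvature_tensor B -> PIC B] by exact: hA.
  have hh : \forall z \near filter_prod (nbhs A) (0 : R)^'+,
      curvature_tensor (z.1 - z.2 *: Id) -> PIC (z.1 - z.2 *: Id) by exact: (h _ hN).
  near=> z => cz.
  have : curvature_tensor (z.1 - z.2 *: Id) -> PIC (z.1 - z.2 *: Id) by near: z.
  apply.
  by apply: curvB => //; apply: curvZ; apply: curv_KN; rewrite trmx1.
have H0 : \forall s \near (0 : R)^'+, 0 < s by exact: nbhs_right_gt.
have [s [s0 hs]] := filter_ex (filterI H0 H).
by exists s => // A KA; apply: hs => //; have [] := KPIC KA.
Unshelve. all: by end_near.
Qed.

Lemma linear_scal : linear_functional (@scal R n).
Proof. by move=> x A B; rewrite scalD scalZ. Qed.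

Lemma compact_scal_bound : exists2 M : R, 1 <= M & forall A, K A -> scal A <= M.
Proof.
have H : \forall M \near +oo, K `<=` (fun A => scal A <= M).
  apply: ((compact_near_coveringP K).1 Kcompact) => A KA.
  have hx : z.1 @[z --> filter_prod (nbhs A) (+oo : set_system R)] --> A by exact: cvg_fst.
  have h1 : \forall z \near filter_prod (nbhs A) (+oo : set_system R), scal z.1 < scal A + 1.
    by apply: (cvgr_lt _ (cvg_linear linear_scal hx)); rewrite ltrDl.
  have h2 : \forall z \near filter_prod (nbhs A) (+oo : set_system R), scal A + 1 <= z.2.
    exact: (cvg_snd (nbhs_pinfty_ge (num_real (scal A + 1)))).
  near=> z; apply: (@le_trans _ _ (scal A + 1)); last by near: z.
  by apply: ltW; near: z.
have H1 : \forall M \near +oo, 1 <= M :> R by exact: nbhs_pinfty_ge.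
by have [M [M1 hM]] := filter_ex (filterI H1 H); exists M.
Unshelve. all: by end_near.
Qed.

End CompactMargin.

Lemma near_right0_mul_le (R : realType) (a c : R) : 0 < c -> \forall k \near 0^'+, a * k <= c.
Proof.
move=> c0; have a0 : 0 < `|a| + 1 by rewrite ltr_wpDl.
near=> k; have k0 : 0 < k by near: k; exact: nbhs_right_gt.
have : k < c / (`|a| + 1) by near: k; apply: nbhs_right_lt; rewrite divr_gt0.
rewrite ltr_pdivlMr // mulrC => /ltW; apply: le_trans.
by rewrite ler_pM2r //; apply: le_trans (ler_norm a) _; rewrite lerDl.
Unshelve. all: by end_near.
Qed.

Section Inclusion.
Variables (R : realType) (n : nat) (b del gam th N kap M : R) (o1 o2 o3 o4 : 'I_n).
Hypotheses (v1 : o1 = 0%N :> nat) (v2 : o2 = 1%N :> nat) (v3 : o3 = 2%N :> nat) (v4 : o4 = 3%N :> nat).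
Local Notation Id := (KN (1%:M : 'M[R]_n) 1%:M).
Hypotheses (n5 : (5 <= n)%N) (b_ge0 : 0 <= b) (del_gt0 : 0 < del) (gam_ge0 : 0 <= gam)
  (th_le : th <= b) (kap_ge0 : 0 <= kap).
Local Notation c1 := (1 / (16 * n%:R)).
Hypotheses (bM : M * b <= del) (kapM : n%:R * M * kap <= del) (NM : 2 * (n%:R * M) + 2 * del <= N).

Lemma picc_id_margin (A : tensor4 R n) s : picc (A - s *: Id) o1 o2 o3 o4 = picc A o1 o2 o3 o4 - 8 * s.
Proof.
rewrite -(picc_id R (standard_uniq v1 v2 v3 v4)); move: Id => X.
by rewrite /picc !(tcompD, tcompN, tcompZ); ring.
Qed.

(** Of the PIC margin 2 del, one half is the offset in (1) and the other absorbs b times the Ricci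
    terms. In (2) the margin gives T >= (8 n - 16) del against an error of at most 2 del; in (3) the
    bounds on Ricci are absorbed by N. *)
Lemma pinching_set_margin A : PIC A -> PIC (A - (2 * del) *: Id) -> scal A <= M ->
  pinching_set b del gam th N kap c1 o1 o2 o3 o4 A.
Proof.
move=> pA pD sM; have u4 := standard_uniq v1 v2 v3 v4.
have o12 : o1 != o2 by rewrite -val_eqE /= v1 v2.
split; first by case: pA.
move=> j g gO; have {}pA := PIC_pullback gO pA.
have {}pD : PIC (pullback g A - (2 * del) *: Id).
  by have := PIC_pullback gO pD; rewrite pullbackD pullbackN pullbackZ pullback_KN !mulmx1 gO.
rewrite -(scal_pullback A gO) in sM; move: (pullback g A) pA pD sM => B pB pD sM.
have s0 := PIC_scal_ge0 n5 pB.
have r_le i : Ric B i i <= M by apply: le_trans (PIC_Ric_le_scal n5 pB i) sM.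
have r_ge i : `|Ric B i i| <= n%:R * M.
  by apply: le_trans (PIC_Ric_bound n5 pB i) _; rewrite ler_wpM2l.
have del0 := del_gt0.
case: j => [[]|] /=.
- have T0 := plane_trace_ge0 n5 pD o12.
  rewrite (plane_trace pD o12) /sec in T0.
  have E i : Ric (B - (2 * del) *: Id) i i = Ric B i i - 2 * del * (2 * n%:R - 2).
    rewrite RicD -scaleN1r scalerA RicZ Ric_KN1 mxtrace1; move: (Ric B) => X.
    by rewrite !mxE eqxx mulr1n; ring.
  have E2 : tcomp (B - (2 * del) *: Id) o1 o2 o1 o2 = tcomp B o1 o2 o1 o2 - 4 * del.
    rewrite tcompD tcompN tcompZ KNE !idE !eqxx (negPf o12) eq_sym (negPf o12).
    by rewrite !mulr0 mulr1 mulr1n; ring.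
  rewrite !E E2 in T0.
  have n5R : 5 <= n%:R :> R by rewrite ler_nat.
  have nd : 5 * del <= n%:R * del by rewrite ler_pM2r.
  have := r_ge o1; have := r_ge o2; rewrite !ler_norml => /andP[_ h2] /andP[h1 _].
  have := ler_wpM2l kap_ge0 h1; have := ler_wpM2l kap_ge0 h2.
  have c1_ge0 : (0 : R) <= c1 by rewrite divr_ge0 // mulr_ge0.
  have := mulr_ge0 (mulr_ge0 kap_ge0 c1_ge0) s0.
  have kM := kapM; move: T0 nd kM; rewrite addr0.
  move: (Ric B o1 o1) (Ric B o2 o2) (tcomp _ _ _ _ _) (scal B) => x y t s.
  by move: (n%:R : R) => m; lra.
- have := r_ge o1; have := r_ge o2; rewrite !ler_norml => /andP[h1 _] /andP[h2 _].
  have : th * scal B <= del.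
    apply: (@le_trans _ _ (b * M)); last by rewrite mulrC.
    by apply: le_trans (ler_wpM2r s0 th_le) _; rewrite ler_wpM2l.
  by have := NM; move: h1 h2; lra.
- rewrite -/(pinching_functional b gam th kap c1 o1 o2 o3 o4 None _).
  rewrite isotropic_functionalE //.
  have P0 := PIC_picc_ge0 pD u4; rewrite picc_id_margin in P0.
  have := r_le o1; have := r_le o2; have := r_le o3; have := r_le o4.
  move: (Ric B o1 o1) (Ric B o2 o2) (Ric B o3 o3) (Ric B o4 o4) => x y z t ht hz hy hx.
  have := ler_wpM2l b_ge0 ht; have := ler_wpM2l b_ge0 hz; have := ler_wpM2l b_ge0 hy.
  have := ler_wpM2l b_ge0 hx; have := mulr_ge0 gam_ge0 s0; have h := bM; move: P0 h.
  by move: (picc _ _ _ _ _) (scal B) => p s; lra.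
Qed.

End Inclusion.

Lemma pinching_parameters (R : realType) (n : nat) (del M N : R) :
  (5 <= n)%N -> 0 < del ->
  exists kap b : R, [/\ 0 < kap, kap <= 1 / 3, 500 * n%:R ^+ 6 * kap <= (1 / (16 * n%:R)) ^+ 2
      & n%:R * M * kap <= del] /\
    [/\ 0 < b, 1000 * n%:R ^+ 2 * b <= 1, 1000 * (n%:R * (b * N)) <= del,
        1000 * n%:R ^+ 2 * b <= kap ^+ 2 & b * N ^+ 2 <= del ^+ 2 /\ M * b <= del].
Proof.
move=> n5 d0; have n0 : 0 < n%:R :> R by rewrite ltr0n (leq_trans _ n5).
near (0 : R)^'+ => kap.
have k0 : 0 < kap by near: kap; exact: nbhs_right_gt.
(* b comes after [kap], since one of its bounds is kap^2. *)
near (0 : R)^'+ => b.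
exists kap, b; split; split.
- exact: k0.
- have : 1 * kap <= 1 / 3 by near: kap; apply: near_right0_mul_le; rewrite divr_gt0.
  by rewrite mul1r.
- near: kap; apply: near_right0_mul_le; apply: exprn_gt0.
  by apply: divr_gt0; [exact: ltr01|apply: mulr_gt0].
- by near: kap; exact: near_right0_mul_le.
- by near: b; exact: nbhs_right_gt.
- by near: b; apply: near_right0_mul_le; exact: ltr01.
- have -> : 1000 * (n%:R * (b * N)) = 1000 * (n%:R * N) * b by ring.
  by near: b; exact: near_right0_mul_le.
- by near: b; apply: near_right0_mul_le; exact: exprn_gt0.
- split; last by near: b; exact: near_right0_mul_le.
  by rewrite mulrC; near: b; apply: near_right0_mul_le; exact: exprn_gt0.
Unshelve. all: by end_near.
Qed.

Theorem theorem2p1 (R : realType) (n : nat) (hn : (5 <= n)%N)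
    (K : set (tensor4 R n)) (Kcompact : compact K)
    (KPIC : K `<=` interior_in (@curvature_tensor R n) (@PIC R n))
    (T : R) (T_gt0 : 0 < T) :
  exists (theta N : R) (G : R -> set (tensor4 R n)),
    [/\ 0 < theta, 0 < N,
        continuous_family T G &
        forall t : R, 0 <= t <= T ->
          [/\ G t `<=` @curvature_tensor R n, closed (G t),
              convex_set (G t) & O_invariant (G t)]] /\
    [/\ Hamilton_invariant T G,
        K `<=` G 0 &
        forall t : R, 0 <= t <= T -> forall A, G t A ->
          PIC (A - (theta * scal A) *: KN 1%:M 1%:M) /\
          forall e1 e2 : 'rV[R]_n, orthonormal_frame [:: e1; e2] ->
            0 <= Ric_form A e1 e1 + Ric_form A e2 e2 - theta * scal A + N].
Proof.
have n0 : 0 < n%:R :> R by rewrite ltr0n (leq_trans _ hn).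
have n5 : 5 <= n%:R :> R by rewrite ler_nat.
have [s s0 Ks] := compact_PIC_margin Kcompact KPIC.
have [M M1 KM] := compact_scal_bound Kcompact.
(* [pinching_set_margin] consumes twice [del]. *)
pose del := s / 2; have d0 : 0 < del by rewrite divr_gt0.
(* The first summand serves the evolution of (3), the other two the inclusion of [K]. *)
pose N := 64 * (n%:R * del) + 2 * (n%:R * M) + 2 * del.
have nM : 0 < n%:R * M by rewrite mulr_gt0 // (lt_le_trans ltr01).
have nd : 0 < n%:R * del by rewrite mulr_gt0.
have N0 : 0 < N by rewrite /N; move: d0 nM nd; clear; lra.
have [kap [b [[k0 k3 ks kM] [b0 b1 bN bk [bN2 bM]]]]] := @pinching_parameters R n del M N hn d0.
pose gam := (1 / 2 + 1 / (4 * n%:R)) * b ^+ 2; pose th := (1 - 1 / (16 * n%:R)) * b.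
have [g0 _] : 0 <= gam /\ gam <= b ^+ 2 by exact: gam_bounds n5 erefl.
have [th0 thb] : 0 <= th /\ th <= b by exact: (th_bounds n5 b0 erefl).
have o k : (k < 5)%N -> {i : 'I_n | i = k :> nat}.
  by move=> k5; exists (Ordinal (leq_trans k5 hn)).
case: (o 0%N isT) => o1 v1; case: (o 1%N isT) => o2 v2.
case: (o 2%N isT) => o3 v3; case: (o 3%N isT) => o4 v4.
pose G0 := pinching_set b del gam th N kap (1 / (16 * n%:R)) o1 o2 o3 o4.
have Glin := @linear_pinching_functional R n b gam th kap (1 / (16 * n%:R)) o1 o2 o3 o4.
have NL : 64 * (n%:R * del) <= N by rewrite /N; move: d0 nM; clear; lra.
(* By [pinching_picc] isotropic curvatures are at least b^2 s, and id (.) id has isotropic curvature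
   8. *)
exists (b ^+ 2 / 8), N, (fun=> G0); split; split.
- by rewrite divr_gt0 // exprn_gt0.
- exact: N0.
- by move=> t0 _ r eps e0; near=> t; split=> A GA _; exists A; rewrite // subrr normr0.
- move=> t _; split.
  + by move=> A [].
  + exact: closed_barrier_set.
  + exact: convex_barrier_set.
  + by move=> g gO A GA; exact: barrier_set_pullback.
- move=> I X Iint sol t0 It0 _ X0 t It /andP[t0t _].
  apply: (barrier_set_invariant Glin _ Iint sol It0 It t0t X0) => A j GA.
  exact: (@pinching_boundary R n b del gam th N kap o1 o2 o3 o4).
- move=> A KA; apply: (@pinching_set_margin R n b del gam th N kap M) => //.
  + exact: ltW.
  + exact: ltW.
  + by rewrite /N; move: nd; clear; lra.
  + exact: (interior_PIC KPIC KA).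
  + by rewrite /del mulrC divfK //; exact: Ks.
  + exact: KM.
- move=> t _ A GA.
  have sA : 0 < scal A by apply: (pinching_scal_gt0 v1 v2 v3 v4) GA.
  split.
    have cA := pinching_curv GA; split.
      by apply: curvB => //; apply: curvZ; apply: curv_KN; rewrite trmx1.
    move=> e1 e2 e3 e4 eO; have [|g gO gr] := orthonormal_frame_extend _ eO; first exact: ltnW.
    have := @pinching_picc R n b del gam th N kap o1 o2 o3 o4 v1 v2 v3 v4 hn b0 d0 b1 erefl _
      (barrier_set_pullback gO GA).
    rewrite scal_pullback // => P.
    have : 0 <= picc (pullback g (A - (b ^+ 2 / 8 * scal A) *: KN 1%:M 1%:M)) o1 o2 o3 o4.
      rewrite pullbackD pullbackN pullbackZ pullback_KN !mulmx1 gO (picc_id_margin v1 v2 v3 v4).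
      by move: P; set p := picc _ _ _ _ _; clear; lra.
    by rewrite /picc !tcomp_pullback !gr ?v1 ?v2 ?v3 ?v4.
  move=> e1 e2 eO; have := pinching_low_eigenvalues v1 v2 v4 GA eO; rewrite !Ric_formE.
  have h : b ^+ 2 / 8 * scal A <= 2 * th * scal A.
    have bb : b * b <= b.
      by rewrite ler_piMl ?(ltW b0) //; move: b0 (small_b1 n5 b0 b1); clear; lra.
    have tb : b / 2 <= th.
      have [i0 i5] := inv_small n5; have := ler_wpM2r (ltW b0) i5.
      by rewrite (th_split n5 erefl : th = _); move: b0; clear; lra.
    have := ler_wpM2r (ltW sA) tb; have := ler_wpM2r (ltW sA) bb; have := mulr_ge0 (ltW b0) (ltW sA).
    by clear; rewrite expr2; lra.
  by move: h; clear; lra.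
Unshelve. all: by end_near.
Qed.
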